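(* Let $G$ be a discrete group, let $n\in\mathbb{N}$, and let $\alpha$ be a partial action of $G$ on a $C^*$-algebra $A$ with the $n$-decomposition property. Then for every $\tau\in\mathcal{T}_n(G)$, $$A_{G\cdot\tau}\rtimes_\alpha G\cong M_{m_\tau+1}(A_\tau\rtimes H_\tau).$$ In particular, $A\rtimes_\alpha G$ is a direct sum of algebras of the form $M_{m_\tau+1}(A_\tau\rtimes H_\tau)$, for $\tau\in\mathcal{T}_n(G)$.
   Context: Partial actions: a partial action $\alpha=((A_g)_{g\in G},(\alpha_g)_{g\in G})$ of a discrete group $G$ on a $C^*$-algebra $A$ consists of closed two-sided ideals $A_g$ of $A$ and $*$-isomorphisms $\alpha_g\colon A_{g^{-1}}\to A_g$ such that $A_1=A$, $\alpha_1=\mathrm{id}_A$, and $\alpha_{gh}$ extends $\alpha_g\circ\alpha_h$ wherever the composition is defined. It is global if $A_g=A$ for all $g$. Crossed product: $A\rtimes_\alpha G$ is the full partial crossed product, that is, the enveloping $C^*$-algebra of the $*$-algebra of finite sums $\sum_g a_g\delta_g$ with $a_g\in A_g$, with product $(a\delta_g)(b\delta_h)=\alpha_g(\alpha_{g^{-1}}(a)b)\delta_{gh}$ and involution $(a\delta_g)^*=\alpha_{g^{-1}}(a^* )\delta_{g^{-1}}$. Decomposition property: for $n\in\mathbb{N}=\{1,2,\ldots\}$ let $\mathcal{T}_n(G)=\{\tau\subseteq G\colon 1\in\tau,\ |\tau|=n\}$, and set $A_\tau=\bigcap_{g\in\tau}A_g$. The partial action $\alpha$ has the $n$-decomposition property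 if (a) $A=\overline{\sum_{\tau\in\mathcal{T}_n(G)}A_\tau}$, and (b) $A_\tau\cap A_g=\{0\}$ for all $\tau\in\mathcal{T}_n(G)$ and all $g\in G\setminus\tau$. For $\tau\in\mathcal{T}_n(G)$: $A_{G\cdot\tau}=\sum_{g\in\tau^{-1}}A_{g\tau}$ with $\tau^{-1}=\{g^{-1}\colon g\in\tau\}$ (a $G$-invariant ideal of $A$, carrying the restricted partial action with domains $A_{G\cdot\tau}\cap A_g$); $H_\tau=\{h\in G\colon h\tau=\tau\}$, a finite subgroup of $G$ whose order divides $n$ and which acts globally on $A_\tau$ by restricting $\alpha$; and $m_\tau=\frac{n}{|H_\tau|}-1$. *)

(* Defs.v *)
From HB Require Import structures.
From mathcomp Require Import all_boot all_order all_algebra finmap.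
From mathcomp Require Import all_classical all_reals all_analysis.
From mathcomp Require Import complex.
Set Implicit Arguments.
Unset Strict Implicit.
Unset Printing Implicit Defensive.
Import Order.TTheory GRing.Theory Num.Theory.
Import numFieldNormedType.Exports.
Local Open Scope classical_set_scope.
Local Open Scope ring_scope.

(* For [R : realType], [R[i]] is the field of complex numbers. *-algebras and
   C*-algebras are not assumed to be unital, so that the multiplication is not
   MathComp's ring multiplication. *)
HB.mixin Record Lmodule_isStarAlgebra (R : realType) A
    & GRing.Lmodule R[i] A := {
  amul : A -> A -> A ;
  astar : A -> A ;
  amulA : associative amul ;
  amulDl : left_distributive amul +%R ;
  amulDr : right_distributive amul +%R ;
  amulZl : forall (c : R[i]) x y, amul (c *: x) y = c *: amul x y ;
  amulZr : forall (c : R[i]) x y, amul x (c *: y) = c *: amul x y ;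
  astarK : involutive astar ;
  astarD : {morph astar : x y / x + y} ;
  astarZ : forall (c : R[i]) x, astar (c *: x) = Num.conj c *: astar x ;
  astarM : forall x y, astar (amul x y) = amul (astar y) (astar x)
}.

#[short(type="starAlgType")]
HB.structure Definition StarAlgebra (R : realType) :=
  {A of Lmodule_isStarAlgebra R A & GRing.Lmodule R[i] A}.

HB.mixin Record StarAlgebra_isCStar (R : realType) A
    & StarAlgebra R A & CompleteNormedModule R[i] A := {
  normr_amul : forall x y : A, `|amul x y| <= `|x| * `|y| ;
  cstar_identity : forall x : A, `|amul (astar x) x| = `|x| ^+ 2
}.

#[short(type="cstarAlgType")]
HB.structure Definition CStarAlgebra (R : realType) :=
  {A of StarAlgebra_isCStar R A & StarAlgebra R A & CompleteNormedModule R[i] A}.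

(* Multiplication and involution without axioms: this is how a *-algebra
   carried by a subset [S] of a vector space [V] is represented below; only the
   restriction of the operations to [S] is relevant. *)
Record star_ops (V : Type) := StarOps { op_mul : V -> V -> V ; op_star : V -> V }.

Definition ops_of (R : realType) (A : starAlgType R) : star_ops A :=
  StarOps (@amul R A) (@astar R A).

Definition star_hom_on (R : realType) (V W : lmodType R[i])
    (oV : star_ops V) (oW : star_ops W) (S : set V) (f : V -> W) : Prop :=
  [/\ forall x y, S x -> S y -> f (x + y) = f x + f y,
      forall (c : R[i]) x, S x -> f (c *: x) = c *: f x,
      forall x y, S x -> S y -> f (op_mul oV x y) = op_mul oW (f x) (f y)
    & forall x, S x -> f (op_star oV x) = op_star oW (f x)].

Definition star_hom (R : realType) (A B : starAlgType R) (f : A -> B) : Prop :=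
  star_hom_on (ops_of A) (ops_of B) setT f.

(* For C*-algebras a bijective *-homomorphism is automatically isometric. *)
Definition star_isomorphic (R : realType) (A B : starAlgType R) : Prop :=
  exists f : A -> B, star_hom f /\ bijective f.

(* Seminorms take values in [R[i]], as the norms of normed modules over [R[i]]
   do; [0 <= p x] forces the values to be real. *)
Definition cstar_seminorm_on (R : realType) (V : lmodType R[i])
    (o : star_ops V) (S : set V) (p : V -> R[i]) : Prop :=
  [/\ forall x, S x -> 0 <= p x,
      forall x y, S x -> S y -> p (x + y) <= p x + p y
    & forall (c : R[i]) x, S x -> p (c *: x) = `|c| * p x] /\
  [/\ forall x y, S x -> S y -> p (op_mul o x y) <= p x * p y,
      forall x, S x -> p (op_star o x) = p x
    & forall x, S x -> p (op_mul o (op_star o x) x) = p x ^+ 2].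

Definition cstar_norm (R : realType) (A : starAlgType R) (N : A -> R[i]) : Prop :=
  cstar_seminorm_on (ops_of A) setT N /\ forall x, N x = 0 -> x = 0.

(* [iota : S -> E] exhibits [E] as the enveloping C*-algebra of the *-algebra
   [S], i.e. as its Hausdorff completion for the largest C*-seminorm. *)
Definition is_enveloping (R : realType) (V : lmodType R[i]) (o : star_ops V)
    (S : set V) (E : cstarAlgType R) (iota : V -> E) : Prop :=
  [/\ star_hom_on o (ops_of E) S iota,
      closure (iota @` S) = setT
    & forall x, S x ->
        supremums [set p x | p in cstar_seminorm_on o S] `|iota x|].

Definition closed_ideal (R : realType) (A : cstarAlgType R) (I : set A) : Prop :=
  [/\ closed I, I 0,
      forall x y, I x -> I y -> I (x + y),
      forall (c : R[i]) x, I x -> I (c *: x)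
    & forall a x, I x -> I (amul a x) /\ I (amul x a)].

(* The sum of a family of subspaces indexed by [P]: all finite sums. *)
Definition subspace_sum (R : realType) (V : lmodType R[i]) (I : choiceType)
    (P : set I) (D : I -> set V) : set V :=
  [set x | exists (s : {fset I}) (f : I -> V),
    (forall i, i \in s -> P i /\ D i (f i)) /\ x = \sum_(i <- s) f i].

(* [pact a g] is a total function whose values outside [pdom a g^-1] are
   irrelevant. *)
Record partial_action (R : realType) (G : groupType) (A : cstarAlgType R) :=
  PartialAction {
    pdom : G -> set A ;
    pact : G -> A -> A ;
    pdom_ideal : forall g, closed_ideal (pdom g) ;
    pact_hom : forall g,
      star_hom_on (ops_of A) (ops_of A) (pdom g^-1%g) (pact g) ;
    pact_bij : forall g, set_bij (pdom g^-1%g) (pdom g) (pact g) ;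
    pdom1 : pdom 1%g = setT ;
    pact1 : forall x, pact 1%g x = x ;
    pact_ext : forall g h x,
      pdom h^-1%g x -> pdom g^-1%g (pact h x) ->
      pdom (g * h)^-1%g x /\ pact (g * h)%g x = pact g (pact h x)
  }.

Section CrossedProduct.
Variables (R : realType) (G : groupType) (A : cstarAlgType R).
Variable al : partial_action G A.
Implicit Types (x y : G -> A) (K : set G) (J : set A).

(* [x : G -> A] stands for the finite sum of the [x g] delta_g. For a subgroup
   [K] and a [K]-invariant ideal [J], [cp_carrier K J] is the *-algebra of finite
   sums of the partial action of [K] on [J] obtained by restriction, whose
   domains are the [J `&` pdom al g] for [g] in [K]. *)
Definition cp_carrier K J : set (G -> A) :=
  [set x | [/\ finite_set [set g | x g <> 0],
               forall g, x g <> 0 -> K g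
             & forall g, (J `&` pdom al g) (x g)]].

Definition cp_mul x y : G -> A := fun k =>
  \sum_(g \in [set: G])
    pact al g (amul (pact al g^-1%g (x g)) (y (g^-1 * k)%g)).

Definition cp_star x : G -> A := fun g => pact al g (astar (x g^-1%g)).

Definition is_crossed_product K J (E : cstarAlgType R) (iota : (G -> A) -> E) :=
  is_enveloping (StarOps cp_mul cp_star) (cp_carrier K J) iota.

End CrossedProduct.

(* In the usual notation, for a finite subset [t] of [G]: [tuples1 G n] is T_n(G),
   [ltrans g t] is gt, [tinv t] is t^-1, [tstab t] is H_t, [tmult n t] is m_t,
   [tdom al t] is A_t and [orbit_dom al t] is A_{G.t}. *)
Definition tuples1 (G : groupType) (n : nat) : set {fset G} :=
  [set t : {fset G} | (1%g \in t) && (#|` t| == n)].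
Arguments tuples1 : clear implicits.

Definition ltrans (G : groupType) (g : G) (t : {fset G}) : {fset G} :=
  [fset (g * h)%g | h in t]%fset.

Definition tinv (G : groupType) (t : {fset G}) : {fset G} :=
  [fset (h^-1)%g | h in t]%fset.

Definition tstab (G : groupType) (t : {fset G}) : set G :=
  [set h | ltrans h t = t].

(* [fset_set] is meaningful here because [tstab t] is finite for nonempty [t]. *)
Definition tmult (G : groupType) (n : nat) (t : {fset G}) : nat :=
  (n %/ #|` fset_set (tstab t)|).-1.

Definition tdom (R : realType) (G : groupType) (A : cstarAlgType R)
    (al : partial_action G A) (t : {fset G}) : set A :=
  \bigcap_(g in [set` t]) pdom al g.

Definition orbit_dom (R : realType) (G : groupType) (A : cstarAlgType R)
    (al : partial_action G A) (t : {fset G}) : set A :=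
  subspace_sum [set` tinv t] (fun g => tdom al (ltrans g t)).

Definition decomposition_property (R : realType) (G : groupType)
    (A : cstarAlgType R) (al : partial_action G A) (n : nat) : Prop :=
  closure (subspace_sum (tuples1 G n) (tdom al)) = setT /\
  forall t g, tuples1 G n t -> g \notin t -> tdom al t `&` pdom al g = [set 0].

(* M_k(A), as a *-algebra. When A is a C*-algebra it has a unique C*-norm (for
   which it is complete), which is not the entrywise norm of ['M_k]. *)
Definition cmatrix (R : realType) (A : starAlgType R) (k : nat) : Type := 'M[A]_k.

Section MatrixStarAlgebra.
Variables (R : realType) (A : starAlgType R) (k : nat).
Local Notation M := (cmatrix A k).
Implicit Types (x y z : M).

HB.instance Definition _ := GRing.Zmodule.on M.

Definition cmatrix_scale (c : R[i]) x : M := \matrix_(i, j) (c *: x i j).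

Fact cmatrix_scaleA a b x :
  cmatrix_scale a (cmatrix_scale b x) = cmatrix_scale (a * b) x.
Proof. by apply/matrixP => i j; rewrite !mxE scalerA. Qed.
Fact cmatrix_scale1 : left_id 1 cmatrix_scale.
Proof. by move=> x; apply/matrixP => i j; rewrite !mxE scale1r. Qed.
Fact cmatrix_scaleDr : right_distributive cmatrix_scale +%R.
Proof. by move=> c x y; apply/matrixP => i j; rewrite !mxE scalerDr. Qed.
Fact cmatrix_scaleDl x : {morph cmatrix_scale^~ x : a b / a + b}.
Proof. by move=> a b; apply/matrixP => i j; rewrite !mxE scalerDl. Qed.

HB.instance Definition _ := GRing.Zmodule_isLmodule.Build R[i] M
  cmatrix_scaleA cmatrix_scale1 cmatrix_scaleDr cmatrix_scaleDl.

Definition cmatrix_mul x y : M := \matrix_(i, j) \sum_l amul (x i l) (y l j).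
Definition cmatrix_star x : M := \matrix_(i, j) astar (x j i).

Let amul_suml (I : Type) (r : seq I) (F : I -> A) a :
  amul (\sum_(i <- r) F i) a = \sum_(i <- r) amul (F i) a.
Proof.
elim: r => [|i r IH]; last by rewrite !big_cons amulDl IH.
by rewrite !big_nil -(scale0r (0 : A)) amulZl !scale0r.
Qed.
Let amul_sumr (I : Type) (r : seq I) (F : I -> A) a :
  amul a (\sum_(i <- r) F i) = \sum_(i <- r) amul a (F i).
Proof.
elim: r => [|i r IH]; last by rewrite !big_cons amulDr IH.
by rewrite !big_nil -(scale0r (0 : A)) amulZr !scale0r.
Qed.
Let astar_sum (I : Type) (r : seq I) (F : I -> A) :
  astar (\sum_(i <- r) F i) = \sum_(i <- r) astar (F i).
Proof.
elim: r => [|i r IH]; last by rewrite !big_cons astarD IH.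
by rewrite !big_nil -(scale0r (0 : A)) astarZ conjC0 !scale0r.
Qed.

Fact cmatrix_mulA : associative cmatrix_mul.
Proof.
move=> x y z; apply/matrixP => i j; rewrite !mxE.
under eq_bigr do rewrite !mxE amul_sumr.
under [RHS]eq_bigr do rewrite !mxE amul_suml.
rewrite exchange_big; apply: eq_bigr => l _; apply: eq_bigr => m _.
by rewrite amulA.
Qed.
Fact cmatrix_mulDl : left_distributive cmatrix_mul +%R.
Proof.
move=> x y z; apply/matrixP => i j; rewrite !mxE -big_split.
by apply: eq_bigr => l _; rewrite !mxE amulDl.
Qed.
Fact cmatrix_mulDr : right_distributive cmatrix_mul +%R.
Proof.
move=> x y z; apply/matrixP => i j; rewrite !mxE -big_split.
by apply: eq_bigr => l _; rewrite !mxE amulDr.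
Qed.
Fact cmatrix_mulZl (c : R[i]) x y : cmatrix_mul (c *: x) y = c *: cmatrix_mul x y.
Proof.
apply/matrixP => i j; rewrite !mxE scaler_sumr.
by apply: eq_bigr => l _; rewrite !mxE amulZl.
Qed.
Fact cmatrix_mulZr (c : R[i]) x y : cmatrix_mul x (c *: y) = c *: cmatrix_mul x y.
Proof.
apply/matrixP => i j; rewrite !mxE scaler_sumr.
by apply: eq_bigr => l _; rewrite !mxE amulZr.
Qed.
Fact cmatrix_starK : involutive cmatrix_star.
Proof. by move=> x; apply/matrixP => i j; rewrite !mxE astarK. Qed.
Fact cmatrix_starD : {morph cmatrix_star : x y / x + y}.
Proof. by move=> x y; apply/matrixP => i j; rewrite !mxE astarD. Qed.
Fact cmatrix_starZ (c : R[i]) x :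
  cmatrix_star (c *: x) = Num.conj c *: cmatrix_star x.
Proof. by apply/matrixP => i j; rewrite !mxE astarZ. Qed.
Fact cmatrix_starM x y :
  cmatrix_star (cmatrix_mul x y) = cmatrix_mul (cmatrix_star y) (cmatrix_star x).
Proof.
apply/matrixP => i j; rewrite !mxE astar_sum.
by apply: eq_bigr => l _; rewrite !mxE astarM.
Qed.

HB.instance Definition _ := Lmodule_isStarAlgebra.Build R M
  cmatrix_mulA cmatrix_mulDl cmatrix_mulDr cmatrix_mulZl cmatrix_mulZr
  cmatrix_starK cmatrix_starD cmatrix_starZ cmatrix_starM.

End MatrixStarAlgebra.

(* [E] is *-isomorphic to the C*-algebraic (that is, c_0) direct sum of the
   C*-algebras [B i]: the [f i] are the coordinates of an injective
   *-homomorphism into the product of the [B i], whose image consists of the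
   families with norms tending to 0 at infinity. [N i] is the C*-norm of [B i],
   which is unique since [B i] is a C*-algebra. *)
Definition is_direct_sum (R : realType) (E : cstarAlgType R) (I : Type)
    (B : I -> starAlgType R) : Prop :=
  exists (N : forall i, B i -> R[i]) (f : forall i, E -> B i),
    [/\ forall i, cstar_norm (N i),
        forall i, star_hom (f i),
        forall x y, (forall i, f i x = f i y) -> x = y
      & forall b : forall i, B i,
          (exists x, forall i, f i x = b i) <->
          (forall e : R[i], 0 < e -> finite_set [set i | e <= N i (b i)])].

(* Main.v *)
Require Import Defs.
From HB Require Import structures.
From mathcomp Require Import all_boot all_order all_algebra finmap.
From mathcomp Require Import all_classical all_reals all_analysis.
From mathcomp Require Import complex ring lra.
Set Implicit Arguments.
Unset Strict Implicit.
Unset Printing Implicit Defensive.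
Import Order.TTheory GRing.Theory Num.Theory.
Import numFieldNormedType.Exports.
Local Open Scope classical_set_scope.
Local Open Scope ring_scope.

(** Why the theorem holds. Condition (b) makes the ideals A_s, for s in T_n(G),
    pairwise orthogonal, and condition (a) says that they span a dense subspace, so
    that A is their orthogonal sum and there is a *-homomorphic projection [pr] of A
    onto each A_s ([component_exists], [pr_star], [pr_approx]). The projections
    intertwine the action: alpha_g maps A_s onto A_{gs} for g^-1 in s ([pr_act]),
    and they kill the domains A_g with g outside s.

    Fix t and representatives g_1, ..., g_k in t^-1 of the left cosets of the
    stabilizer H. The summands of A_{G.t} are the A_{g_i t}, and the elements of
    g_i t are the g_i h g_j^-1 with h in H, each obtained once. So a coefficient
    a delta_g with a in A_{g_i t} and g = g_i h g_j^-1 corresponds to the matrix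
    unit (i, j) tensored with alpha_{g_i}^-1(a) delta_h, and this identifies the
    *-algebra of finite sums over A_{G.t} with k x k matrices over the one of H
    acting on A_t ([Phi], [Psi], [PhiM], [Phi_star], [PhiPsi], [PsiPhi]).

    To pass to the enveloping C*-algebras E and B one compares largest
    C*-seminorms. Restricted to the (i, i) corner, the norm of E is a C*-seminorm on
    the *-algebra enveloped by B, hence is dominated by the norm of B. Conversely,
    M_k(B) must carry a C*-norm, so that the norm of E dominates it. This is where
    the positivity of x*x enters: it makes B^k a Hilbert module on which matrices
    act by bounded operators. Square roots are obtained from the recursion
    r = (v + r^2)/2 ([sqrt_exists]), positivity of x*x from Kaplansky's argument in
    the unitization ([pos_star_mul]), and the norm is [mnorm]. Both comparisons
    extend by continuity to inverse *-isomorphisms ([corner_iso]).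

    For the second part, the same maps realize each M_k(B_t) as a closed ideal of
    the full crossed product E, one for each orbit of T_n(G). Ideals of distinct
    orbits are orthogonal, and together they span a dense subspace since
    C*-seminorms on A are dominated by its norm ([seminorm_contractive]). The norm
    of an orthogonal sum is the supremum of the norms of its terms
    ([nr_orth_sum]), so E is the c_0-direct sum of these ideals. *)

(** * Real-valued norms *)

Section RealNorm.
Variables (R : realType) (E : normedModType R[i]).
Implicit Types x y : E.

(** Norms are compared in [R], where the order is total, rather than in [R[i]]. *)
Definition nr x : R := complex.Re `|x|.

Lemma nrE x : `|x| = (nr x)%:C%C.
Proof. by rewrite /nr RRe_real ?ger0_real. Qed.

Lemma nr_ge0 x : 0 <= nr x.
Proof. by rewrite -lecR -nrE normr_ge0. Qed.

Lemma nr0 : nr 0 = 0.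
Proof. by apply: complexI; rewrite -nrE normr0. Qed.

Lemma nr_eq0 x : nr x = 0 -> x = 0.
Proof. by move=> x0; apply/normr0_eq0; rewrite nrE x0. Qed.

Lemma nrD x y : nr (x + y) <= nr x + nr y.
Proof. by rewrite -lecR rmorphD /= -!nrE ler_normD. Qed.

Lemma nrN x : nr (- x) = nr x.
Proof. by rewrite /nr normrN. Qed.

Lemma nrB x y : nr (x - y) <= nr x + nr y.
Proof. by rewrite -(nrN y) nrD. Qed.

Lemma nr_distC x y : nr (x - y) = nr (y - x).
Proof. by rewrite -nrN opprB. Qed.

Lemma nr_distD z x y : nr (x - y) <= nr (x - z) + nr (z - y).
Proof. by rewrite -{1}(subrKA z) nrD. Qed.

Lemma nrZ (c : R) x : nr (c%:C%C *: x) = `|c| * nr x.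
Proof.
apply: complexI; rewrite -nrE normrZ rmorphM /= -nrE; congr (_ * _).
by rewrite normc_def /= expr0n addr0 sqrtr_sqr.
Qed.

Lemma nrZ_pos (c : R) x : 0 <= c -> nr (c%:C%C *: x) = c * nr x.
Proof. by move=> c0; rewrite nrZ ger0_norm. Qed.

Lemma nr_sum (I : Type) (s : seq I) (P : pred I) (f : I -> E) :
  nr (\sum_(i <- s | P i) f i) <= \sum_(i <- s | P i) nr (f i).
Proof.
elim: s => [|i s IH]; first by rewrite !big_nil nr0.
rewrite !big_cons; case: (P i) => //.
by apply: (le_trans (nrD _ _)); rewrite lerD2l.
Qed.

Lemma le_eps0 (a : R) : (forall e, 0 < e -> a <= e) -> a <= 0.
Proof.
move=> h; rewrite leNgt; apply/negP => a0.
by have := h (a / 2) ltac:(lra); lra.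
Qed.

Lemma nr_small0 x (C : R) : (forall e, 0 < e -> nr x <= C * e) -> x = 0.
Proof.
move=> h; apply: nr_eq0; apply/eqP; rewrite eq_le nr_ge0 andbT.
apply: le_eps0 => e e0; have C1 : 0 < `|C| + 1 by rewrite ltr_wpDl.
apply: (le_trans (h (e / (`|C| + 1)) _)); first by rewrite divr_gt0.
rewrite mulrA ler_pdivrMr // mulrC ler_pM2l //.
by have := ler_norm C; lra.
Qed.

Lemma closed_approx (I : set E) x :
  closed I -> (forall e, 0 < e -> exists2 y, I y & nr (x - y) <= e) -> I x.
Proof.
move=> cI h; apply: cI => U /nbhs_ballP [e e0 eU].
have eR : e \is Num.real by rewrite gtr0_real.
have e'0 : 0 < complex.Re e by rewrite -ltcR RRe_real.
have [y Iy xy] := h (complex.Re e / 2) ltac:(lra).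
exists y; split=> //; apply: eU; rewrite -ball_normE /ball_ /= nrE -(RRe_real eR) ltcR; lra.
Qed.

Lemma closure_approx (I : set E) x :
  closure I x -> forall e : R, 0 < e -> exists2 y, I y & nr (x - y) <= e.
Proof.
move=> cI e e0.
have := cI (ball x e%:C%C) (nbhsx_ballx _ _ _); rewrite ltcR => /(_ e0)[y [Iy xy]].
exists y => //; apply: ltW; move: xy; rewrite -ball_normE /ball_ /= nrE ltcR //.
Qed.

End RealNorm.

(** Completeness without a choice of Cauchy sequence: [P e y] is to be read as [y]
    approximates the limit up to [e], and consistency of these claims suffices. *)
Lemma complete_approx (R : realType) (E : completeNormedModType R[i])
    (P : R -> E -> Prop) :
  (forall e : R, 0 < e -> exists y, P e y) ->
  (forall e d y z, P e y -> P d z -> nr (y - z) <= e + d) ->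
  exists l, forall e y, P e y -> nr (y - l) <= e.
Proof.
move=> exP P_dist.
have /choice [u Pu] : forall k : nat, exists y, P k.+1%:R^-1 y.
  by move=> k; apply: exP; rewrite invr_gt0.
pose F := u k @[k --> \oo].
have FF : ProperFilter F by apply: fmap_proper_filter.
have small (e : R) : 0 < e -> exists N : nat, N.+1%:R^-1 < e.
  move=> e0; exists (Num.bound e^-1).
  rewrite invf_plt ?posrE //.
  apply: (lt_le_trans (archi_boundP _)); first by rewrite invr_ge0 ltW.
  by rewrite ler_nat.
have inv_le (N n : nat) : (N <= n)%N -> n.+1%:R^-1 <= N.+1%:R^-1 :> R.
  by move=> Nn; rewrite lef_pV2 ?posrE // ler_nat.
have cF : cauchy F.
  apply: cauchy_exP => e e0.
  have eR : e \is Num.real by rewrite gtr0_real.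
  have e'0 : 0 < complex.Re e by rewrite -ltcR RRe_real.
  have [N NE] := small (complex.Re e / 2) ltac:(lra).
  exists (u N); exists N => // n /= Nn.
  rewrite -ball_normE /ball_ /= nrE -(RRe_real eR) ltcR.
  apply: le_lt_trans (P_dist _ _ _ _ (Pu N) (Pu n)) _.
  move: (inv_le _ _ Nn) NE; move: (N.+1%:R^-1) (n.+1%:R^-1) => a b ab aE.
  by lra.
have [l Fl] : exists l : E, F --> l by apply/cvg_ex; exact: cauchy_cvg.
exists l => e y Py; rewrite -subr_le0; apply: le_eps0 => d d0.
have /cvgrPdist_lt /(_ (d / 2)%:C%C) := Fl.
rewrite ltcR => /(_ ltac:(lra)) [N _ hN].
have [M ME] := small (d / 2) ltac:(lra).
have /= := hN (maxn N M) (leq_maxl _ _); rewrite nrE ltcR nr_distC => h1.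
have := P_dist _ _ _ _ Py (Pu (maxn N M)).
move: (inv_le _ _ (leq_maxr N M)) ME (nr_distD (u (maxn N M)) y l).
by move: (M.+1%:R^-1) ((maxn N M).+1%:R^-1) => a b; lra.
Qed.

(** * *-algebras and C*-seminorms *)

Section StarAlgebra.
Variables (R : realType) (A : starAlgType R).
Implicit Types x y z : A.

Lemma amul0l y : amul (0 : A) y = 0.
Proof. by rewrite -(scale0r (0 : A)) amulZl !scale0r. Qed.
Lemma amul0r y : amul y (0 : A) = 0.
Proof. by rewrite -(scale0r (0 : A)) amulZr !scale0r. Qed.
Lemma amulNl x y : amul (- x) y = - amul x y.
Proof. by rewrite -scaleN1r amulZl scaleN1r. Qed.
Lemma amulNr x y : amul x (- y) = - amul x y.
Proof. by rewrite -scaleN1r amulZr scaleN1r. Qed.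
Lemma amulBl x y z : amul (x - y) z = amul x z - amul y z.
Proof. by rewrite amulDl amulNl. Qed.
Lemma amulBr x y z : amul z (x - y) = amul z x - amul z y.
Proof. by rewrite amulDr amulNr. Qed.
Lemma astar0 : astar (0 : A) = 0.
Proof. by rewrite -(scale0r (0 : A)) astarZ conjC0 !scale0r. Qed.
Lemma astarN x : astar (- x) = - astar x.
Proof. by rewrite -scaleN1r astarZ rmorphN rmorph1 scaleN1r. Qed.
Lemma astarB x y : astar (x - y) = astar x - astar y.
Proof. by rewrite astarD astarN. Qed.
Lemma astarZr (c : R) x : astar (c%:C%C *: x) = c%:C%C *: astar x.
Proof. by rewrite astarZ conj_Creal // complex_real. Qed.
Lemma astarZi x : astar ('i%C *: x) = - ('i%C *: astar x).
Proof.
by rewrite astarZ -scaleNr; congr (_ *: _); exact: conjCi.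
Qed.

Lemma amul_suml (I : Type) (r : seq I) (P : pred I) (F : I -> A) y :
  amul (\sum_(i <- r | P i) F i) y = \sum_(i <- r | P i) amul (F i) y.
Proof.
apply: (big_morph (fun x => amul x y)); last exact: amul0l.
by move=> ? ?; rewrite amulDl.
Qed.
Lemma amul_sumr (I : Type) (r : seq I) (P : pred I) (F : I -> A) y :
  amul y (\sum_(i <- r | P i) F i) = \sum_(i <- r | P i) amul y (F i).
Proof.
apply: (big_morph (amul y)); last exact: amul0r.
by move=> ? ?; rewrite amulDr.
Qed.
Lemma astar_sum (I : Type) (r : seq I) (P : pred I) (F : I -> A) :
  astar (\sum_(i <- r | P i) F i) = \sum_(i <- r | P i) astar (F i).
Proof. by apply: big_morph => [? ?|]; rewrite ?astarD ?astar0. Qed.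

Lemma scaleii x : 'i%C *: ('i%C *: x) = - x.
Proof. by rewrite scalerA -expr2 sqr_i scaleN1r. Qed.

Lemma realC_half_double x : (2%:R^-1 : R)%:C%C *: (x + x) = x.
Proof.
rewrite -[in X in _ *: X](scale1r x) -scalerDl scalerA.
have -> : (2%:R^-1)%:C%C * (1 + 1) = 1 :> R[i]; last by rewrite scale1r.
have -> : 1 + 1 = (2%:R)%:C%C :> R[i] by rewrite rmorphMn rmorph1.
by rewrite -rmorphM mulVf ?rmorph1 // pnatr_eq0.
Qed.

(** The algebra behind (a + is)*(a + is) = a*a + s*s for commuting self-adjoint
    elements; the form of the hypothesis makes it applicable to elements of a left
    ideal too. *)
Lemma cartesian_square x y : amul (astar x) y = amul (astar y) x ->
  amul (astar (x + 'i%C *: y)) (x + 'i%C *: y) =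
    amul (astar x) x + amul (astar y) y.
Proof.
move=> xy; rewrite astarD astarZi amulDl !amulDr !amulNl !amulZl !amulZr xy.
by rewrite scaleii opprK addrA addrK.
Qed.

End StarAlgebra.

Definition rcstar_seminorm_on (R : realType) (V : lmodType R[i])
    (o : star_ops V) (S : set V) (p : V -> R) : Prop :=
  [/\ forall x, S x -> 0 <= p x,
      forall x y, S x -> S y -> p (x + y) <= p x + p y
    & forall (c : R[i]) x, S x -> p (c *: x) = complex.Re `|c| * p x] /\
  [/\ forall x y, S x -> S y -> p (op_mul o x y) <= p x * p y,
      forall x, S x -> p (op_star o x) = p x
    & forall x, S x -> p (op_mul o (op_star o x) x) = p x ^+ 2].

Lemma normC_ReE (R : realType) (c : R[i]) : `|c| = (complex.Re `|c|)%:C%C.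
Proof. by rewrite RRe_real ?ger0_real. Qed.

Lemma Re_norm_ge0 (R : realType) (l : R[i]) : 0 <= complex.Re `|l|.
Proof. by rewrite -ler0c -normC_ReE. Qed.

Lemma Re_normD (R : realType) (l m : R[i]) :
  complex.Re `|l + m| <= complex.Re `|l| + complex.Re `|m|.
Proof. by rewrite -lecR rmorphD -!normC_ReE ler_normD. Qed.

Lemma Re_normM (R : realType) (l m : R[i]) :
  complex.Re `|l * m| = complex.Re `|l| * complex.Re `|m|.
Proof. by apply: complexI; rewrite rmorphM -!normC_ReE normrM. Qed.

Lemma Re_normV (R : realType) (l : R[i]) :
  complex.Re `|l^-1| = (complex.Re `|l|)^-1.
Proof.
have [->|l0] := eqVneq l 0; first by rewrite invr0 normr0 invr0.
have l_neq0 : complex.Re `|l| != 0.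
  by rewrite -(inj_eq (@complexI R)) -normC_ReE normr_eq0.
by apply: (mulfI l_neq0); rewrite -Re_normM !mulfV ?normr1.
Qed.

Lemma complex_cstar_seminorm (R : realType) (V : lmodType R[i])
    (o : star_ops V) (S : set V) (p : V -> R) :
  rcstar_seminorm_on o S p -> cstar_seminorm_on o S (fun x => (p x)%:C%C).
Proof.
move=> [[p0 pD pZ] [pM ps pc]]; split; split.
- by move=> x Sx; rewrite ler0c p0.
- by move=> x y Sx Sy; rewrite -rmorphD lecR pD.
- by move=> c x Sx; rewrite pZ // rmorphM /= -normC_ReE.
- by move=> x y Sx Sy; rewrite -rmorphM lecR pM.
- by move=> x Sx; rewrite ps.
- by move=> x Sx; rewrite pc // rmorphXn.
Qed.

Lemma cstar_seminorm_pullback (R : realType) (V : lmodType R[i])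
    (oV : star_ops V) (S : set V) (B : starAlgType R) (f : V -> B) (p : B -> R) :
  (forall x, S x -> S (op_star oV x)) ->
  star_hom_on oV (ops_of B) S f -> rcstar_seminorm_on (ops_of B) setT p ->
  rcstar_seminorm_on oV S (fun x => p (f x)).
Proof.
move=> Ss [fD fZ fM fs] [[p0 pD pZ] [pM ps pc]]; split; split.
- by move=> x Sx; apply: p0.
- by move=> x y Sx Sy; rewrite fD //; apply: pD.
- by move=> c x Sx; rewrite fZ // pZ.
- by move=> x y Sx Sy; rewrite fM //; apply: pM.
- by move=> x Sx; rewrite fs //; apply: ps.
- by move=> x Sx; rewrite fM ?fs ?pc //; apply: Ss.
Qed.

Section CStarNorm.
Variables (R : realType) (A : cstarAlgType R).
Implicit Types x y z : A.

Lemma nrM x y : nr (amul x y) <= nr x * nr y.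
Proof. by rewrite -lecR rmorphM /= -!nrE normr_amul. Qed.

Lemma nr_cstar x : nr (amul (astar x) x) = nr x ^+ 2.
Proof. by apply: complexI; rewrite -nrE cstar_identity nrE rmorphXn. Qed.

Lemma nr_star x : nr (astar x) = nr x.
Proof.
have le_star y : nr y <= nr (astar y).
  have [->|y0] := eqVneq (nr y) 0; first exact: nr_ge0.
  have y_gt0 : 0 < nr y by rewrite lt_neqAle eq_sym y0 nr_ge0.
  by rewrite -(ler_pM2r y_gt0) -expr2 -nr_cstar nrM.
by apply/eqP; rewrite eq_le le_star andbT -{2}(astarK x) le_star.
Qed.

Lemma nr_cstarr x : nr (amul x (astar x)) = nr x ^+ 2.
Proof. by rewrite -{1}(astarK x) nr_cstar nr_star. Qed.

Lemma cstar_eq0 x : amul (astar x) x = 0 -> x = 0.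
Proof.
move=> xx; apply: nr_eq0; have /esym/eqP := nr_cstar x.
by rewrite xx nr0 sqrf_eq0 => /eqP.
Qed.

Lemma cstar_eq0r x : amul x (astar x) = 0 -> x = 0.
Proof.
by rewrite -{1}(astarK x) => /cstar_eq0 /(congr1 astar); rewrite astarK astar0.
Qed.

Lemma nrZc (c : R[i]) x : nr (c *: x) = complex.Re `|c| * nr x.
Proof.
by apply: complexI; rewrite -nrE normrZ rmorphM /= -nrE -normC_ReE.
Qed.

Lemma nr_cstar_seminorm : rcstar_seminorm_on (ops_of A) setT (@nr R A).
Proof.
split; split=> *; [exact: nr_ge0 | exact: nrD | exact: nrZc | exact: nrM
  | exact: nr_star | exact: nr_cstar].
Qed.

End CStarNorm.

(** * Square roots *)

(** With [x] and [s] self-adjoint and commuting, x is the half-sum of x + is and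
    x - is, whose squared norms are both p(x*x + s*s). *)
Lemma seminorm_cartesian (R : realType) (A : starAlgType R) (p : A -> R) x s :
  rcstar_seminorm_on (ops_of A) setT p ->
  amul (astar x) s = amul (astar s) x ->
  p x ^+ 2 <= p (amul (astar x) x + amul (astar s) s).
Proof.
move=> [[p0 pD pZ] [_ _ pc]] xs.
set n := p (_ + _); pose u := x + 'i%C *: s; pose v := x + 'i%C *: (- s).
have pu : p u ^+ 2 = n by rewrite -pc //= cartesian_square.
have pv : p v ^+ 2 = n.
  rewrite -pc //= cartesian_square; last by rewrite amulNr astarN amulNl xs.
  by rewrite astarN amulNl amulNr opprK.
have n0 : 0 <= n by rewrite -pu sqr_ge0.
have /esym pu' : p u = Num.sqrt n by rewrite -pu sqrtr_sqr ger0_norm ?p0.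
have /esym pv' : p v = Num.sqrt n by rewrite -pv sqrtr_sqr ger0_norm ?p0.
suff xn : p x <= Num.sqrt n.
  by rewrite -(sqr_sqrtr n0) lerXn2r ?nnegrE ?sqrtr_ge0 ?p0.
have -> : x = (2^-1 : R)%:C%C *: (u + v).
  by rewrite addrACA -scalerDr subrr scaler0 addr0 realC_half_double.
rewrite pZ // normc_def /= expr0n addr0 sqrtr_sqr ger0_norm ?invr_ge0 //.
have := pD u v I I; rewrite -pu' -{1}pv' => uv.
rewrite ler_pdivrMl //; lra.
Qed.

Section SquareRoot.
Variables (R : realType) (A : cstarAlgType R).

Fixpoint sqrt_iter (v : A) (k : nat) : A :=
  if k is k'.+1 then (2^-1 : R)%:C%C *: (v + amul (sqrt_iter v k') (sqrt_iter v k'))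
  else 0.

(** The same recursion for v = 1 in the scalars. It dominates [sqrt_iter] and
    increases to 1, also for [nr v = 1], where the recursion does not contract. *)
Fixpoint sqrt_bound (k : nat) : R :=
  if k is k'.+1 then 2^-1 * (1 + sqrt_bound k' ^+ 2) else 0.

Lemma sqrt_bound_itv k : 0 <= sqrt_bound k <= 1.
Proof. by elim: k => [|k /andP[a b]] /=; [lra | nra]. Qed.

Lemma sqrt_bound_incr k : sqrt_bound k <= sqrt_bound k.+1.
Proof. by rewrite /=; move: (sqrt_bound k) (sqrt_bound_itv k) => a; nra. Qed.

Lemma sqrt_bound_cvg (e : R) : 0 < e -> exists k, 1 - sqrt_bound k <= e.
Proof.
move=> e0.
have h k : (1 - sqrt_bound k) * k.+2%:R <= 2.
  elim: k => [|k IH] /=; first by lra.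
  move: (sqrt_bound k) (sqrt_bound_itv k) IH => a a01.
  rewrite -[k.+3]addn1 -[k.+2]addn2 !natrD.
  have := ler0n R k; move: (k%:R) => t t0 IH.
  have ->: 1 - 2^-1 * (1 + a ^+ 2) = (1 - a) * (1 + a) / 2 by field.
  nra.
have [k kE] : exists k : nat, 2 / e < k%:R.
  by exists (Num.bound (2 / e)); apply: archi_boundP; rewrite divr_ge0 ?ltW.
exists k; rewrite -(@ler_pM2r _ k.+2%:R) //; apply: le_trans (h k) _.
move: kE; rewrite ltr_pdivrMr // mulrC => /ltW /le_trans; apply.
by rewrite ler_pM2l // ler_nat -addn2 leq_addr.
Qed.

Variable v : A.
Hypotheses (v_sa : astar v = v) (v_le1 : nr v <= 1).
Local Notation r := (sqrt_iter v).
Local Notation rho := sqrt_bound.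

Let r_le k : nr (r k) <= rho k.
Proof.
elim: k => [|k IH] /=; first by rewrite nr0.
rewrite nrZ_pos ?invr_ge0 // ler_pM2l ?invr_gt0 //.
apply: le_trans (nrD _ _) _; apply: lerD => //; apply: le_trans (nrM _ _) _.
by rewrite expr2; apply: ler_pM => //; apply: nr_ge0.
Qed.

Let r_step k : nr (r k.+1 - r k) <= rho k.+1 - rho k.
Proof.
elim: k => [|k IH]; first by rewrite subr0 subr0 r_le.
have -> : r k.+2 - r k.+1 = (2^-1 : R)%:C%C *:
    (amul (r k.+1 - r k) (r k.+1) + amul (r k) (r k.+1 - r k)).
  rewrite {1}/sqrt_iter -/sqrt_iter [in X in _ - X]/= -scalerBr; congr (_ *: _).
  by rewrite opprD addrACA subrr add0r amulBl amulBr subrKA.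
have -> : rho k.+2 - rho k.+1 =
    2^-1 * ((rho k.+1 - rho k) * rho k.+1 + rho k * (rho k.+1 - rho k)).
  by rewrite /=; move: (rho k) => a; field.
rewrite nrZ_pos ?invr_ge0 // ler_pM2l ?invr_gt0 //.
apply: le_trans (nrD _ _) _; apply: lerD.
  apply: le_trans (nrM _ _) _; apply: ler_pM => //; try exact: nr_ge0.
apply: le_trans (nrM _ _) _; apply: ler_pM => //; try exact: nr_ge0.
Qed.

Let r_dist k m : (k <= m)%N -> nr (r m - r k) <= rho m - rho k.
Proof.
move=> /subnK <-; elim: (m - k)%N => [|d IH]; first by rewrite !subrr nr0.
rewrite addSn; have := nr_distD (r (d + k)) (r (d + k).+1) (r k).
by have := r_step (d + k); move: (rho _.+1) (rho (d + k)) IH => *; lra.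
Qed.

(** r = 1 - s, where s is the square root of 1 - v; since it lies in the closed
    subalgebra generated by [v], no unit is needed. *)
Lemma sqrt_exists : exists r : A,
  [/\ astar r = r, nr r <= 1, v + amul r r = r + r
    & forall z, amul z v = amul v z -> amul z r = amul r z].
Proof.
pose P (e : R) y := exists2 k, y = r k & 1 - rho k <= e.
have [e e0|e d y z|l Pl] := complete_approx (P := P).
- by have [k ke] := sqrt_bound_cvg e0; exists (r k), k.
- move=> [k -> ke] [m -> md].
  have := sqrt_bound_itv k; have := sqrt_bound_itv m.
  have [km|/ltnW mk] := leqP k m.
    by rewrite nr_distC; have := r_dist km; lra.
  by have := r_dist mk; lra.
have rl k : nr (r k - l) <= 1 - rho k by apply: Pl; exists k.
have eq_lim (C : R) (x : A) : (forall k, nr x <= C * (1 - rho k)) -> x = 0.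
  move=> h; apply: (@nr_small0 _ _ _ `|C|) => e e0.
  have [k ke] := sqrt_bound_cvg e0; apply: le_trans (h k) _.
  have := sqrt_bound_itv k; have := ler_norm C; have := normr_ge0 C.
  by move: (rho k) `|C| ke => *; nra.
have l1 : nr l <= 1 by have := rl 0; rewrite sub0r nrN subr0.
exists l; split=> //.
- apply/eqP; rewrite -subr_eq0; apply/eqP; apply: (eq_lim 2) => k.
  have r_sa : astar (r k) = r k.
    elim: k => [|k IH] /=; first exact: astar0.
    by rewrite astarZr astarD astarM IH v_sa.
  have := nr_distD (r k) (astar l) l; rewrite -{1}r_sa -astarB nr_star.
  by rewrite (nr_distC l); have := rl k; lra.
- apply/eqP; rewrite eq_sym -subr_eq0; apply/eqP; apply: (eq_lim 4) => k.
  have rS : v + amul (r k) (r k) = r k.+1 + r k.+1.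
    by rewrite [r k.+1]/= -scalerDr realC_half_double.
  have -> : l + l - (v + amul l l) = (l - r k.+1) + (l - r k.+1) +
     (amul (r k - l) (r k) + amul l (r k - l)).
    rewrite amulBl amulBr subrKA [l - _ + _]addrACA -opprD -rS.
    by rewrite !opprD !addrA subrK.
  have := nrD ((l - r k.+1) + (l - r k.+1)) (amul (r k - l) (r k) + amul l (r k - l)).
  have := nrD (l - r k.+1) (l - r k.+1).
  have := nrD (amul (r k - l) (r k)) (amul l (r k - l)).
  have := nrM (r k - l) (r k); have := nrM l (r k - l).
  have := rl k; have := rl k.+1; have := r_le k; have := sqrt_bound_itv k.
  have := sqrt_bound_incr k; rewrite (nr_distC l).
  have := nr_ge0 (r k - l); have := nr_ge0 l; have := nr_ge0 (r k).
  move: (nr (r k - l)) (nr (r k)) (rho k) (rho k.+1) (nr l) l1 => *; nra.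
- move=> z zv; apply/eqP; rewrite -subr_eq0; apply/eqP; apply: (eq_lim (2 * nr z)) => k.
  have zr : amul z (r k) = amul (r k) z.
    elim: k => [|k IH] /=; first by rewrite amul0l amul0r.
    rewrite amulZl amulZr amulDl amulDr zv; congr (_ *: (_ + _)).
    by rewrite amulA IH -amulA IH amulA.
  have -> : amul z l - amul l z = amul z (l - r k) + amul (r k - l) z.
    by rewrite amulBl amulBr zr subrKA.
  have := nrD (amul z (l - r k)) (amul (r k - l) z).
  have := nrM z (l - r k); have := nrM (r k - l) z; rewrite (nr_distC l).
  have := rl k; have := nr_ge0 z.
  by move: (nr (r k - l)) (nr z) (rho k) => *; nra.
Qed.

End SquareRoot.

(** A unitary multiplier: with r as in [sqrt_exists] for v = b*b, b + i(1 - r)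
    preserves the seminorm, and [b] is half the sum of it and its adjoint. *)
Lemma seminorm_contractive (R : realType) (A : cstarAlgType R) (p : A -> R) :
  rcstar_seminorm_on (ops_of A) setT p -> forall x, p x <= nr x.
Proof.
move=> pS x; have [[p0 pD pZ] [pM ps pc]] := pS.
have unit_ball b : astar b = b -> nr b <= 1 -> p b <= 1.
  move=> b_sa b1.
  have v1 : nr (amul b b) <= 1 by have := nrM b b; have := nr_ge0 b; nra.
  have [|r [r_sa _ rE r_comm]] := sqrt_exists _ v1; first by rewrite astarM b_sa.
  have pby y : p (amul b y) <= p y.
    rewrite -[_ <= _](@ler_pXn2r _ 2) ?nnegrE ?p0 //.
    set s := y - amul r y.
    apply: le_trans (seminorm_cartesian (s := s) pS _) _.
      have br : amul b r = amul r b by apply: r_comm; rewrite amulA.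
      rewrite /s astarB !astarM b_sa r_sa amulBr amulBl !amulA.
      by rewrite -(amulA _ b r) br amulA.
    rewrite -(pc y) //= le_eqVlt; apply/orP; left; apply/eqP; congr p.
    pose D z := amul (amul (astar y) z) y.
    have -> : amul (astar (amul b y)) (amul b y) = D (amul b b).
      by rewrite astarM b_sa /D !amulA.
    have -> : amul (astar s) s = amul (astar y) y + (D (amul r r) - (D r + D r)).
      rewrite /s astarB astarM r_sa amulBl !amulBr /D !amulA.
      by rewrite opprB -addrA opprD [X in _ + X = _]addrC -!addrA.
    have DD z t : D z + D t = D (z + t) by rewrite /D amulDr amulDl.
    by rewrite addrCA [D _ + (_ - _)]addrA !DD rE subrr addr0.
  have := pby b; have := ps b I; have := pc b I; rewrite /= b_sa => -> _.
  by have := p0 b I; nra.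
have sa_le b : astar b = b -> p b <= nr b.
  move=> b_sa; have [b0|b0] := eqVneq (nr b) 0.
    have -> : b = 0 by apply: nr_eq0.
    by have := pZ 0 0 I; rewrite scale0r nr0 => ->; rewrite normr0 mul0r.
  have b_gt0 : 0 < nr b by rewrite lt_neqAle eq_sym b0 nr_ge0.
  have := unit_ball ((nr b)^-1%:C%C *: b); rewrite astarZr b_sa => /(_ erefl).
  rewrite nrZ_pos ?invr_ge0 ?nr_ge0 // mulVf // => /(_ (lexx _)).
  rewrite pZ // normc_def /= expr0n addr0 sqrtr_sqr ger0_norm ?invr_ge0 ?nr_ge0 //.
  by rewrite ler_pdivrMl // mulr1.
rewrite -[_ <= _](@ler_pXn2r _ 2) ?nnegrE ?p0 ?nr_ge0 //.
by rewrite -pc // -nr_cstar /=; apply: sa_le; rewrite astarM astarK.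
Qed.

(** * Positivity in a unital C*-algebra *)

Section UnitalPositivity.
Variables (R : realType) (D : cstarAlgType R) (e : D).
Hypotheses (e_l : forall x, amul e x = x) (e_r : forall x, amul x e = x).
Implicit Types (a b c h x z : D) (t : R).

Let e_sa : astar e = e.
Proof. by rewrite -[RHS]astarK -[in RHS](e_l (astar e)) astarM astarK e_l. Qed.

Let nr_e : nr e <= 1.
Proof.
have := nr_cstar e; rewrite e_sa e_l => h; have := nr_ge0 e.
by move: (nr e) h => s; nra.
Qed.

Let nr_te t : 0 <= t -> nr (t%:C%C *: e) <= t.
Proof. by move=> t0; rewrite nrZ_pos // ler_piMr. Qed.

Let te_comm t x : amul x (t%:C%C *: e) = amul (t%:C%C *: e) x.
Proof. by rewrite amulZl amulZr e_l e_r. Qed.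

(** For self-adjoint [a] the inequality says that the spectrum of [a] lies in
    [0, 2t]; this form makes stability under sums immediate. *)
Definition pos a := astar a = a /\ exists2 t, 0 <= t & nr (t%:C%C *: e - a) <= t.

Lemma sqrt_sub (w : D) t : astar w = w -> nr w <= t ->
  exists s, [/\ pos s, amul s s = t%:C%C *: e - w
              & forall z, amul z w = amul w z -> amul z s = amul s z].
Proof.
move=> w_sa wt; have t0 : 0 <= t by apply: le_trans wt; exact: nr_ge0.
have [t_eq0|t_neq0] := eqVneq t 0.
  have w0 : w = 0 by apply: nr_eq0; have := nr_ge0 w; lra.
  exists 0; split=> [|| z _]; rewrite ?amul0l ?amul0r //.
    by split; [exact: astar0 | exists 0; rewrite ?scale0r ?subrr ?nr0].
  by rewrite t_eq0 w0 scale0r subrr.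
have t_gt0 : 0 < t by rewrite lt_neqAle eq_sym t_neq0.
pose v := (t^-1)%:C%C *: w.
have v_sa : astar v = v by rewrite astarZr w_sa.
have v1 : nr v <= 1 by rewrite nrZ_pos ?invr_ge0 // ler_pdivrMl // mulr1.
have tv : t%:C%C *: v = w.
  by rewrite scalerA -rmorphM mulfV // rmorph1 scale1r.
have [r [r_sa r1 rE r_comm]] := sqrt_exists v_sa v1.
pose q := Num.sqrt t; have q0 : 0 <= q by exact: sqrtr_ge0.
exists (q%:C%C *: (e - r)); split.
- split; first by rewrite astarZr astarB e_sa r_sa.
  by exists q => //; rewrite -scalerBr subKr nrZ_pos // ler_piMr.
- rewrite amulZl amulZr scalerA -rmorphM -expr2 sqr_sqrtr //.
  rewrite amulBr e_r amulBl e_l opprB.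
  have -> : amul r r - r = r - v 
    by apply/eqP; rewrite subr_eq addrAC -rE addrAC subrr add0r.
  by rewrite subrKA scalerBr tv.
- move=> z zw; rewrite amulZl amulZr amulBl amulBr e_l e_r r_comm //.
  by rewrite amulZl amulZr zw.
Qed.

Lemma pos_sqrt a : pos a ->
  exists s, [/\ pos s, amul s s = a
              & forall z, amul z a = amul a z -> amul z s = amul s z].
Proof.
move=> [a_sa [t t0 ta]].
have [|s [s_pos sE s_comm]] := sqrt_sub (w := t%:C%C *: e - a) _ ta.
  by rewrite astarB astarZr e_sa a_sa.
exists s; split=> // [|z za]; first by rewrite sE subKr.
by apply: s_comm; rewrite amulBr amulBl te_comm za.
Qed.

Lemma pos_sq_bound b t : astar b = b -> nr b ^+ 2 <= t ->
  nr (t%:C%C *: e - amul b b) <= t.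
Proof.
move=> b_sa bt.
have [||s [[s_sa _] sE s_comm]] := sqrt_sub (w := amul b b) (t := t).
- by rewrite astarM b_sa.
- by apply: le_trans bt; rewrite expr2 nrM.
rewrite -sE; apply: le_trans (nrM _ _) _; rewrite -expr2.
apply: le_trans (seminorm_cartesian (s := b) (nr_cstar_seminorm D) _) _.
  by rewrite s_sa b_sa s_comm // amulA.
rewrite s_sa b_sa sE subrK; apply: nr_te; apply: le_trans bt; exact: sqr_ge0.
Qed.

Lemma pos_sq b : astar b = b -> pos (amul b b).
Proof.
move=> b_sa; split; first by rewrite astarM b_sa.
by exists (nr b ^+ 2); [exact: sqr_ge0 | exact: pos_sq_bound].
Qed.

Lemma posD a b : pos a -> pos b -> pos (a + b).
Proof.
move=> [a_sa [t t0 ta]] [b_sa [s s0 sb]]; split; first by rewrite astarD a_sa b_sa.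
exists (t + s); first exact: addr_ge0.
rewrite rmorphD scalerDl opprD addrACA.
by apply: le_trans (nrD _ _) _; exact: lerD.
Qed.

Lemma pos0 : pos 0.
Proof. by split; [exact: astar0 | exists 0; rewrite ?scale0r ?subrr ?nr0]. Qed.

Lemma posZ t a : 0 <= t -> pos a -> pos (t%:C%C *: a).
Proof.
move=> t0 [a_sa [s s0 sa]]; split; first by rewrite astarZr a_sa.
exists (t * s); first exact: mulr_ge0.
by rewrite rmorphM -scalerA -scalerBr nrZ_pos // ler_wpM2l.
Qed.

Lemma pos_sum (I : Type) (s : seq I) (F : I -> D) :
  (forall i, pos (F i)) -> pos (\sum_(i <- s) F i).
Proof.
move=> posF; elim: s => [|i s IH]; first by rewrite big_nil; exact: pos0.
by rewrite big_cons; exact: posD.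
Qed.

(** With t = |d|, both [c] and [t - c] are squares, of commuting self-adjoint
    elements. *)
Lemma pos_mono c d : pos c -> pos (d - c) -> nr c <= nr d.
Proof.
move=> c_pos dc_pos; have d_pos : pos d by rewrite -(subrK c d); exact: posD.
have [s [s_pos sE _]] := sqrt_sub (proj1 d_pos) (lexx (nr d)).
have tc_pos : pos ((nr d)%:C%C *: e - c).
  by rewrite -(subrKA d) -sE; apply: posD => //; apply: pos_sq; case: s_pos.
have [g [[g_sa _] gE g_comm]] := pos_sqrt tc_pos.
have [f [[f_sa _] fE f_comm]] := pos_sqrt c_pos.
have fg : amul f g = amul g f.
  apply: g_comm; apply/esym; apply: f_comm.
  by rewrite amulBl amulBr te_comm.
rewrite -{1}fE; apply: le_trans (nrM _ _) _; rewrite -expr2.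
apply: le_trans (seminorm_cartesian (s := g) (nr_cstar_seminorm D) _) _.
  by rewrite f_sa g_sa fg.
by rewrite f_sa g_sa fE gE subrKC; apply: nr_te; exact: nr_ge0.
Qed.

(** With w the adjoint of z and t = |z|^2, take the norm of (t + zw)z = z(t + wz).
    Positivity of zw makes the square of the left-hand norm at least 2t^3, and
    positivity of - wz makes that of the right-hand norm at most t^3. *)
Lemma opposite_squares_eq0 z k f : astar k = k -> astar f = f ->
  amul (astar z) z = - amul k k -> amul z (astar z) = amul f f -> z = 0.
Proof.
move=> k_sa f_sa zk zf; have [t tE] : {t | t = nr z ^+ 2} by exists (nr z ^+ 2).
have t0 : 0 <= t by rewrite tE; exact: sqr_ge0.
have nk : nr k ^+ 2 = t by rewrite -nr_cstar k_sa -nrN -zk nr_cstar tE.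
have nf : nr f ^+ 2 = t by rewrite -nr_cstar f_sa -zf nr_cstarr tE.
pose g := t%:C%C *: e + amul f f; pose g' := t%:C%C *: e - amul k k.
have gz : amul g z = amul z g'.
  by rewrite amulDl amulBr te_comm -zf -amulA zk amulNr.
have g'_le : nr g' <= t by apply: pos_sq_bound; rewrite ?nk.
have g_sa : astar g = g by rewrite astarD astarZr astarM e_sa f_sa.
have g'_sa : astar g' = g' by rewrite astarB astarZr astarM e_sa k_sa.
have upper : nr (amul g z) ^+ 2 <= t * t * t.
  rewrite gz -nr_cstar astarM g'_sa -amulA (amulA _ z) zk.
  apply: le_trans (nrM _ _) _; rewrite mulrC.
  apply: ler_pM; rewrite ?nr_ge0 //; apply: le_trans (nrM _ _) _.
  apply: ler_pM; rewrite ?nr_ge0 // nrN -nk expr2; exact: nrM.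
have lower : 2 * t * t * t <= nr (amul g z) ^+ 2.
  rewrite -nr_cstarr astarM g_sa amulA -(amulA g z) zf.
  have -> : 2 * t * t * t = nr ((2 * t)%:C%C *: amul (amul f f) (amul f f)).
    rewrite nrZ_pos ?mulr_ge0 //; have ff_sa : astar (amul f f) = amul f f.
      by rewrite astarM f_sa.
    by rewrite -{1}ff_sa nr_cstar -{1}f_sa nr_cstar nf; ring.
  apply: pos_mono.
    by apply: posZ; rewrite ?mulr_ge0 //; apply: pos_sq; rewrite astarM f_sa.
  have -> : amul (amul g (amul f f)) g - (2 * t)%:C%C *: amul (amul f f) (amul f f) =
     (t * t)%:C%C *: amul f f + amul (amul (amul f f) f) (amul (amul f f) f).
    set F := amul f f.
    have -> : amul (amul g F) g =
        ((t * t)%:C%C *: F + t%:C%C *: amul F F) + (t%:C%C *: amul F F + amul (amul F F) F).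
      rewrite /g amulDl amulZl e_l amulDr amulZr e_r amulDl amulZl.
      by rewrite scalerDr scalerA rmorphM.
    rewrite mulr_natl mulr2n rmorphD /= scalerDl.
    rewrite [_ *: F + _]addrC addrACA [X in X - _]addrC addrK.
    by rewrite /F !amulA.
  apply: posD; first by apply: posZ; rewrite ?mulr_ge0 //; exact: pos_sq.
  by apply: pos_sq; rewrite !astarM f_sa amulA.
have : t <= 0 by rewrite leNgt; apply/negP => t_gt0; have := mulr_gt0 t_gt0 t_gt0; nra.
move=> t_le0; apply: nr_eq0; have : t == 0 by rewrite eq_le t_le0.
by rewrite tE sqrf_eq0 => /eqP.
Qed.

(** Kaplansky's argument. Let m be the absolute value of h = x*x, and b = m - h, which
    is twice the negative part of h. For z = xb, z*z = - b m b is the negative of a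
    square, so that zz* = (zz* + z*z) - z*z is positive. By [opposite_squares_eq0],
    z = 0, and b = 0 follows. *)
Lemma pos_star_mul x : pos (amul (astar x) x).
Proof.
set h := amul _ _; have h_sa : astar h = h by rewrite astarM astarK.
have [m [m_pos mE m_comm]] := pos_sqrt (pos_sq h_sa).
have m_sa : astar m = m by case: m_pos.
have hm : amul h m = amul m h by apply: m_comm; rewrite amulA.
have [n [[n_sa _] nE n_comm]] := pos_sqrt m_pos.
have hn : amul h n = amul n h by exact: n_comm.
have mn : amul m n = amul n m by exact: n_comm.
pose b := m - h; have b_sa : astar b = b by rewrite astarB m_sa h_sa.
have bm : amul b m = amul m b by rewrite amulBl amulBr hm.
have bn : amul b n = amul n b by rewrite amulBl amulBr hn mn.
have hb : amul h b = - amul b m by rewrite amulBl amulBr hm mE opprB.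
pose z := amul x b; pose k := amul n b.
have k_sa : astar k = k by rewrite astarM b_sa n_sa bn.
have kk : amul k k = amul b (amul m b).
  by rewrite /k -{1}bn -amulA (amulA n n) nE.
have zk : amul (astar z) z = - amul k k.
  by rewrite kk astarM b_sa -amulA (amulA _ x) -/h hb amulNr bm.
have zz_pos : pos (amul z (astar z)).
  (* with w the adjoint of z: zw + wz is half the sum of the squares of z + w
     and i(z - w), and wz = - k^2 *)
  have -> : amul z (astar z) = (2^-1 : R)%:C%C *:
     (amul (z + astar z) (z + astar z) +
      amul ('i%C *: (z - astar z)) ('i%C *: (z - astar z))) + amul k k.
    rewrite amulZl amulZr scaleii !amulDl !amulDr !amulNl !amulNr opprK.
    set zz := amul z (astar z); set z'z := amul (astar z) z.
    set z2 := amul z z; set z'2 := amul (astar z) (astar z).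
    rewrite opprD !opprB opprD opprK.
    have -> : z2 + zz + (z'z + z'2) + (zz - z2 + (z'z - z'2)) = (zz + z'z) + (zz + z'z).
      rewrite addrACA [X in X + _]addrC subrKA [X in _ + X]addrC [z'z + z'2]addrC.
      by rewrite subrKA addrACA.
    by rewrite realC_half_double -{1}[amul k k]opprK -zk addrK.
  apply: posD; last exact: pos_sq.
  apply: posZ; first by rewrite invr_ge0.
  apply: posD; apply: pos_sq; first by rewrite astarD astarK addrC.
  by rewrite astarZi astarB astarK -scalerN opprB.
have [f [[f_sa _] fE _]] := pos_sqrt zz_pos.
have z0 := opposite_squares_eq0 k_sa f_sa zk (esym fE).
have bmb : amul b (amul m b) = 0.
  by rewrite -kk; apply/eqP; rewrite -oppr_eq0 -zk z0 amul0r.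
have bh : amul b h = - amul b m by rewrite -hb amulBl amulBr hm.
have bb : amul b b = amul b m + amul b m by rewrite {2}/b amulBr bh opprK.
have b3 : amul (amul b b) b = 0 by rewrite bb amulDl -amulA bmb addr0.
have bb0 : amul b b = 0.
  by apply: cstar_eq0; rewrite astarM b_sa amulA b3 amul0l.
have b0 : b = 0 by apply: cstar_eq0; rewrite b_sa.
by have /eqP := b0; rewrite subr_eq0 => /eqP <-.
Qed.

End UnitalPositivity.

(** * The unitization *)

Lemma complete_approx_real (R : realType) (P : R -> R -> Prop) :
  (forall e : R, 0 < e -> exists y, P e y) ->
  (forall e d y z, P e y -> P d z -> `|y - z| <= e + d) ->
  exists l, forall e y, P e y -> `|y - l| <= e.
Proof.
move=> exP P_dist; pose L := [set y.2 - y.1 | y in [set y | P y.1 y.2]].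
have le_up e y d z : P e y -> P d z -> y - e <= z + d.
  by move=> Py Pz; have := P_dist _ _ _ _ Py Pz; rewrite ler_norml; lra.
have [y1 Py1] := exP 1 ltr01.
exists (sup L) => e y Py; rewrite ler_norml; apply/andP; split.
  rewrite lerNl opprB lerBlDl; apply: ge_sup; first by exists (y1 - 1), (1, y1).
  by move=> _ [[d z] /= Pz <-]; exact: le_up.
rewrite lerBlDr -lerBlDl; apply: ub_le_sup; last by exists (e, y).
by exists (y1 + 1) => _ [[d z] /= Pz <-]; exact: le_up.
Qed.

(** [(a, l)] stands for a + l1. *)
Definition unitization (R : realType) (A : cstarAlgType R) : Type := (A * R[i]^o)%type.

Section Unitization.
Variables (R : realType) (A : cstarAlgType R).
Local Notation D := (unitization A).
Implicit Types (x y z : D) (a b : A).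

HB.instance Definition _ := GRing.Lmodule.copy D (A * R[i]^o)%type.

Definition umul x y : D :=
  (amul x.1 y.1 + x.2 *: y.1 + y.2 *: x.1, x.2 * y.2).
Definition ustar x : D := (astar x.1, Num.conj x.2).

Let addr3 (a b c d f g : A) : a + b + (c + d) + (f + g) = a + c + f + (b + d + g).
Proof. by rewrite (addrACA a) (addrACA (a + c)). Qed.

Fact umulDl : left_distributive umul +%R.
Proof.
move=> x y z; congr (_, _) => /=; last exact: mulrDl.
by rewrite amulDl scalerDl scalerDr addr3.
Qed.
Fact umulDr : right_distributive umul +%R.
Proof.
move=> x y z; congr (_, _) => /=; last exact: mulrDr.
by rewrite amulDr scalerDl scalerDr addr3.
Qed.
Fact umulZl (c : R[i]) x y : umul (c *: x) y = c *: umul x y.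
Proof.
congr (_, _) => /=; last by rewrite -scalerAl.
by rewrite amulZl !scalerDr !scalerA [y.2 * c]mulrC.
Qed.
Fact umulZr (c : R[i]) x y : umul x (c *: y) = c *: umul x y.
Proof.
congr (_, _) => /=; last by rewrite -scalerAr.
by rewrite amulZr !scalerDr !scalerA [x.2 * c]mulrC.
Qed.
Fact umulA : associative umul.
Proof.
move=> [a l] [b m] [c n]; congr (_, _) => /=; last exact: mulrA.
rewrite !amulDl !amulDr !amulZl !amulZr !scalerDr !scalerA amulA.
rewrite (mulrC n m) (mulrC n l) -!addrA; congr (_ + _).
rewrite [RHS]addrCA; congr (_ + _).
by rewrite addrCA; congr (_ + _); rewrite addrCA.
Qed.
Fact ustarK : involutive ustar.
Proof. by move=> [a l]; rewrite /ustar /= astarK conjCK. Qed.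
Fact ustarD : {morph ustar : x y / x + y}.
Proof. by move=> x y; rewrite /ustar /= astarD rmorphD. Qed.
Fact ustarZ (c : R[i]) x : ustar (c *: x) = Num.conj c *: ustar x.
Proof. by rewrite /ustar /= astarZ rmorphM. Qed.
Fact ustarM x y : ustar (umul x y) = umul (ustar y) (ustar x).
Proof.
rewrite /ustar /umul /= !astarD !astarZ astarM rmorphM mulrC.
by congr (_, _); rewrite addrAC.
Qed.

HB.instance Definition _ := Lmodule_isStarAlgebra.Build R D
  umulA umulDl umulDr umulZl umulZr ustarK ustarD ustarZ ustarM.

Definition uact x a : A := amul x.1 a + x.2 *: a.

Definition usup x : R := sup [set nr (uact x a) | a in [set a | nr a <= 1]].

(** The operator norm alone would vanish on (-1_A, 1) when [A] has a unit 1_A. *)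
Definition unorm x : R := Num.max (complex.Re `|x.2|) (usup x).

Let uact_le x a : nr a <= 1 -> nr (uact x a) <= nr x.1 + complex.Re `|x.2|.
Proof.
move=> a1; apply: le_trans (nrD _ _) _; apply: lerD.
  apply: le_trans (nrM _ _) _; rewrite -[leRHS]mulr1.
  by apply: ler_wpM2l; rewrite ?nr_ge0.
by rewrite nrZc ler_piMr // -ler0c -normC_ReE.
Qed.

Lemma unorm_ge2 x : complex.Re `|x.2| <= unorm x.
Proof. by rewrite le_max lexx. Qed.

Lemma unorm_ge0 x : 0 <= unorm x.
Proof. by apply: le_trans (unorm_ge2 x); rewrite -ler0c -normC_ReE. Qed.

Lemma nr_uact x a : nr (uact x a) <= unorm x * nr a.
Proof.
have [a0|a0] := eqVneq (nr a) 0.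
  have -> : a = 0 by exact: nr_eq0.
  by rewrite /uact amul0r scaler0 addr0 nr0 mulr0.
have a_gt0 : 0 < nr a by rewrite lt_neqAle eq_sym a0 nr_ge0.
pose b := (nr a)^-1%:C%C *: a.
have nb : nr b <= 1 by rewrite nrZ_pos ?invr_ge0 ?nr_ge0 // mulVf.
have -> : uact x a = (nr a)%:C%C *: uact x b.
  rewrite {2}/uact /b amulZr scalerDr !scalerA mulrAC -!rmorphM mulfV //.
  by rewrite rmorph1 scale1r mul1r.
rewrite nrZ_pos ?nr_ge0 // mulrC ler_wpM2r ?nr_ge0 // le_max; apply/orP; right.
apply: ub_le_sup; last by exists b.
by exists (nr x.1 + complex.Re `|x.2|) => _ [c /= c1 <-]; exact: uact_le.
Qed.

Lemma unorm_le x (C : R) : complex.Re `|x.2| <= C ->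
  (forall a, nr a <= 1 -> nr (uact x a) <= C) -> unorm x <= C.
Proof.
move=> xC aC; rewrite ge_max xC; apply: ge_sup; last by move=> _ [a /= /aC ? <-].
by exists (nr (uact x 0)), 0; rewrite //= nr0.
Qed.

Lemma uactM x y a : uact (amul x y) a = uact x (uact y a).
Proof.
rewrite /uact /= !amulDl !amulDr !amulZl !amulZr scalerDr scalerA amulA.
by rewrite -!addrA; congr (_ + _); rewrite addrCA; congr (_ + _).
Qed.

Fact unormD x y : unorm (x + y) <= unorm x + unorm y.
Proof.
apply: unorm_le => [|a a1].
  by apply: le_trans (Re_normD _ _) _; apply: lerD; exact: unorm_ge2.
have -> : uact (x + y) a = uact x a + uact y a.
  by rewrite /uact amulDl scalerDl addrACA.
apply: le_trans (nrD _ _) _; apply: lerD; apply: le_trans (nr_uact _ _) _.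
  by rewrite ler_piMr ?unorm_ge0.
by rewrite ler_piMr ?unorm_ge0.
Qed.

Fact unormM x y : unorm (amul x y) <= unorm x * unorm y.
Proof.
apply: unorm_le => [|a a1].
  by rewrite Re_normM; apply: ler_pM; rewrite ?Re_norm_ge0 ?unorm_ge2.
rewrite uactM; apply: le_trans (nr_uact _ _) _.
apply: ler_wpM2l; first exact: unorm_ge0.
by apply: le_trans (nr_uact _ _) _; rewrite ler_piMr ?unorm_ge0.
Qed.

Let unormZ_le (c : R[i]) x : unorm (c *: x) <= complex.Re `|c| * unorm x.
Proof.
apply: unorm_le => [|a a1]; first by rewrite Re_normM ler_wpM2l ?Re_norm_ge0 ?unorm_ge2.
have -> : uact (c *: x) a = c *: uact x a.
  by rewrite /uact amulZl scalerDr scalerA.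
rewrite nrZc; apply: ler_wpM2l; first exact: Re_norm_ge0.
apply: le_trans (nr_uact _ _) _.
by rewrite ler_piMr ?unorm_ge0.
Qed.

Fact unormZ (c : R[i]) x : unorm (c *: x) = complex.Re `|c| * unorm x.
Proof.
apply/eqP; rewrite eq_le unormZ_le andTb.
have [->|c0] := eqVneq c 0; first by rewrite normr0 mul0r unorm_ge0.
have c_gt0 : 0 < complex.Re `|c| by rewrite -ltcR -normC_ReE normr_gt0.
have := unormZ_le c^-1 (c *: x); rewrite scalerA mulVf // scale1r.
by rewrite Re_normV mulrC ler_pdivlMr // mulrC.
Qed.

Lemma nr_le_unorm x : nr x.1 <= 2 * unorm x.
Proof.
have [x0|x0] := eqVneq (nr x.1) 0; first by rewrite x0 mulr_ge0 ?unorm_ge0.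
have x_gt0 : 0 < nr x.1 by rewrite lt_neqAle eq_sym x0 nr_ge0.
rewrite -(ler_pM2r x_gt0) -expr2 -nr_cstarr.
have -> : amul x.1 (astar x.1) = uact x (astar x.1) - x.2 *: astar x.1.
  by rewrite addrK.
apply: le_trans (nrB _ _) _; have := nr_uact x (astar x.1); rewrite nr_star.
have := unorm_ge2 x; rewrite nrZc nr_star; have := nr_ge0 x.1; nra.
Qed.

Fact unorm_eq0 x : unorm x = 0 -> x = 0.
Proof.
move=> x0; have := unorm_ge2 x; have := nr_le_unorm x; rewrite x0 mulr0.
case: x {x0} => a l /= a0 l0; congr (_, _).
  by apply: nr_eq0; apply/eqP; rewrite eq_le a0 nr_ge0.
apply/eqP; rewrite -normr_eq0 normC_ReE; apply/eqP; congr (_%:C)%C.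
by apply/eqP; rewrite eq_le l0 Re_norm_ge0.
Qed.

Let unorm_sq_le x : unorm x ^+ 2 <= unorm (amul (astar x) x).
Proof.
have n0 := unorm_ge0 (amul (astar x) x).
rewrite -[leRHS]sqr_sqrtr //.
rewrite ler_pXn2r ?nnegrE ?unorm_ge0 ?sqrtr_ge0 //.
apply: unorm_le => [|a a1].
  rewrite -[leLHS]ger0_norm ?Re_norm_ge0 // -sqrtr_sqr ler_wsqrtr //.
  apply: le_trans (unorm_ge2 _).
  rewrite -[(amul _ x).2]/(Num.conj x.2 * x.2) Re_normM expr2 ler_wpM2r ?Re_norm_ge0 //.
  by rewrite norm_conjC.
rewrite -[leLHS]ger0_norm ?nr_ge0 // -sqrtr_sqr ler_wsqrtr //.
have -> : nr (uact x a) ^+ 2 = nr (amul (astar a) (uact (amul (astar x) x) a)).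
  rewrite -nr_cstar uactM; set w := uact x a; congr nr.
  rewrite {1}/w; clearbody w.
  by rewrite /uact /= astarD astarM astarZ amulDl amulZl amulDr amulZr amulA.
apply: le_trans (nrM _ _) _; rewrite nr_star.
have := nr_uact (amul (astar x) x) a; have := nr_ge0 a.
have := nr_ge0 (uact (amul (astar x) x) a).
by move: n0 a1; move: (nr a) (unorm _) (nr _) => *; nra.
Qed.

Let unorm_star x : unorm (astar x) = unorm x.
Proof.
have le_star y : unorm y <= unorm (astar y).
  have [->|y0] := eqVneq (unorm y) 0; first exact: unorm_ge0.
  have y_gt0 : 0 < unorm y by rewrite lt_neqAle eq_sym y0 unorm_ge0.
  rewrite -(ler_pM2r y_gt0) -expr2; apply: le_trans (unorm_sq_le y) _.
  exact: unormM.
by apply/eqP; rewrite eq_le le_star andbT -{2}(astarK x) le_star.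
Qed.

Lemma unorm_cstar x : unorm (amul (astar x) x) = unorm x ^+ 2.
Proof.
apply/eqP; rewrite eq_le unorm_sq_le andbT.
by apply: le_trans (unormM _ _) _; rewrite unorm_star expr2.
Qed.

Let cunorm x : R[i] := (unorm x)%:C%C.
Let cunormD x y : cunorm (x + y) <= cunorm x + cunorm y.
Proof. by rewrite -rmorphD lecR unormD. Qed.
Let cunormZ (c : R[i]) x : cunorm (c *: x) = `|c| * cunorm x.
Proof. by rewrite /cunorm unormZ rmorphM normC_ReE. Qed.
Let cunorm_eq0 x : cunorm x = 0 -> x = 0.
Proof. by move=> /complexI /unorm_eq0. Qed.

HB.instance Definition _ :=
  Lmodule_isNormed.Build R[i] D cunormD cunormZ cunorm_eq0.

Lemma nr_unorm x : nr x = unorm x.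
Proof. by []. Qed.

Let Re_le (l : R[i]) : `|complex.Re l| <= complex.Re `|l|.
Proof. by rewrite -lecR -normC_ReE normc_ge_Re. Qed.

Let ReB (l m : R[i]) : complex.Re (l - m) = complex.Re l - complex.Re m.
Proof. by case: l m => [? ?] [? ?]. Qed.
Let ImB (l m : R[i]) : complex.Im (l - m) = complex.Im l - complex.Im m.
Proof. by case: l m => [? ?] [? ?]. Qed.

Let Re_i : complex.Re `|'i%C : R[i]| = 1.
Proof. by rewrite normc_def /= expr0n expr1n add0r sqrtr1. Qed.

Let Im_le (l : R[i]) : `|complex.Im l| <= complex.Re `|l|.
Proof.
rewrite -normrN -ReiNIm; apply: le_trans (Re_le _) _; rewrite Re_normM.
by rewrite Re_i mulr1.
Qed.

Let le_Re_Im (l : R[i]) :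
  complex.Re `|l| <= `|complex.Re l| + `|complex.Im l|.
Proof.
rewrite {1}[l]complexE; apply: le_trans (Re_normD _ _) _; rewrite Re_normM Re_i mul1r.
by rewrite !normc_def /= !expr0n !addr0 !sqrtr_sqr.
Qed.

Fact unitization_complete (F : set_system D) :
  ProperFilter F -> cauchy F -> cvg F.
Proof.
move=> FF cF.
have approx (d : R) : 0 < d -> exists x, F [set y | nr (x - y) <= d].
  move=> d0; have d0' : 0 < d%:C%C by rewrite ltcR.
  have [x xF] := proj1 (cauchyP F) cF _ d0'; exists x; apply: filterS xF => y.
  by rewrite -ball_normE /ball_ /= nrE ltcR => /ltW.
have meet (S T : set D) : F S -> F T -> exists2 x, S x & T x.
  by move=> FS FT; have [x [? ?]] := filter_ex (filterI FS FT); exists x.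
have [|d d' a b Fa Fb|l1 l1P] :=
    complete_approx (P := fun (d : R) (a : A) => F [set y | nr (a - y.1) <= d]).
- move=> d d0; have [x xF] := approx (d / 2) ltac:(lra).
  exists x.1; apply: filterS xF => y /= xy.
  by have := nr_le_unorm (x - y); rewrite -nr_unorm => /le_trans; apply; lra.
- have [y ay yb] := meet _ _ Fa Fb.
  by apply: le_trans (nr_distD y.1 _ _) _; rewrite (nr_distC y.1); exact: lerD.
have snd_lim (f : R[i] -> R) :
    (forall l m, `|f l - f m| <= complex.Re `|l - m|) ->
    exists l, forall d s, F [set y | `|s - f y.2| <= d] -> `|s - l| <= d.
  move=> f_le.
  have [|d d' a b Fa Fb|l lP] :=
    complete_approx_real (P := fun d s => F [set y | `|s - f y.2| <= d]); last by exists l.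
  + move=> d d0; have [x xF] := approx d d0.
    exists (f x.2); apply: filterS xF => y /=; apply: le_trans.
    by apply: le_trans (f_le _ _) _; exact: (unorm_ge2 (x - y)).
  + have [y ay yb] := meet _ _ Fa Fb.
    by apply: le_trans (ler_distD (f y.2) _ _) _; rewrite (distrC (f y.2)); exact: lerD.
have Re_lip (l m : R[i]) : `|complex.Re l - complex.Re m| <= complex.Re `|l - m|.
  by rewrite -ReB; exact: Re_le.
have Im_lip (l m : R[i]) : `|complex.Im l - complex.Im m| <= complex.Re `|l - m|.
  by rewrite -ImB; exact: Im_le.
have [lr lrP] := snd_lim _ Re_lip; have [li liP] := snd_lim _ Im_lip.
apply/cvg_ex; exists ((l1, Complex lr li) : D).
apply/cvgrPdist_lt => e e0.
have eR : e \is Num.real by rewrite gtr0_real.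
have [x xF] := approx (complex.Re e / 8) ltac:(by rewrite divr_gt0 // -ltcR RRe_real).
have x1 : nr (x.1 - l1) <= 2 * (complex.Re e / 8).
  apply: l1P; apply: filterS xF => y /= xy; apply: le_trans (nr_le_unorm (x - y)) _.
  by rewrite -nr_unorm ler_pM2l.
have x2 (f : R[i] -> R) l : (forall l m, `|f l - f m| <= complex.Re `|l - m|) ->
   (forall d s, F [set y | `|s - f y.2| <= d] -> `|s - l| <= d) ->
   `|f x.2 - l| <= complex.Re e / 8.
  move=> f_le fP; apply: fP; apply: filterS xF => y /=; apply: le_trans.
  by apply: le_trans (f_le _ _) _; exact: (unorm_ge2 (x - y)).
have x2r := x2 _ _ Re_lip lrP; have x2i := x2 _ _ Im_lip liP.
apply: filterS xF => y /= xy; rewrite nrE -(RRe_real eR) ltcR.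
have xl : nr (x - (l1, Complex lr li)) <= complex.Re e / 2.
  apply: (@le_trans _ _ (nr (x.1 - l1) +
      (`|complex.Re x.2 - lr| + `|complex.Im x.2 - li|))).
    apply: unorm_le => [|a a1]; last first.
      apply: le_trans (uact_le _ a1) _; rewrite lerD2l.
      by have := le_Re_Im (x.2 - Complex lr li); rewrite ReB ImB.
    apply: le_trans (le_Re_Im _) _; rewrite ReB ImB.
    by rewrite ler_wpDl ?nr_ge0.
  by move: (nr _) `|_| `|_| x1 x2r x2i => u v w; lra.
have := nr_distD x (l1, Complex lr li) y; rewrite (nr_distC _ x).
have : 0 < complex.Re e by rewrite -ltcR RRe_real.
by lra.
Qed.

HB.instance Definition _ := Uniform_isComplete.Build D unitization_complete.

Let unormrM x y : `|amul x y| <= `|x| * `|y|.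
Proof. by rewrite -[leRHS]rmorphM lecR unormM. Qed.
Let unormr_cstar x : `|amul (astar x) x| = `|x| ^+ 2.
Proof. by rewrite -[RHS]rmorphXn; congr (_%:C)%C; exact: unorm_cstar. Qed.

HB.instance Definition _ := StarAlgebra_isCStar.Build R D unormrM unormr_cstar.

Definition uone : D := (0, 1).
Definition uinj a : D := (a, 0).

Lemma uone_l x : amul uone x = x.
Proof.
by case: x => a l; congr (_, _); rewrite /= ?amul0l ?mul1r ?scale1r ?scaler0 ?addr0 ?add0r.
Qed.
Lemma uone_r x : amul x uone = x.
Proof.
by case: x => a l; congr (_, _); rewrite /= ?amul0r ?mulr1 ?scale1r ?scaler0 ?add0r.
Qed.

Lemma uinjD a b : uinj (a + b) = uinj a + uinj b.
Proof. by congr (_, _); rewrite /= addr0. Qed.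
Lemma uinjM a b : uinj (amul a b) = amul (uinj a) (uinj b).
Proof. by congr (_, _); rewrite /= ?scale0r ?addr0 ?mul0r. Qed.
Lemma uinj_star a : uinj (astar a) = astar (uinj a).
Proof. by congr (_, _); rewrite /= conjC0. Qed.

Lemma nr_uinj a : nr (uinj a) = nr a.
Proof.
apply/eqP; rewrite eq_le; apply/andP; split.
  apply: unorm_le => [|b b1]; first by rewrite [X in complex.Re X]normr0 nr_ge0.
  rewrite /uact scale0r addr0; apply: le_trans (nrM _ _) _.
  by rewrite ler_piMr ?nr_ge0.
have [->|a0] := eqVneq (nr a) 0; first exact: nr_ge0.
have a_gt0 : 0 < nr a by rewrite lt_neqAle eq_sym a0 nr_ge0.
rewrite -(ler_pM2r a_gt0) -expr2 -nr_cstarr -(nr_star a).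
by have := nr_uact (uinj a) (astar a); rewrite /uact /= scale0r addr0.
Qed.

End Unitization.

(** In the unitization all terms are positive, so adding them to a*a cannot decrease
    the norm. *)
Lemma nr_le_sum_star (R : realType) (A : cstarAlgType R) (a : A) (I : Type)
    (s : seq I) (F : I -> A) :
  nr a ^+ 2 <= nr (amul (astar a) a + \sum_(i <- s) amul (astar (F i)) (F i)).
Proof.
have pos_inj (b : A) : pos (uone A) (uinj (amul (astar b) b)).
  rewrite uinjM uinj_star; apply: pos_star_mul; [exact: uone_l | exact: uone_r].
rewrite -nr_cstar -(nr_uinj (amul _ _)) -(nr_uinj (_ + _)).
apply: (pos_mono (@uone_l R A) (@uone_r R A)); first exact: pos_inj.
have uinj_sum : uinj (\sum_(i <- s) amul (astar (F i)) (F i)) =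
    \sum_(i <- s) uinj (amul (astar (F i)) (F i)).
  by apply: (big_morph (@uinj R A)); [exact: uinjD | ].
rewrite uinjD addrAC subrr add0r uinj_sum.
by apply: pos_sum => // i.
Qed.

(** * The C*-norm of a matrix algebra *)

Section MatrixNorm.
Variables (R : realType) (B : cstarAlgType R) (k : nat).
Local Notation M := (cmatrix B k).
Implicit Types (x y : 'I_k -> B) (S T : M).

(** Matrices act on the Hilbert [B]-module B^k, whose [B]-valued inner product is
    [ip]. *)
Definition ip x y : B := \sum_i amul (astar (x i)) (y i).
Definition colnorm x : R := Num.sqrt (nr (ip x x)).
Definition mact T x : 'I_k -> B := fun i => \sum_l amul (T i l) (x l).

Lemma colnorm_ge0 x : 0 <= colnorm x. Proof. exact: sqrtr_ge0. Qed.
Lemma colnorm_sq x : colnorm x ^+ 2 = nr (ip x x).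
Proof. by rewrite sqr_sqrtr ?nr_ge0. Qed.

Lemma nr_le_colnorm x i : nr (x i) <= colnorm x.
Proof.
rewrite -[leLHS]ger0_norm ?nr_ge0 // -sqrtr_sqr ler_wsqrtr //.
by rewrite /ip (bigD1 i) //= -big_filter nr_le_sum_star.
Qed.

Lemma ip_star x y : astar (ip x y) = ip y x.
Proof. by rewrite astar_sum; apply: eq_bigr => i _; rewrite astarM astarK. Qed.

Lemma ip_Zl (c : R) x y : ip (fun i => c%:C%C *: x i) y = c%:C%C *: ip x y.
Proof.
by rewrite scaler_sumr; apply: eq_bigr => i _; rewrite astarZr amulZl.
Qed.
Lemma ip_Zr (c : R) x y : ip x (fun i => c%:C%C *: y i) = c%:C%C *: ip x y.
Proof. by rewrite scaler_sumr; apply: eq_bigr => i _; rewrite amulZr. Qed.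

Lemma colnormZ (c : R) x : 0 <= c -> colnorm (fun i => c%:C%C *: x i) = c * colnorm x.
Proof.
move=> c0; rewrite /colnorm ip_Zl ip_Zr !nrZ_pos // mulrA -expr2.
by rewrite sqrtrM ?sqr_ge0 // sqrtr_sqr ger0_norm.
Qed.

(** For |x| <= 1 and a = (x, y), the difference (y, y) - a*a is the sum of
    (y - xa, y - xa) and of a*(1 - (x, x))a, and 1 - (x, x) is a square. *)
Let ip_CauchySchwarz1 x y : nr (ip x x) <= 1 -> nr (ip x y) ^+ 2 <= nr (ip y y).
Proof.
move=> x1; set a := ip x y; set c := ip x x.
have [r [r_sa _ rE _]] := sqrt_exists (ip_star x x) x1.
pose w := a - amul r a; pose z i := y i - amul (x i) a.
suff -> : ip y y = amul (astar a) a +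
    \sum_(u <- w :: [seq z i | i <- index_enum 'I_k]) amul (astar u) u.
  exact: nr_le_sum_star.
rewrite big_cons big_map.
have -> : \sum_(i <- index_enum 'I_k) amul (astar (z i)) (z i) =
    (ip y y - amul (astar a) a) - (amul (astar a) a - amul (amul (astar a) c) a).
  rewrite -[X in amul X a - _]/(astar (ip x y)) -[X in _ - amul X a]/(astar (ip x y)).
  rewrite {1}[astar (ip x y)]ip_star.
  rewrite {2}/a /c /ip amul_sumr !amul_suml amul_sumr amul_suml -!sumrB.
  by apply: eq_bigr => i _; rewrite astarB astarM amulBl !amulBr !amulA.
have -> : amul (astar w) w = amul (astar a) a - amul (amul (astar a) c) a.
  have <- : r + r - amul r r = c by rewrite -rE addrK.
  rewrite /w astarB astarM r_sa amulBl !amulBr amulDr amulBl amulDl !amulA.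
  by rewrite !opprB -addrA; congr (_ + _); rewrite addrCA opprD.
by rewrite [X in _ = _ + X]addrC subrK addrC subrK.
Qed.

Lemma ip_CauchySchwarz x y : nr (ip x y) <= colnorm x * colnorm y.
Proof.
have [x0|x0] := eqVneq (colnorm x) 0.
  have -> : ip x y = 0.
    apply: big1 => i _; have -> : x i = 0.
      by apply: nr_eq0; apply/eqP; rewrite eq_le nr_ge0 andbT -x0 nr_le_colnorm.
    by rewrite astar0 amul0l.
  by rewrite nr0 x0 mul0r.
have x_gt0 : 0 < colnorm x by rewrite lt_neqAle eq_sym x0 colnorm_ge0.
have := @ip_CauchySchwarz1 (fun i => (colnorm x)^-1%:C%C *: x i) y.
rewrite -colnorm_sq colnormZ ?invr_ge0 ?colnorm_ge0 // mulVf // expr1n lexx.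
move=> /(_ isT); rewrite ip_Zl nrZ_pos ?invr_ge0 ?colnorm_ge0 // -colnorm_sq.
rewrite ler_pXn2r ?nnegrE ?mulr_ge0 ?invr_ge0 ?nr_ge0 ?colnorm_ge0 //.
by rewrite ler_pdivrMl.
Qed.

Lemma ip_mact T x y : ip x (mact T y) = ip (mact (astar T) x) y.
Proof.
transitivity (\sum_i \sum_l amul (amul (astar (x i)) (T i l)) (y l)).
  by apply: eq_bigr => i _; rewrite amul_sumr; apply: eq_bigr => l _; rewrite amulA.
rewrite exchange_big; apply: eq_bigr => l _; rewrite astar_sum amul_suml.
by apply: eq_bigr => i _; rewrite astarM mxE astarK.
Qed.

Lemma mactM S T x : mact (amul S T) x = mact S (mact T x).
Proof.
apply/funext => i; transitivity (\sum_l \sum_m amul (amul (S i m) (T m l)) (x l)).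
  by apply: eq_bigr => l _; rewrite mxE amul_suml.
rewrite exchange_big; apply: eq_bigr => m _; rewrite amul_sumr.
by apply: eq_bigr => l _; rewrite amulA.
Qed.

Definition mnorm T : R :=
  sup [set nr (ip xy.1 (mact T xy.2)) |
        xy in [set xy | colnorm xy.1 <= 1 /\ colnorm xy.2 <= 1]].

Let colnorm0 : colnorm (fun=> 0) = 0.
Proof. by rewrite /colnorm /ip big1 ?nr0 ?sqrtr0 // => i _; rewrite amul0r. Qed.

Lemma mnorm_le T (C : R) :
  (forall x y, colnorm x <= 1 -> colnorm y <= 1 -> nr (ip x (mact T y)) <= C) ->
  mnorm T <= C.
Proof.
move=> TC; apply: ge_sup; last by move=> _ [[x y] /= [? ?] <-]; exact: TC.
by exists (nr (ip (fun=> 0) (mact T (fun=> 0)))), (fun=> 0, fun=> 0); rewrite //= colnorm0.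
Qed.

Let mnorm_ge1 T x y : colnorm x <= 1 -> colnorm y <= 1 ->
  nr (ip x (mact T y)) <= mnorm T.
Proof.
move=> x1 y1; apply: ub_le_sup; last by exists (x, y).
exists (\sum_i \sum_l nr (T i l)) => _ [[x' y'] /= [x'1 y'1] <-].
apply: le_trans (nr_sum _ _ _) _; apply: ler_sum => i _.
apply: le_trans (nrM _ _) _; rewrite nr_star.
apply: (@le_trans _ _ (nr (mact T y' i))).
  by rewrite ler_piMl ?nr_ge0 // (le_trans (nr_le_colnorm x' i)).
apply: le_trans (nr_sum _ _ _) _; apply: ler_sum => l _.
apply: le_trans (nrM _ _) _.
by rewrite ler_piMr ?nr_ge0 // (le_trans (nr_le_colnorm y' l)).
Qed.

Lemma mnorm_ge0 T : 0 <= mnorm T.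
Proof.
apply: (le_trans (nr_ge0 _)); apply: (mnorm_ge1 T (x := fun=> 0) (y := fun=> 0));
  by rewrite colnorm0.
Qed.

Lemma mnormP T x y : nr (ip x (mact T y)) <= mnorm T * (colnorm x * colnorm y).
Proof.
have [x0|x0] := eqVneq (colnorm x) 0.
  by apply: le_trans (ip_CauchySchwarz _ _) _; rewrite x0 !mul0r mulr0.
have [y0|y0] := eqVneq (colnorm y) 0.
  rewrite ip_mact; apply: le_trans (ip_CauchySchwarz _ _) _.
  by rewrite y0 !mulr0.
have x_gt0 : 0 < colnorm x by rewrite lt_neqAle eq_sym x0 colnorm_ge0.
have y_gt0 : 0 < colnorm y by rewrite lt_neqAle eq_sym y0 colnorm_ge0.
pose x' i := (colnorm x)^-1%:C%C *: x i; pose y' i := (colnorm y)^-1%:C%C *: y i.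
have := mnorm_ge1 T (x := x') (y := y').
rewrite !colnormZ ?invr_ge0 ?colnorm_ge0 // !mulVf // => /(_ (lexx _) (lexx _)).
have -> : mact T y' = fun i => (colnorm y)^-1%:C%C *: mact T y i.
  by apply/funext => i; rewrite scaler_sumr; apply: eq_bigr => l _; rewrite amulZr.
rewrite ip_Zl ip_Zr !nrZ_pos ?invr_ge0 ?colnorm_ge0 //.
rewrite ler_pdivrMl // ler_pdivrMl // => /le_trans; apply.
by rewrite le_eqVlt; apply/orP; left; apply/eqP; ring.
Qed.

Lemma colnorm_mact T x : colnorm (mact T x) <= mnorm T * colnorm x.
Proof.
have [y0|y0] := eqVneq (colnorm (mact T x)) 0.
  by rewrite y0 mulr_ge0 ?mnorm_ge0 ?colnorm_ge0.
have y_gt0 : 0 < colnorm (mact T x) by rewrite lt_neqAle eq_sym y0 colnorm_ge0.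
rewrite -(ler_pM2l y_gt0) -expr2 colnorm_sq; apply: le_trans (mnormP _ _ _) _.
by rewrite mulrCA.
Qed.

Lemma nr_le_mnorm T i j : nr (T i j) <= mnorm T.
Proof.
set c := T i j; have [->|c0] := eqVneq (nr c) 0; first exact: mnorm_ge0.
have c_gt0 : 0 < nr c by rewrite lt_neqAle eq_sym c0 nr_ge0.
pose x l := if l == j then astar c else 0.
have Tx : mact T x i = amul c (astar c).
  rewrite /mact (bigD1 j) //= /x eqxx big1 ?addr0 // => l /negPf ->.
  exact: amul0r.
have nx : colnorm x = nr c.
  rewrite /colnorm /ip (bigD1 j) //= /x eqxx big1 ?addr0.
    by rewrite nr_cstar nr_star sqrtr_sqr ger0_norm ?nr_ge0.
  by move=> l /negPf ->; exact: amul0r.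
rewrite -(ler_pM2r c_gt0) -expr2 -nr_cstarr -Tx -nx.
by apply: le_trans (colnorm_mact _ _); exact: nr_le_colnorm.
Qed.

Lemma mnorm_cstar_seminorm : rcstar_seminorm_on (ops_of M) setT mnorm.
Proof.
have mnorm_star_le T : mnorm (astar T) <= mnorm T.
  apply: mnorm_le => x y x1 y1; rewrite ip_mact astarK -ip_star nr_star.
  exact: mnorm_ge1.
have mnormM S T : mnorm (amul S T) <= mnorm S * mnorm T.
  apply: mnorm_le => x y x1 y1; rewrite mactM; apply: le_trans (mnormP _ _ _) _.
  apply: ler_wpM2l; first exact: mnorm_ge0.
  have := colnorm_mact T y; have := colnorm_ge0 x; have := colnorm_ge0 y.
  have := colnorm_ge0 (mact T y); have := mnorm_ge0 T.
  by move: (colnorm (mact T y)) (mnorm T) => *; nra.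
have mnorm_starE T : mnorm (astar T) = mnorm T.
  by apply/eqP; rewrite eq_le mnorm_star_le -{1}(astarK T) mnorm_star_le.
have mnormZ_le (c : R[i]) T : mnorm (c *: T) <= complex.Re `|c| * mnorm T.
  apply: mnorm_le => x y x1 y1.
  have -> : ip x (mact (c *: T) y) = c *: ip x (mact T y).
    rewrite scaler_sumr; apply: eq_bigr => i _; rewrite -amulZr; congr amul.
    by rewrite scaler_sumr; apply: eq_bigr => l _; rewrite mxE amulZl.
  rewrite nrZc; apply: ler_wpM2l; last exact: mnorm_ge1.
  by rewrite -ler0c -normC_ReE.
split; split.
- by move=> T _; exact: mnorm_ge0.
- move=> S T _ _; apply: mnorm_le => x y x1 y1.
  have -> : ip x (mact (S + T) y) = ip x (mact S y) + ip x (mact T y).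
    rewrite -big_split /=; apply: eq_bigr => i _; rewrite -amulDr; congr amul.
    by rewrite -big_split /=; apply: eq_bigr => l _; rewrite mxE amulDl.
  by apply: le_trans (nrD _ _) _; apply: lerD; exact: mnorm_ge1.
- move=> c T _; apply/eqP; rewrite eq_le mnormZ_le andTb.
  have [->|c0] := eqVneq c 0; first by rewrite normr0 mul0r mnorm_ge0.
  have c_gt0 : 0 < complex.Re `|c| by rewrite -ltcR -normC_ReE normr_gt0.
  have := mnormZ_le c^-1 (c *: T); rewrite scalerA mulVf // scale1r.
  by rewrite Re_normV mulrC ler_pdivlMr // mulrC.
- by move=> S T _ _; exact: mnormM.
- by move=> T _; exact: mnorm_starE.
- move=> T _; apply/eqP; rewrite eq_le; apply/andP; split.
    by apply: le_trans (mnormM _ _) _; rewrite mnorm_starE.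
  have n0 := mnorm_ge0 (amul (astar T) T).
  rewrite -[leRHS]sqr_sqrtr // ler_pXn2r ?nnegrE ?mnorm_ge0 ?sqrtr_ge0 //.
  apply: mnorm_le => x y x1 y1.
  apply: le_trans (ip_CauchySchwarz _ _) _.
  apply: (@le_trans _ _ (colnorm (mact T y))); first by rewrite ler_piMl ?colnorm_ge0.
  rewrite ler_wsqrtr // -{1}[T]astarK -ip_mact -mactM.
  by apply: mnorm_ge1.
Qed.

End MatrixNorm.

(** * The orthogonal decomposition of the algebra *)

Section ClosedIdeal.
Variables (R : realType) (A : cstarAlgType R) (I : set A).
Hypothesis idI : closed_ideal I.
Implicit Types x y a : A.

Lemma ideal_closed : closed I. Proof. by case: idI. Qed.
Lemma ideal0 : I 0. Proof. by case: idI. Qed.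
Lemma idealD x y : I x -> I y -> I (x + y).
Proof. by move=> Ix Iy; case: idI => _ _ D _ _; exact: D. Qed.
Lemma idealZ (c : R[i]) x : I x -> I (c *: x).
Proof. by move=> Ix; case: idI => _ _ _ Z _; exact: Z. Qed.
Lemma idealMl a x : I x -> I (amul a x).
Proof. by move=> Ix; case: idI => _ _ _ _ M; case: (M a x Ix). Qed.
Lemma idealMr a x : I x -> I (amul x a).
Proof. by move=> Ix; case: idI => _ _ _ _ M; case: (M a x Ix). Qed.
Lemma idealB x y : I x -> I y -> I (x - y).
Proof. by move=> Ix Iy; rewrite -scaleN1r; apply: idealD => //; exact: idealZ. Qed.
Lemma ideal_sum (J : eqType) (s : seq J) (P : pred J) (F : J -> A) :
  (forall j, j \in s -> P j -> I (F j)) -> I (\sum_(j <- s | P j) F j).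
Proof.
move=> IF; rewrite big_seq_cond; apply: (big_ind I); first exact: ideal0.
- exact: idealD.
- by move=> j /andP[? ?]; exact: IF.
Qed.
End ClosedIdeal.

Lemma ideal_bigcap (R : realType) (A : cstarAlgType R) (J : Type) (P : set J)
    (I : J -> set A) :
  (forall j, closed_ideal (I j)) -> closed_ideal (\bigcap_(j in P) I j).
Proof.
move=> idI; split.
- by apply: closed_bigI => j _; exact: ideal_closed.
- by move=> j _; exact: ideal0.
- by move=> x y Ix Iy j Pj; apply: idealD; [exact: idI | exact: Ix | exact: Iy].
- by move=> c x Ix j Pj; apply: idealZ; [exact: idI | exact: Ix].
- by move=> a x Ix; split=> j Pj;
    [apply: idealMl | apply: idealMr]; [exact: idI | exact: Ix | exact: idI | exact: Ix].
Qed.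

(** With w the adjoint of z, take norms in (wz)^2 = w(zw)x. This is applied when zw
    lies in an ideal on which right multiplication by [z] and by [x] agree. *)
Lemma cstar_contract (R : realType) (A : cstarAlgType R) (z x : A) :
  amul (amul z (astar z)) z = amul (amul z (astar z)) x -> nr z <= nr x.
Proof.
move=> zx; have [z0|z0] := eqVneq (nr z) 0; first by rewrite z0 nr_ge0.
have z_gt0 : 0 < nr z by rewrite lt_neqAle eq_sym z0 nr_ge0.
have sa : astar (amul (astar z) z) = amul (astar z) z by rewrite astarM astarK.
have h : (nr z ^+ 2) ^+ 2 = nr (amul (astar z) (amul (amul z (astar z)) x)).
  by rewrite -zx -nr_cstar -nr_cstar sa !amulA.
have h1 := nrM (astar z) (amul (amul z (astar z)) x).
have h2 := nrM (amul z (astar z)) x; rewrite nr_star in h1; rewrite nr_cstarr in h2.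
have z3 : 0 < nr z ^+ 3 by rewrite exprn_gt0.
rewrite -(ler_pM2l z3); apply: (@le_trans _ _ ((nr z ^+ 2) ^+ 2)).
  by rewrite -exprM -exprSr.
by rewrite h; apply: (le_trans h1); rewrite exprS -mulrA ler_pM2l.
Qed.

Lemma cstar_regular (R : realType) (A : cstarAlgType R) (w : A) :
  amul (amul w (astar w)) w = 0 -> w = 0.
Proof.
move=> w0; have := @cstar_contract _ _ w 0.
rewrite w0 amul0r nr0 => /(_ erefl) w_le; apply: nr_eq0; apply/eqP.
by rewrite eq_le w_le nr_ge0.
Qed.

Section LeftTranslation.
Variable G : groupType.
Implicit Types (g h : G) (s t : {fset G}).

Lemma mem_ltrans g t h : (h \in ltrans g t) = ((g^-1 * h)%g \in t).
Proof.
apply/imfsetP/idP => [[k /= kt ->]|ht]; first by rewrite mulKg.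
by exists (g^-1 * h)%g; rewrite //= mulVKg.
Qed.

Lemma mem_tinv t h : (h \in tinv t) = ((h^-1)%g \in t).
Proof.
apply/imfsetP/idP => [[k /= kt ->]|ht]; first by rewrite invgK.
by exists (h^-1)%g; rewrite //= invgK.
Qed.

Lemma ltransM g h t : ltrans (g * h)%g t = ltrans g (ltrans h t).
Proof. by apply/fsetP => k; rewrite !mem_ltrans invgM mulgA. Qed.

Lemma ltrans1 t : ltrans 1%g t = t.
Proof. by apply/fsetP => k; rewrite mem_ltrans invg1 mul1g. Qed.

Lemma ltransK g t : ltrans (g^-1)%g (ltrans g t) = t.
Proof. by rewrite -ltransM mulVg ltrans1. Qed.

Lemma ltransVK g t : ltrans g (ltrans (g^-1)%g t) = t.
Proof. by rewrite -ltransM mulgV ltrans1. Qed.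

Lemma card_ltrans g t : #|` ltrans g t| = #|` t|.
Proof. by rewrite card_imfset //=; exact: mulgI. Qed.

Lemma tuples1_ltrans n g t : tuples1 G n t -> (g^-1)%g \in t ->
  tuples1 G n (ltrans g t).
Proof.
move=> /andP[_ tn] gt; apply/andP; split; last by rewrite card_ltrans.
by rewrite mem_ltrans mulg1.
Qed.

Lemma tuples1_1 n t : tuples1 G n t -> 1%g \in t.
Proof. by case/andP. Qed.

Lemma tuples1_diff n s t : tuples1 G n s -> tuples1 G n t -> s != t ->
  exists2 g, g \in t & g \notin s.
Proof.
move=> /andP[_ /eqP sn] /andP[_ /eqP tn] st.
have /fsubsetPn [g gt gs] : ~~ (t `<=` s)%fset.
  apply/negP => ts; move/negP: st; apply.
  by rewrite eq_sym eqEfcard ts sn tn leqnn.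
by exists g.
Qed.

End LeftTranslation.

Section PartialAction.
Variables (R : realType) (G : groupType) (A : cstarAlgType R).
Variable al : partial_action G A.
Implicit Types (x y z a : A) (g h k : G) (s t : {fset G}).
Local Notation D := (pdom al).
Local Notation act := (pact al).

Let idD g : closed_ideal (D g). Proof. exact: pdom_ideal. Qed.

Lemma actD g x y : D (g^-1)%g x -> D (g^-1)%g y -> act g (x + y) = act g x + act g y.
Proof. by case: (pact_hom al g) => h _ _ _; exact: h. Qed.
Lemma actZ g (c : R[i]) x : D (g^-1)%g x -> act g (c *: x) = c *: act g x.
Proof. by case: (pact_hom al g) => _ h _ _; exact: h. Qed.
Lemma actM g x y : D (g^-1)%g x -> D (g^-1)%g y ->
  act g (amul x y) = amul (act g x) (act g y).
Proof. by case: (pact_hom al g) => _ _ h _; exact: h. Qed.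
Lemma act_star g x : D (g^-1)%g x -> act g (astar x) = astar (act g x).
Proof. by case: (pact_hom al g) => _ _ _ h; exact: h. Qed.
Lemma act0 g : act g 0 = 0.
Proof. by rewrite -(scale0r (0 : A)) actZ ?scale0r //; exact: ideal0. Qed.
Lemma act_sum g (J : eqType) (r : seq J) (F : J -> A) :
  (forall j, j \in r -> D (g^-1)%g (F j)) ->
  act g (\sum_(j <- r) F j) = \sum_(j <- r) act g (F j).
Proof.
elim: r => [|j r IH] DF; first by rewrite !big_nil act0.
rewrite !big_cons actD ?IH //; first by move=> i ir; apply: DF; rewrite inE ir orbT.
  by apply: DF; rewrite inE eqxx.
by apply: ideal_sum => // i ir _; apply: DF; rewrite inE ir orbT.
Qed.

Lemma act_in g x : D (g^-1)%g x -> D g (act g x).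
Proof. by case: (pact_bij al g) => h _ _; exact: h. Qed.

Lemma act_comp g h x : D (h^-1)%g x -> D (g^-1)%g (act h x) ->
  act (g * h)%g x = act g (act h x).
Proof. by move=> hx gx; case: (pact_ext hx gx). Qed.

Lemma actK g x : D (g^-1)%g x -> act (g^-1)%g (act g x) = x.
Proof.
move=> gx; rewrite -act_comp ?mulVg ?pact1 //.
by rewrite invgK; exact: act_in.
Qed.

Lemma actVK g x : D g x -> act g (act (g^-1)%g x) = x.
Proof. by move=> gx; rewrite -{1}(invgK g) actK // invgK. Qed.

Lemma act_dom g h x : D (h^-1)%g x -> D g x -> D (h * g)%g (act h x).
Proof.
move=> hx gx; have gx' : D (g^-1)%g^-1%g x by rewrite invgK.
have y_dom : D (g^-1)%g (act (g^-1)%g x) by exact: act_in.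
have yE : act g (act (g^-1)%g x) = x by exact: actVK.
have [hgy <-] : D (h * g)^-1%g (act (g^-1)%g x) /\ act (h * g)%g (act (g^-1)%g x) = act h x.
  by rewrite -{3}yE; apply: pact_ext => //; rewrite yE.
exact: act_in.
Qed.

Lemma tdom_ideal t : closed_ideal (tdom al t).
Proof. exact: ideal_bigcap. Qed.

Lemma act_tdom g t x : (g^-1)%g \in t -> tdom al t x ->
  tdom al (ltrans g t) (act g x).
Proof.
move=> gt tx h /=; rewrite mem_ltrans => ht; rewrite -(mulVKg g h).
by apply: act_dom; exact: tx.
Qed.

Section Decomposition.
Variables (n : nat) (al_dec : decomposition_property al n).
Local Notation T := (tuples1 G n).

Lemma tdom_pdom0 t g x : T t -> g \notin t -> tdom al t x -> D g x -> x = 0.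
Proof.
move=> Tt gt tx gx; have [_ /(_ t g Tt gt) h] := al_dec.
by have : [set 0] x by rewrite -h.
Qed.

Lemma tdom_orth s t x y : T s -> T t -> s != t -> tdom al s x -> tdom al t y ->
  amul x y = 0.
Proof.
move=> Ts Tt st sx ty; have [g gt gs] := tuples1_diff Ts Tt st.
apply: (tdom_pdom0 Ts gs); first exact: (idealMr (tdom_ideal s)).
by apply: idealMl => //; exact: ty.
Qed.

Lemma dec_approx x (e : R) : 0 < e ->
  exists (F : {fset {fset G}}) (f : {fset G} -> A),
    (forall s, s \in F -> T s /\ tdom al s (f s)) /\ nr (x - \sum_(s <- F) f s) <= e.
Proof.
move=> e0; have [h _] := al_dec.
have [|y [F [f [Ff ->]]] xy] := closure_approx (I := subspace_sum T (tdom al)) (x := x) _ e0.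
  by rewrite h.
by exists F, f.
Qed.

Lemma tdom_faithful w :
  (forall t y, T t -> tdom al t y -> amul y w = 0) -> w = 0.
Proof.
move=> w0; apply: cstar_eq0; apply: (@nr_small0 _ _ _ (nr w)) => e e0.
have [F [f [Ff fw]]] := dec_approx (astar w) e0.
have fw0 : amul (\sum_(s <- F) f s) w = 0.
  rewrite amul_suml big_seq big1 // => s sF; have [Ts fs] := Ff s sF.
  exact: (w0 s).
rewrite -[amul _ _]subr0 -fw0 -amulBl; apply: le_trans (nrM _ _) _.
by rewrite mulrC ler_wpM2l ?nr_ge0.
Qed.

(** [z] is the component of [x] in [tdom al t]. Being characterized by products, it
    is unique, and its algebraic properties follow from uniqueness. *)
Let component t x z := tdom al t z /\ forall y, tdom al t y -> amul y z = amul y x.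

Let component_le t x z : component t x z -> nr z <= nr x.
Proof.
move=> [tz zx]; apply: cstar_contract; apply: zx.
exact: (idealMr (tdom_ideal t)).
Qed.

Let componentB t x x' z z' :
  component t x z -> component t x' z' -> component t (x - x') (z - z').
Proof.
move=> [tz zx] [tz' zx']; split; first exact: (idealB (tdom_ideal t)).
by move=> y ty; rewrite !amulBr zx ?zx'.
Qed.

Let component_sum t (F : {fset {fset G}}) (f : {fset G} -> A) : T t ->
  (forall s, s \in F -> T s /\ tdom al s (f s)) ->
  component t (\sum_(s <- F) f s) (if t \in F then f t else 0).
Proof.
move=> Tt Ff; split.
  by case: ifP => [/Ff[] //|_]; exact: (ideal0 (tdom_ideal t)).
move=> y ty; rewrite amul_sumr.
have orth s : s \in F -> s != t -> amul y (f s) = 0.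
  by move=> /Ff[Ts sf] st; apply: (tdom_orth Tt Ts) => //; rewrite eq_sym.
case: ifPn => tF; last first.
  rewrite amul0r big_seq big1 // => s sF; apply: orth => //.
  by apply: contraNneq tF => <-.
rewrite (big_fsetD1 t) //= big_seq big1 ?addr0 // => s.
by rewrite !inE => /andP[? ?]; exact: orth.
Qed.

Lemma component_exists t x : T t -> exists z, component t x z.
Proof.
move=> Tt.
have [|e d y z|l lP] := complete_approx
    (P := fun d z => exists2 x', component t x' z & nr (x - x') <= d).
- move=> e e0; have [F [f [Ff fx]]] := dec_approx x e0.
  by exists (if t \in F then f t else 0), (\sum_(s <- F) f s) => //; exact: component_sum.
- move=> [x' cx' xx'] [x'' cx'' xx''].
  apply: le_trans (component_le (componentB cx' cx'')) _.
  apply: le_trans (nr_distD x _ _) _; rewrite (nr_distC x' x).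
  exact: lerD.
have approx e : 0 < e ->
    exists x' z, [/\ component t x' z, nr (x - x') <= e & nr (z - l) <= e].
  move=> e0; have [F [f [Ff fx]]] := dec_approx x e0.
  exists (\sum_(s <- F) f s), (if t \in F then f t else 0).
  have cz := component_sum Tt Ff; split=> //.
  by apply: lP; exists (\sum_(s <- F) f s).
exists l; split.
  apply: closed_approx; first exact: (ideal_closed (tdom_ideal t)).
  move=> e e0; have [x' [z [[tz _] _ zl]]] := approx _ e0.
  by exists z; rewrite // nr_distC.
move=> y ty; apply/eqP; rewrite -subr_eq0; apply/eqP.
apply: (@nr_small0 _ _ _ (2 * nr y)) => e e0.
have [x' [z [[tz zx'] xx' zl]]] := approx _ e0.
have -> : amul y l - amul y x = amul y (l - z) + amul y (x' - x).
  by rewrite !amulBr zx' // subrKA.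
apply: le_trans (nrD _ _) _.
have := nrM y (l - z); have := nrM y (x' - x); have := nr_ge0 y.
rewrite (nr_distC l) (nr_distC x'); move: (nr y) (nr (z - l)) (nr (x - x')) zl xx'.
by move=> a b c *; nra.
Qed.

Definition pr t x : A := xget 0 [set z | component t x z].

Lemma pr_component t x : T t -> component t x (pr t x).
Proof.
move=> Tt; have [z cz] := component_exists x Tt.
by rewrite /pr; case: xgetP => [? -> //|/(_ z)].
Qed.

Lemma pr_tdom t x : T t -> tdom al t (pr t x).
Proof. by move=> Tt; case: (pr_component x Tt). Qed.

Lemma pr_mull t x y : T t -> tdom al t y -> amul y (pr t x) = amul y x.
Proof. by move=> Tt; case: (pr_component x Tt) => _ h; exact: h. Qed.

Lemma pr_eq t x z : T t -> tdom al t z ->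
  (forall y, tdom al t y -> amul y z = amul y x) -> pr t x = z.
Proof.
move=> Tt tz zx; apply/eqP; rewrite -subr_eq0; apply/eqP/cstar_regular.
set w := _ - z; have tw : tdom al t w.
  by apply: (idealB (tdom_ideal t)) => //; exact: pr_tdom.
have tww : tdom al t (amul w (astar w)) by exact: (idealMr (tdom_ideal t)).
by rewrite /w amulBr -/w pr_mull // zx // subrr.
Qed.

Lemma pr_le t x : T t -> nr (pr t x) <= nr x.
Proof. by move=> Tt; apply: (@component_le t); exact: pr_component. Qed.

Lemma pr_mulr t x y : T t -> tdom al t y -> amul (pr t x) y = amul x y.
Proof.
move=> Tt ty; have idt := tdom_ideal t.
have <- : pr t (amul x y) = amul (pr t x) y.
  apply: pr_eq => //; first exact: (idealMl idt).
  by move=> z tz; rewrite !amulA pr_mull.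
by apply: pr_eq => //; exact: (idealMl idt).
Qed.

Lemma prD t x y : T t -> pr t (x + y) = pr t x + pr t y.
Proof.
move=> Tt; apply: pr_eq => //.
  by apply: (idealD (tdom_ideal t)); exact: pr_tdom.
by move=> z tz; rewrite !amulDr !pr_mull.
Qed.

Lemma prZ t (c : R[i]) x : T t -> pr t (c *: x) = c *: pr t x.
Proof.
move=> Tt; apply: pr_eq => //.
  by apply: (idealZ (tdom_ideal t)); exact: pr_tdom.
by move=> z tz; rewrite !amulZr !pr_mull.
Qed.

Lemma pr0 t : T t -> pr t 0 = 0.
Proof. by move=> Tt; rewrite -(scale0r (0 : A)) prZ // !scale0r. Qed.

Lemma prB t x y : T t -> pr t (x - y) = pr t x - pr t y.
Proof. by move=> Tt; rewrite prD // -scaleN1r prZ // scaleN1r. Qed.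

Lemma pr_sum t (J : Type) (r : seq J) (P : pred J) (F : J -> A) : T t ->
  pr t (\sum_(j <- r | P j) F j) = \sum_(j <- r | P j) pr t (F j).
Proof.
move=> Tt; apply: big_morph; last exact: pr0.
by move=> ? ?; exact: prD.
Qed.

Lemma prM t x y : T t -> pr t (amul x y) = amul (pr t x) (pr t y).
Proof.
move=> Tt; apply: pr_eq => //.
  by apply: (idealMr (tdom_ideal t)); exact: pr_tdom.
move=> z tz; rewrite amulA pr_mull //; last by apply: (idealMr (tdom_ideal t)).
by rewrite pr_mull // amulA.
Qed.

Lemma pr_id t x : T t -> tdom al t x -> pr t x = x.
Proof. by move=> Tt tx; exact: pr_eq. Qed.

Lemma pr_orth s t x : T s -> T t -> s != t -> tdom al t x -> pr s x = 0.
Proof.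
move=> Ts Tt st tx; apply: pr_eq => //; first exact: (ideal0 (tdom_ideal s)).
by move=> y sy; rewrite amul0r (tdom_orth Ts Tt).
Qed.

Lemma pr_pdom0 t g x : T t -> g \notin t -> D g x -> pr t x = 0.
Proof.
move=> Tt gt gx; apply: pr_eq => //; first exact: (ideal0 (tdom_ideal t)).
move=> y ty; rewrite amul0r; apply/esym/(tdom_pdom0 Tt gt).
  exact: (idealMr (tdom_ideal t)).
exact: idealMl.
Qed.

(** For [x] in [tdom al t], all components of [astar x] but the one at [t] vanish:
    for y in another summand yx* is in that summand too, so that yx*x = 0 by
    orthogonality, and hence yx* = 0. *)
Lemma tdom_star t x : T t -> tdom al t x -> tdom al t (astar x).
Proof.
move=> Tt tx; suff -> : astar x = pr t (astar x) by exact: pr_tdom.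
apply/eqP; rewrite -subr_eq0; apply/eqP/tdom_faithful => s y Ts sy.
have [ts|st] := eqVneq t s; first by rewrite amulBr pr_mull ?subrr ?ts.
rewrite amulBr (tdom_orth Ts Tt _ sy (pr_tdom _ Tt)) 1?eq_sym // subr0.
apply: cstar_eq0r; rewrite astarM astarK amulA.
rewrite [amul _ x](tdom_orth Ts Tt) 1?eq_sym ?amul0l //.
exact: (idealMr (tdom_ideal s)).
Qed.

Lemma pr_star t x : T t -> pr t (astar x) = astar (pr t x).
Proof.
move=> Tt; apply: pr_eq => //; first by apply: tdom_star => //; exact: pr_tdom.
move=> y ty; apply: (can_inj (@astarK R A)); rewrite !astarM !astarK.
by rewrite pr_mulr //; exact: tdom_star.
Qed.

(** A finite sum of summands that approximates [x] may be replaced by the components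
    of [x] there, since the projection onto finitely many summands is contractive. *)
Lemma pr_approx x (e : R) : 0 < e -> exists2 F : {fset {fset G}},
  (forall s, s \in F -> T s) & nr (x - \sum_(s <- F) pr s x) <= e.
Proof.
move=> e0; have [|F [f [Ff fx]]] := dec_approx x (e := e / 2); first by rewrite divr_gt0.
have TF s : s \in F -> T s by move=> /Ff[].
exists F => //; set Q := fun y => \sum_(s <- F) pr s y.
have Q_le y : nr (Q y) <= nr y.
  apply: cstar_contract; rewrite {1 4}/Q !amul_suml; apply: eq_big_seq => s sF.
  have Ts := TF s sF; have a_s : tdom al s (amul (pr s y) (astar (Q y))).
    by apply: (idealMr (tdom_ideal s)); exact: pr_tdom.
  move: (amul (pr s y) _) a_s => a a_s.
  rewrite /Q amul_sumr (big_fsetD1 s) //= big_seq big1 ?addr0 ?pr_mull // => u.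
  rewrite !inE => /andP[us /TF Tu].
  by apply: (tdom_orth Ts Tu _ a_s (pr_tdom _ Tu)); rewrite eq_sym.
have QB y z : Q (y - z) = Q y - Q z.
  rewrite /Q -sumrB; apply: eq_big_seq => s /TF Ts; exact: prB.
have Qf : Q (\sum_(s <- F) f s) = \sum_(s <- F) f s.
  apply: eq_big_seq => s sF; have [Ts fs] := Ff s sF.
  rewrite pr_sum // (big_fsetD1 s) //= big_seq big1 ?addr0 ?pr_id // => u.
  by rewrite !inE => /andP[us /Ff[Tu fu]]; apply: (pr_orth Ts Tu) => //; rewrite eq_sym.
have -> : x - Q x = (x - \sum_(s <- F) f s) - Q (x - \sum_(s <- F) f s).
  by rewrite QB Qf opprB addrA subrK.
apply: le_trans (nrB _ _) _; have := Q_le (x - \sum_(s <- F) f s); lra.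
Qed.

Lemma pr_pdom t g x : T t -> D g x -> D g (pr t x).
Proof.
move=> Tt gx; have [gt|gt] := boolP (g \in t); first exact: pr_tdom.
by rewrite (pr_pdom0 Tt gt gx); exact: ideal0.
Qed.

(** The components of [x] in [pdom al g] sit in the summands contained in
    [pdom al g], and these are self-adjoint. *)
Lemma pdom_star g x : D g x -> D g (astar x).
Proof.
move=> gx; apply: closed_approx; first exact: ideal_closed.
move=> e e0; have [F TF Fx] := pr_approx x e0.
exists (astar (\sum_(s <- F) pr s x)); last by rewrite -astarB nr_star.
rewrite astar_sum; apply: ideal_sum => // s /TF Ts _.
have [gt|gt] := boolP (g \in s).
  by rewrite -pr_star //; exact: pr_tdom.
by rewrite (pr_pdom0 Ts gt gx) astar0; exact: ideal0.
Qed.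

(** [act g] maps the defining property of the component at [t] to that of the
    component at [ltrans g t]. *)
Lemma pr_act g t x : T t -> (g^-1)%g \in t -> D (g^-1)%g x ->
  pr (ltrans g t) (act g x) = act g (pr t x).
Proof.
move=> Tt gt gx; have Tgt := tuples1_ltrans Tt gt.
apply: pr_eq => //; first by apply: act_tdom => //; exact: pr_tdom.
move=> y gty; have g_gt : g \in ltrans g t by rewrite mem_ltrans mulVg (tuples1_1 Tt).
have gy : D g y by exact: gty.
have ty : tdom al t (act (g^-1)%g y).
  by rewrite -(ltransK g t); apply: act_tdom; rewrite ?invgK.
rewrite -(actVK gy) -!actM ?pr_mull //; first by exact: ty.
- exact: ty.
- by have := pr_tdom x Tt; apply.
Qed.

End Decomposition.
End PartialAction.

(** * Algebraic crossed products *)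

Section Carrier.
Variables (R : realType) (G : groupType) (A : cstarAlgType R).
Variable al : partial_action G A.
Implicit Types (a : A) (g h k : G) (s t : {fset G}) (x y : G -> A).
Local Notation D := (pdom al).
Local Notation act := (pact al).

Lemma cp_carrierP (K : set G) (J : set A) x : cp_carrier al K J x <->
  [/\ exists W : {fset G}, forall g, g \notin W -> x g = 0,
      forall g, ~ K g -> x g = 0
    & forall g, J (x g) /\ D g (x g)].
Proof.
split=> [[finx xK xJ]|[[W xW] xK xJ]]; split=> //.
- exists (fset_set [set g | x g <> 0]) => g; rewrite in_fset_set // => /negP gW.
  by apply: contrapT => xg; apply: gW; rewrite inE.
- by move=> g Kg; apply: contrapT => /xK.
- apply: (sub_finite_set _ (finite_fset W)) => g /= xg.
  by apply: contrapT => /negP /xW.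
- by move=> g xg; apply: contrapT => /xK.
Qed.

Lemma cp_mulE (W : {fset G}) x y k : (forall g, g \notin W -> x g = 0) ->
  cp_mul al x y k =
    \sum_(g <- W) act g (amul (act (g^-1)%g (x g)) (y (g^-1 * k)%g)).
Proof.
by move=> xW; apply: fsbigTE => g /xW ->; rewrite act0 amul0l act0.
Qed.

(** Both factors of the term of index [g] lie in the domain of [act g], and the
    second one is moved into the domain of index [k]. *)
Lemma cp_term_dom x y g k : D g (x g) -> D (g^-1 * k)%g (y (g^-1 * k)%g) ->
  let a := amul (act (g^-1)%g (x g)) (y (g^-1 * k)%g) in
  D (g^-1)%g a /\ D k (act g a).
Proof.
move=> xg yg a; have idD h := pdom_ideal al h.
have ga : D (g^-1)%g a.
  by apply: (idealMr (idD _)); apply: act_in; rewrite invgK.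
split=> //; rewrite -(mulVKg g k); apply: act_dom => //.
exact: (idealMl (idD _)).
Qed.

(** What makes [cp_carrier al K J] a *-algebra, for a subgroup [K]. Closed ideals
    are self-adjoint in general, but for the ideals below this follows directly from
    the orthogonal decomposition. *)
Definition invariant_ideal (K : set G) (J : set A) :=
  [/\ closed_ideal J, forall a, J a -> J (astar a)
    & forall g a, K g -> J a -> D (g^-1)%g a -> J (act g a)].

Definition subgroup_set (K : set G) :=
  [/\ K 1%g, forall g h, K g -> K h -> K (g * h)%g & forall g, K g -> K (g^-1)%g].

Lemma subgroup_setT : subgroup_set setT.
Proof. by []. Qed.

Section Closure.
Variables (K : set G) (J : set A).
Hypotheses (KG : subgroup_set K) (KJ : invariant_ideal K J).
Hypothesis D_star : forall g a, D g a -> D g (astar a).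

Let idJ : closed_ideal J. Proof. by case: KJ. Qed.
Let idD g : closed_ideal (D g). Proof. exact: pdom_ideal. Qed.

Lemma carrierD x y : cp_carrier al K J x -> cp_carrier al K J y ->
  cp_carrier al K J (x + y).
Proof.
move=> /cp_carrierP [[W xW] xK xJ] /cp_carrierP [[V yV] yK yJ].
apply/cp_carrierP; split=> [|g Kg|g].
- exists (W `|` V)%fset => g; rewrite inE negb_or => /andP[gW gV].
  by rewrite [LHS](_ : _ = x g + y g) // xW // yV // addr0.
- by rewrite [LHS](_ : _ = x g + y g) // xK // yK // addr0.
- by have [? ?] := xJ g; have [? ?] := yJ g; split; apply: idealD.
Qed.

Lemma carrierZ (c : R[i]) x : cp_carrier al K J x -> cp_carrier al K J (c *: x).
Proof.
move=> /cp_carrierP [[W xW] xK xJ]; apply/cp_carrierP; split=> [|g Kg|g].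
- by exists W => g gW; rewrite [LHS](_ : _ = c *: x g) // xW // scaler0.
- by rewrite [LHS](_ : _ = c *: x g) // xK // scaler0.
- by have [? ?] := xJ g; split; apply: idealZ.
Qed.

Lemma carrier0 : cp_carrier al K J 0.
Proof.
apply/cp_carrierP; split=> [|//|g]; first by exists fset0.
by split; exact: ideal0.
Qed.

Lemma carrier_sum (I : Type) (r : seq I) (P : pred I) (F : I -> G -> A) :
  (forall i, P i -> cp_carrier al K J (F i)) ->
  cp_carrier al K J (\sum_(i <- r | P i) F i).
Proof.
by move=> SF; apply: big_ind => //; [exact: carrier0 | exact: carrierD].
Qed.

Lemma carrier_star x : cp_carrier al K J x -> cp_carrier al K J (cp_star al x).
Proof.
case: KG => _ _ KV; case: KJ => _ J_star J_act.
move=> /cp_carrierP [[W xW] xK xJ]; apply/cp_carrierP; split=> [|g Kg|g].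
- exists (tinv W) => g; rewrite mem_tinv => /xW gW.
  by rewrite /cp_star gW astar0 act0.
- by rewrite /cp_star xK ?astar0 ?act0 // => /KV; rewrite invgK.
- have [Jx Dx] := xJ (g^-1)%g; have Dxs := D_star Dx.
  split; last exact: act_in.
  have [Kg|/= Kg] := pselect (K g); first by apply: J_act => //; exact: J_star.
  rewrite /cp_star xK ?astar0 ?act0; first exact: ideal0.
  by move=> /KV; rewrite invgK.
Qed.

(** The carrier of [J] is a left ideal of that of [setT]; this is what makes the
    closure of an orbit an ideal of the crossed product. *)
Lemma carrier_mul x y : cp_carrier al K setT x -> cp_carrier al K J y ->
  cp_carrier al K J (cp_mul al x y).
Proof.
case: KG => _ KM KV; case: KJ => _ _ J_act.
move=> /cp_carrierP [[W xW] xK xJ] /cp_carrierP [[V yV] yK yJ].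
apply/cp_carrierP; split=> [|k Kk|k].
- exists [fset (g * h)%g | g in W, h in V]%fset => k kWV.
  rewrite (cp_mulE _ _ xW) big_seq big1 // => g gW.
  rewrite yV ?amul0r ?act0 //; apply: contra kWV => kV.
  by rewrite -(mulVKg g k); exact: in_imfset2.
- rewrite (cp_mulE _ _ xW) big1 // => g _.
  have [Kg|Kg] := pselect (K g); last by rewrite xK // act0 amul0l act0.
  rewrite yK ?amul0r ?act0 // => Kgk; apply: Kk.
  by rewrite -(mulVKg g k); exact: KM.
- have term g := cp_term_dom (proj2 (xJ g)) (proj2 (yJ (g^-1 * k)%g)).
  rewrite (cp_mulE _ _ xW); split; apply: ideal_sum => // g _ _; last by case: (term g).
  have [Kg|Kg] := pselect (K g).
    apply: J_act => //; last by case: (term g).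
    by apply: (idealMl idJ); case: (yJ (g^-1 * k)%g).
  by rewrite xK // act0 amul0l act0; exact: ideal0.
Qed.

End Closure.

Lemma carrier_sub (K : set G) (J J' : set A) x : J `<=` J' ->
  cp_carrier al K J x -> cp_carrier al K J' x.
Proof. by move=> JJ' [? ? xJ]; split=> // g; have [? ?] := xJ g; split=> //; exact: JJ'. Qed.

End Carrier.

Section Corner.
Variables (R : realType) (G : groupType) (A : cstarAlgType R).
Variable al : partial_action G A.
Variables (n : nat) (al_dec : decomposition_property al n).
Variables (t : {fset G}) (Tt : tuples1 G n t).
Implicit Types (a : A) (g h k : G) (s : {fset G}) (x y b c : G -> A).
Local Notation T := (tuples1 G n).
Local Notation D := (pdom al).
Local Notation act := (pact al).
Local Notation H := (tstab t).

Let idD g : closed_ideal (D g). Proof. exact: pdom_ideal. Qed.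
Let D_star g a : D g a -> D g (astar a). Proof. exact: (pdom_star al_dec). Qed.

Lemma tstab_subgroup : subgroup_set H.
Proof.
split; rewrite /tstab /=; first exact: ltrans1.
  by move=> g h gt ht; rewrite ltransM ht gt.
by move=> g gt; rewrite -{1}gt ltransK.
Qed.

Let H1 : H 1%g. Proof. by case: tstab_subgroup. Qed.
Let HM g h : H g -> H h -> H (g * h)%g. Proof. by case: tstab_subgroup => _ + _; apply. Qed.
Let HV g : H g -> H (g^-1)%g. Proof. by case: tstab_subgroup => _ _; apply. Qed.

Lemma mem_tstab h g : H h -> ((h * g)%g \in t) = (g \in t).
Proof. by move=> Hh; rewrite -{1}Hh mem_ltrans mulKg. Qed.

Lemma tstab_sub h : H h -> h \in t.
Proof. by move=> Hh; rewrite -(mulg1 h) mem_tstab //; exact: tuples1_1 Tt. Qed.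

Lemma tdom_invariant : invariant_ideal al H (tdom al t).
Proof.
split; [exact: tdom_ideal | by move=> a; exact: (tdom_star al_dec) |].
move=> h a Hh ta _; rewrite -[t]Hh; apply: act_tdom => //.
by apply: tstab_sub; exact: HV.
Qed.

(** The ideal [orbit_dom al t] (see [orbit_domE]), described by the components that
    vanish instead of by finite sums: closedness and invariance are then immediate,
    and no choice of representatives is involved. *)
Definition orbit_ideal : set A :=
  [set a | forall s, T s -> ~ (exists g, s = ltrans g t) -> pr al s a = 0].

Lemma orbit_ideal_invariant : invariant_ideal al setT orbit_ideal.
Proof.
split; first split.
- move=> a ca s Ts st; apply: (@nr_small0 _ _ _ 1) => e e0.
  have [y oy ay] := closure_approx ca e0.
  rewrite -[pr al s a]subr0 -(oy s Ts st) -(prB al_dec) // mul1r.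
  by apply: le_trans ay; exact: (pr_le al_dec).
- by move=> s Ts _; rewrite (pr0 al_dec).
- by move=> a b oa ob s Ts st; rewrite (prD al_dec) // oa // ob // addr0.
- by move=> c a oa s Ts st; rewrite (prZ al_dec) // oa // scaler0.
- by move=> a b ob; split=> s Ts st; rewrite (prM al_dec) // ob // ?amul0l ?amul0r.
- by move=> a oa s Ts st; rewrite (pr_star al_dec) // oa // astar0.
move=> g a _ oa Da s Ts st.
have [gs|gs] := boolP (g \in s); last first.
  by apply: (pr_pdom0 al_dec Ts gs); exact: act_in.
have Ts' : T (ltrans (g^-1)%g s) by apply: tuples1_ltrans; rewrite ?invgK.
rewrite -(ltransVK g s) (pr_act al_dec) //; last first.
  by rewrite mem_ltrans invgK mulgV; exact: tuples1_1 Ts.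
rewrite oa ?act0 // => -[h hE]; apply: st; exists (g * h)%g.
by rewrite ltransM -hE ltransVK.
Qed.

Lemma orbit_dom_sub : orbit_dom al t `<=` orbit_ideal.
Proof.
move=> _ [F [f [Ff ->]]] s Ts st; rewrite (pr_sum al_dec) // big_seq big1 // => g gF.
have [gt fg] := Ff g gF; rewrite /= mem_tinv in gt.
have Tgt := tuples1_ltrans Tt gt.
apply: (pr_orth al_dec Ts Tgt) => //; apply/eqP => sE; apply: st; by exists g.
Qed.

Variables (k : nat) (gs : 'I_k -> G).
Hypothesis gs_in : forall i, ((gs i)^-1)%g \in t.
Hypothesis gs_cover : forall u, (u^-1)%g \in t -> exists i, H ((gs i)^-1 * u)%g.
Hypothesis gs_inj : forall i j, H ((gs i)^-1 * gs j)%g -> i = j.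
Implicit Types (i j l : 'I_k).
Local Notation tr i := (ltrans (gs i) t).

Let Ttr i : T (tr i). Proof. exact: tuples1_ltrans. Qed.

Let gs_tr i : gs i \in tr i.
Proof. by rewrite mem_ltrans mulVg; exact: tuples1_1 Tt. Qed.

Lemma tr_inj i j : tr i = tr j -> i = j.
Proof. by move=> ij; apply: gs_inj; rewrite /tstab /= ltransM -ij ltransK. Qed.

Lemma tr_cover s : T s -> (exists g, s = ltrans g t) -> exists i, s = tr i.
Proof.
move=> Ts [g sE]; have [|i Hi] := @gs_cover g.
  by have := tuples1_1 Ts; rewrite sE mem_ltrans mulg1.
exists i; rewrite sE -(mulVKg (gs i) g) ltransM; congr ltrans; exact: Hi.
Qed.

Lemma orbit_ideal_sum a : orbit_ideal a -> a = \sum_i pr al (tr i) a.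
Proof.
move=> oa; apply/eqP; rewrite -subr_eq0; apply/eqP.
apply: (tdom_faithful al_dec) => s y Ts sy.
rewrite -(pr_mull al_dec _ Ts sy) (prB al_dec) // (pr_sum al_dec) //.
have [st|st] := pselect (exists g, s = ltrans g t); last first.
  rewrite oa // big1 ?subr0 ?amul0r // => i _.
  apply: (pr_orth al_dec Ts (Ttr i)); last exact: (pr_tdom al_dec).
  by apply/eqP => sE; apply: st; exists (gs i).
have [i ->] := tr_cover Ts st; rewrite (bigD1 i) //= big1 ?addr0.
  by rewrite [X in _ - X](pr_id al_dec) ?subrr ?amul0r //; exact: (pr_tdom al_dec).
move=> j ji; apply: (pr_orth al_dec (Ttr i) (Ttr j)); last exact: (pr_tdom al_dec).
by apply: contra_neq ji => /tr_inj ->.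
Qed.

Lemma orbit_domE : orbit_dom al t = orbit_ideal.
Proof.
apply/seteqP; split; first exact: orbit_dom_sub.
move=> a oa; exists [fset gs i | i : 'I_k]%fset, (fun g => pr al (ltrans g t) a).
split.
  move=> g /imfsetP [i _ ->]; split; first by rewrite /= mem_tinv.
  exact: (pr_tdom al_dec).
rewrite big_imfset /=; last by move=> i j _ _ ij; apply: gs_inj; rewrite ij mulVg.
by rewrite {1}(orbit_ideal_sum oa) big_enum.
Qed.

(** The products gs i * h * (gs j)^-1, for h in the stabilizer, are the distinct
    elements of [tr i]. *)
Lemma mem_tr i j h : H h -> (gs i * h * (gs j)^-1)%g \in tr i.
Proof. by move=> Hh; rewrite mem_ltrans -mulgA mulKg mem_tstab. Qed.

Lemma tr_coset i g : g \in tr i -> exists j, H ((gs i)^-1 * g * gs j)%g.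
Proof.
rewrite mem_ltrans => gt; have [|j Hj] := @gs_cover (((gs i)^-1 * g)^-1)%g.
  by rewrite invgK.
by exists j; have := HV Hj; rewrite invgM !invgK.
Qed.

Lemma tr_coset_uniq i j l g :
  H ((gs i)^-1 * g * gs j)%g -> H ((gs i)^-1 * g * gs l)%g -> j = l.
Proof.
move=> Hj Hl; apply: gs_inj; have := HM (HV Hj) Hl.
by rewrite !invgM invgK -!mulgA mulVKg mulKg.
Qed.

(** The matrix coefficients of the isomorphism, and its inverse on matrix units
    tensored with [b]: formally, [Psi i j b] is (delta (gs i)) b (delta (gs j))^-1. *)
Definition Phi x i j : G -> A := fun h =>
  if `[< H h >] then act ((gs i)^-1)%g (pr al (tr i) (x (gs i * h * (gs j)^-1)%g))
  else 0.

Definition Psi i j b : G -> A := fun g => act (gs i) (b ((gs i)^-1 * g * gs j)%g).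

Let pr_gs i a : D (gs i) (pr al (tr i) a).
Proof. by apply: (pr_tdom al_dec a (Ttr i)); exact: gs_tr. Qed.

Lemma Phi_tdom x i j h : tdom al t (Phi x i j h).
Proof.
rewrite /Phi; case: asboolP => _; last exact: (ideal0 (tdom_ideal al t)).
rewrite -[X in tdom al X](ltransK (gs i)); apply: act_tdom; rewrite ?invgK //.
exact: (pr_tdom al_dec).
Qed.

Lemma Phi_carrier x i j : cp_carrier al setT setT x ->
  cp_carrier al H (tdom al t) (Phi x i j).
Proof.
move=> /cp_carrierP [[W xW] _ xJ]; apply/cp_carrierP; split=> [|h Hh|h].
- exists [fset ((gs i)^-1 * g * gs j)%g | g in W]%fset => h hW.
  rewrite /Phi; case: asboolP => // Hh; rewrite xW ?(pr0 al_dec) ?act0 //.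
  apply: contra hW => hW; apply/imfsetP.
  by exists (gs i * h * (gs j)^-1)%g; rewrite //= -!mulgA mulKg mulVg mulg1.
- by rewrite /Phi; case: asboolP.
- split; first exact: Phi_tdom.
  have [Hh|Hh] := pselect (H h); first by apply: (Phi_tdom x i j h); exact: tstab_sub.
  by rewrite /Phi; case: asboolP => // _; exact: ideal0.
Qed.

Lemma PhiD x y i j : Phi (x + y) i j = Phi x i j + Phi y i j.
Proof.
apply/funext => h; rewrite [RHS](_ : _ = Phi x i j h + Phi y i j h) // /Phi.
case: asboolP => _; last by rewrite addr0.
by rewrite (prD al_dec) // actD ?invgK.
Qed.

Lemma PhiZ (c : R[i]) x i j : Phi (c *: x) i j = c *: Phi x i j.
Proof.
apply/funext => h; rewrite [RHS](_ : _ = c *: Phi x i j h) // /Phi.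
case: asboolP => _; last by rewrite scaler0.
by rewrite (prZ al_dec) // actZ ?invgK.
Qed.

Lemma act_comp_tdom g h s a : (h^-1)%g \in s -> (g^-1)%g \in ltrans h s ->
  tdom al s a -> act (g * h)%g a = act g (act h a).
Proof.
move=> hs ghs sa; apply: act_comp; first exact: sa.
exact: (act_tdom hs sa).
Qed.

Lemma sum_fctE (I : Type) (r : seq I) (P : pred I) (F : I -> G -> A) g :
  (\sum_(i <- r | P i) F i) g = \sum_(i <- r | P i) F i g.
Proof. by apply: (big_morph (fun x : G -> A => x g)). Qed.

(** Both sides move a product of elements of [tdom al (tr l)]: first by g and then by
    (gs i)^-1 on the left, first by (gs l)^-1 and then by k on the right. *)
Let Phi_term x y i l j g h : D g (x g) ->
  D (g^-1 * (gs i * h * (gs j)^-1))%g (y (g^-1 * (gs i * h * (gs j)^-1))%g) ->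
  H h -> H ((gs i)^-1 * g * gs l)%g ->
  let k := ((gs i)^-1 * g * gs l)%g in
  act ((gs i)^-1)%g (pr al (tr i) (act g
    (amul (act (g^-1)%g (x g)) (y (g^-1 * (gs i * h * (gs j)^-1))%g)))) =
  act k (amul (act (k^-1)%g (Phi x i l k)) (Phi y l j (k^-1 * h)%g)).
Proof.
move=> Dx Dy Hh Hk k'.
have gk : g = (gs i * k' * (gs l)^-1)%g by rewrite /k' -!mulgA mulVKg mulgV mulg1.
have gVk : (g^-1 = gs l * k'^-1 * (gs i)^-1)%g by rewrite gk !invgM invgK mulgA.
have g_tr : g \in tr i by rewrite gk mem_tr.
have gV_tr : (g^-1)%g \in tr l by rewrite gVk mem_tr //; exact: HV.
have tr_lt : ltrans g (tr l) = tr i by rewrite -ltransM gk mulgVK ltransM Hk.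
have tr_il : ltrans (g^-1)%g (tr i) = tr l by rewrite -tr_lt ltransK.
have [Dz _] := cp_term_dom Dx Dy.
rewrite -tr_lt (pr_act al_dec) // (prM al_dec) // -{1}tr_il (pr_act al_dec) ?invgK //.
rewrite /Phi asboolT // asboolT; last by apply: HM => //; exact: HV.
rewrite -/k' -gk.
have -> : (gs l * (k'^-1 * h) * (gs j)^-1 = g^-1 * (gs i * h * (gs j)^-1))%g.
  by rewrite gVk -!mulgA mulKg.
set p := pr al (tr i) (x g); set q := pr al (tr l) (y _).
have pi_ : tdom al (tr i) p by exact: (pr_tdom al_dec).
have ql : tdom al (tr l) q by exact: (pr_tdom al_dec).
have ul : tdom al (tr l) (act (g^-1)%g p).
  by rewrite -tr_il; apply: act_tdom; rewrite ?invgK.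
have -> : act (k'^-1)%g (act ((gs i)^-1)%g p) = act ((gs l)^-1)%g (act (g^-1)%g p).
  rewrite -(act_comp_tdom (s := tr i)) ?invgK ?ltransK //; last exact: tstab_sub.
  rewrite -(act_comp_tdom (s := tr i)) ?invgK ?tr_il //.
  by rewrite gVk -!mulgA mulKg.
have D_l a : tdom al (tr l) a -> D ((gs l)^-1)^-1%g a.
  by rewrite invgK => /(_ (gs l) (gs_tr l)).
rewrite -actM; [|exact: D_l|exact: D_l].
have uq : tdom al (tr l) (amul (act (g^-1)%g p) q).
  exact: (idealMl (tdom_ideal al _)).
rewrite -(act_comp_tdom (s := tr l)) ?invgK ?tr_lt //.
rewrite -(act_comp_tdom (s := tr l)) ?invgK ?ltransK //; last first.
  by apply: tstab_sub; exact: HV.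
by congr act; rewrite /k' mulgK.
Qed.

(** Of the terms of the product in the crossed product, the projection onto
    [tdom al (tr i)] keeps those whose index g lies in [tr i]; such a g determines
    the summation indices l and k of the matrix product. *)
Lemma PhiM x y i j : cp_carrier al setT setT x -> cp_carrier al setT setT y ->
  Phi (cp_mul al x y) i j = \sum_l cp_mul al (Phi x i l) (Phi y l j).
Proof.
move=> Sx Sy; apply/funext => h; rewrite sum_fctE.
have [Hh|Hh] := pselect (H h); last first.
  rewrite /Phi asboolF // big1 // => l _.
  have /cp_carrierP [_ xy0 _] := carrier_mul tstab_subgroup tdom_invariant
    (carrier_sub (@subsetT _ _) (Phi_carrier i l Sx)) (Phi_carrier l j Sy).
  exact: xy0.
have /cp_carrierP [[W xW] _ xJ] := Sx; have /cp_carrierP [_ _ yJ] := Sy.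
rewrite {1}/Phi asboolT // (cp_mulE _ _ _ xW) (pr_sum al_dec) // act_sum; last first.
  by move=> g _; rewrite invgK.
have xWl l m : m \notin [fset ((gs i)^-1 * g * gs l)%g | g in W]%fset -> Phi x i l m = 0.
  move=> mW; rewrite /Phi; case: asboolP => // Hm.
  rewrite xW ?(pr0 al_dec) ?act0 //; apply: contra mW => mW; apply/imfsetP.
  by exists (gs i * m * (gs l)^-1)%g; rewrite //= -!mulgA mulKg mulVg mulg1.
under [RHS]eq_bigr => l _.
  rewrite (cp_mulE _ _ _ (xWl l)) big_imfset /=; last first.
    by move=> g g' _ _ /mulIg /mulgI.
  over.
rewrite exchange_big /=; apply: eq_bigr => g _.
have Phi_g l : (gs i * ((gs i)^-1 * g * gs l) * (gs l)^-1 = g)%g.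
  by rewrite -!mulgA mulVKg mulgV mulg1.
have Phi0 l : ~ H ((gs i)^-1 * g * gs l)%g -> Phi x i l ((gs i)^-1 * g * gs l)%g = 0.
  by move=> Hl; rewrite /Phi asboolF.
have [gi|gi] := boolP (g \in tr i); last first.
  rewrite (pr_pdom0 al_dec (Ttr i) gi) ?act0; last first.
    apply: act_in.
    by case: (cp_term_dom (proj2 (xJ g)) (proj2 (yJ (g^-1 * (gs i * h * (gs j)^-1))%g))).
  rewrite big1 // => l _; rewrite Phi0 ?act0 ?amul0l ?act0 // => Hl.
  by move/negP: gi; apply; rewrite -(Phi_g l) mem_tr.
have [l Hl] := tr_coset gi; rewrite (bigD1 l) //= big1 ?addr0.
  by apply: Phi_term Hh Hl; [case: (xJ g) | case: (yJ (g^-1 * (gs i * h * (gs j)^-1))%g)].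
move=> m ml; rewrite Phi0 ?act0 ?amul0l ?act0 // => Hm.
by move/eqP: ml; apply; exact: tr_coset_uniq Hm Hl.
Qed.

Lemma Phi_star x i j : cp_carrier al setT setT x ->
  Phi (cp_star al x) i j = cp_star al (Phi x j i).
Proof.
move=> /cp_carrierP [_ _ xJ]; apply/funext => h; rewrite /cp_star /Phi.
have [Hh|Hh] := pselect (H h); last first.
  by rewrite asboolF // asboolF ?astar0 ?act0 // => /HV; rewrite invgK.
rewrite asboolT // asboolT; last exact: HV.
set g := (gs i * h * (gs j)^-1)%g.
have gV : (g^-1 = gs j * h^-1 * (gs i)^-1)%g by rewrite !invgM invgK mulgA.
rewrite -gV; have gV_tr : (g^-1)%g \in tr j by rewrite gV mem_tr //; exact: HV.
have tr_ji : ltrans g (tr j) = tr i by rewrite -ltransM mulgVK ltransM Hh.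
have Dx : D (g^-1)%g (astar (x (g^-1)%g)) by apply: D_star; case: (xJ (g^-1)%g).
rewrite -{1}tr_ji (pr_act al_dec) // (pr_star al_dec) //.
set q := pr al (tr j) _; have qj : tdom al (tr j) q by exact: (pr_tdom al_dec).
have qj' : tdom al (tr j) (astar q) by exact: (tdom_star al_dec).
have Dq : D ((gs j)^-1)^-1%g q by rewrite invgK; exact: (qj (gs j) (gs_tr j)).
rewrite -act_star //.
rewrite -(act_comp_tdom (s := tr j)) ?invgK ?tr_ji //.
rewrite -(act_comp_tdom (s := tr j)) ?invgK ?ltransK //; last first.
  by apply: tstab_sub; exact: HV.
by congr act; rewrite /g -!mulgA mulKg.
Qed.

Lemma Psi_carrier b i j : cp_carrier al H (tdom al t) b ->
  cp_carrier al setT orbit_ideal (Psi i j b).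
Proof.
move=> /cp_carrierP [[W bW] bH bJ].
have Psi_tr g : tdom al (tr i) (Psi i j b g).
  by apply: act_tdom => //; case: (bJ ((gs i)^-1 * g * gs j)%g).
apply/cp_carrierP; split=> [|g /(_ I) //|g].
- exists [fset (gs i * h * (gs j)^-1)%g | h in W]%fset => g gW.
  rewrite /Psi bW ?act0 //; apply: contra gW => gW; apply/imfsetP.
  by exists ((gs i)^-1 * g * gs j)%g; rewrite //= -!mulgA mulVKg mulgV mulg1.
- split.
    move=> s Ts st; apply: (pr_orth al_dec Ts (Ttr i)) => //.
    by apply/eqP => sE; apply: st; exists (gs i).
  have [Hg|Hg] := pselect (H ((gs i)^-1 * g * gs j)%g); last first.
    by rewrite /Psi bH // act0; exact: ideal0.
  apply: (Psi_tr g); have := mem_tr i j Hg.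
  by rewrite /= -!mulgA mulVKg mulgV mulg1.
Qed.

Lemma PhiPsi b i j i' j' : cp_carrier al H (tdom al t) b ->
  Phi (Psi i j b) i' j' = if (i == i') && (j == j') then b else 0.
Proof.
move=> /cp_carrierP [_ bH bJ]; apply/funext => h.
have b_tr g : tdom al (tr i) (act (gs i) (b g)).
  by apply: act_tdom => //; case: (bJ g).
rewrite /Phi; case: asboolP => Hh; last by case: ifP => // _; rewrite bH.
rewrite /Psi; have [<-|ii'] := eqVneq i i'; last first.
  rewrite (pr_orth al_dec (Ttr i') (Ttr i)) ?act0 //.
  by apply: contra_neq ii' => /tr_inj ->.
rewrite (pr_id al_dec) // actK; last first.
  by case: (bJ ((gs i)^-1 * (gs i * h * (gs j')^-1) * gs j)%g) => + _;
    apply; exact: gs_in.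
have [<-|jj'] := eqVneq j j'.
  by rewrite /= -!mulgA mulKg mulVg mulg1.
rewrite /= bH // -!mulgA mulKg => Hj; move/eqP: jj'; apply; apply/esym/gs_inj.
by have := HM (HV Hh) Hj; rewrite mulKg.
Qed.

Lemma PsiPhi x : cp_carrier al setT orbit_ideal x ->
  x = \sum_i \sum_j Psi i j (Phi x i j).
Proof.
move=> /cp_carrierP [_ _ xJ]; apply/funext => g; rewrite sum_fctE.
have [og Dg] := xJ g; rewrite {1}(orbit_ideal_sum og); apply: eq_bigr => i _.
rewrite sum_fctE; have PsiE j : Psi i j (Phi x i j) g =
    if `[< H ((gs i)^-1 * g * gs j)%g >] then pr al (tr i) (x g) else 0.
  rewrite /Psi /Phi; case: asboolP => Hg; last by rewrite act0.
  rewrite actVK //; congr (pr al _ (x _)).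
  by rewrite -!mulgA mulVKg mulgV mulg1.
have [gi|gi] := boolP (g \in tr i); last first.
  rewrite (pr_pdom0 al_dec (Ttr i) gi) // big1 // => j _; rewrite PsiE.
  by rewrite (pr_pdom0 al_dec (Ttr i) gi) // if_same.
have [j Hj] := tr_coset gi; rewrite (bigD1 j) //= PsiE asboolT // big1 ?addr0 //.
move=> l lj; rewrite PsiE asboolF // => Hl.
by move/eqP: lj; apply; exact: tr_coset_uniq Hl Hj.
Qed.

Lemma PsiD b c i j : cp_carrier al H (tdom al t) b -> cp_carrier al H (tdom al t) c ->
  Psi i j (b + c) = Psi i j b + Psi i j c.
Proof.
move=> /cp_carrierP [_ _ bJ] /cp_carrierP [_ _ cJ]; apply/funext => g.
by apply: actD; [case: (bJ ((gs i)^-1 * g * gs j)%g) |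
  case: (cJ ((gs i)^-1 * g * gs j)%g)] => + _; apply; exact: gs_in.
Qed.

Lemma PsiZ (u : R[i]) b i j : cp_carrier al H (tdom al t) b ->
  Psi i j (u *: b) = u *: Psi i j b.
Proof.
move=> /cp_carrierP [_ _ bJ]; apply/funext => g.
by apply: actZ; case: (bJ ((gs i)^-1 * g * gs j)%g) => + _; apply; exact: gs_in.
Qed.

(** [Phi] is injective on [orbit_ideal], by [PsiPhi]: identities there may be
    checked in the matrix algebra. *)
Lemma Phi_inj x y : cp_carrier al setT orbit_ideal x ->
  cp_carrier al setT orbit_ideal y -> (forall i j, Phi x i j = Phi y i j) -> x = y.
Proof.
move=> Sx Sy xy; rewrite (PsiPhi Sx) (PsiPhi Sy).
by apply: eq_bigr => i _; apply: eq_bigr => j _; rewrite xy.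
Qed.

Let subT x : cp_carrier al setT orbit_ideal x -> cp_carrier al setT setT x.
Proof. exact: carrier_sub. Qed.

Let carrierM_H b c : cp_carrier al H (tdom al t) b -> cp_carrier al H (tdom al t) c ->
  cp_carrier al H (tdom al t) (cp_mul al b c).
Proof.
move=> Sb; apply: (carrier_mul tstab_subgroup tdom_invariant).
exact: carrier_sub Sb.
Qed.

Lemma PsiM b c i j l : cp_carrier al H (tdom al t) b ->
  cp_carrier al H (tdom al t) c ->
  cp_mul al (Psi i j b) (Psi j l c) = Psi i l (cp_mul al b c).
Proof.
move=> Sb Sc; have Sbc := carrierM_H Sb Sc.
have [Pb Pc] := (Psi_carrier i j Sb, Psi_carrier j l Sc).
apply: Phi_inj; last 1 first.
- move=> i' l'; rewrite (PhiM _ _ (subT Pb) (subT Pc)) PhiPsi //.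
  have cp0l y : cp_mul al 0 y = 0.
    by apply/funext => g; rewrite (@cp_mulE _ _ _ al fset0) // big_seq_fset0.
  have cp0r y : cp_carrier al H (tdom al t) y -> cp_mul al y 0 = 0.
    move=> /cp_carrierP [[W yW] _ _]; apply/funext => g.
    by rewrite (cp_mulE _ _ _ yW) big1 // => h _; rewrite amul0r act0.
  rewrite (bigD1 j) //= big1 ?addr0 => [|m mj].
    rewrite !PhiPsi // !eqxx /= andbT; case: eqP => // _.
      by case: eqP => //= _; exact: cp0r.
  rewrite PhiPsi // [j == m]eq_sym (negPf mj) andbF; exact: cp0l.
- exact: (carrier_mul (@subgroup_setT _) orbit_ideal_invariant (subT Pb) Pc).
- exact: Psi_carrier.
Qed.

Lemma Psi_star b i j : cp_carrier al H (tdom al t) b ->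
  cp_star al (Psi i j b) = Psi j i (cp_star al b).
Proof.
move=> Sb; have Pb := Psi_carrier i j Sb.
have Sbs : cp_carrier al H (tdom al t) (cp_star al b).
  exact: (carrier_star tstab_subgroup tdom_invariant).
apply: Phi_inj; last 1 first.
- move=> i' j'; rewrite (Phi_star _ _ (subT Pb)) !PhiPsi // andbC.
  by case: ifP => // _; apply/funext => g; rewrite /cp_star astar0 act0.
- exact: (carrier_star (@subgroup_setT _) orbit_ideal_invariant).
- exact: Psi_carrier.
Qed.

End Corner.

(** * Extension by continuity *)

Section Lipschitz.
Variable R : realType.
Implicit Types E F : normedModType R[i].

Definition lip E F (f : E -> F) :=
  exists2 C : R, 0 <= C & forall x y, nr (f x - f y) <= C * nr (x - y).

Definition dense_in E (X : set E) :=
  forall x (e : R), 0 < e -> exists2 y, X y & nr (x - y) <= e.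

Lemma lip_dense_eq E F (f g : E -> F) (X : set E) :
  lip f -> lip g -> dense_in X -> (forall x, X x -> f x = g x) ->
  forall x, f x = g x.
Proof.
move=> [C C0 fC] [C' C'0 gC] dX fg x; apply/eqP; rewrite -subr_eq0; apply/eqP.
apply: (@nr_small0 _ _ _ (C + C')) => e e0; have [y Xy xy] := dX x e e0.
apply: le_trans (nr_distD (f y) _ _) _; rewrite {2}(fg y Xy) mulrDl; apply: lerD.
  by apply: le_trans (fC _ _) _; rewrite ler_wpM2l.
by apply: le_trans (gC _ _) _; rewrite ler_wpM2l // nr_distC.
Qed.

Lemma lip_id E : lip (@id E).
Proof. by exists 1 => // x y; rewrite mul1r. Qed.

Lemma lip_cst E F (a : F) : lip (fun _ : E => a).
Proof. by exists 0 => // x y; rewrite subrr nr0 mul0r. Qed.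

Lemma lipD E F (f g : E -> F) : lip f -> lip g -> lip (fun x => f x + g x).
Proof.
move=> [C C0 fC] [C' C'0 gC]; exists (C + C'); first exact: addr_ge0.
move=> x y; rewrite opprD addrACA mulrDl.
by apply: le_trans (nrD _ _) _; exact: lerD.
Qed.

Lemma lip_sum E F (I : Type) (r : seq I) (f : I -> E -> F) :
  (forall i, lip (f i)) -> lip (fun x => \sum_(i <- r) f i x).
Proof.
move=> lf; elim: r => [|i r IH].
  by under eq_fun do rewrite big_nil; exact: lip_cst.
by under eq_fun do rewrite big_cons; exact: lipD.
Qed.

Lemma lip_comp E F (K : normedModType R[i]) (g : F -> K) (f : E -> F) :
  lip g -> lip f -> lip (fun x => g (f x)).
Proof.
move=> [C C0 gC] [C' C'0 fC]; exists (C * C'); first exact: mulr_ge0.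
move=> x y; apply: le_trans (gC _ _) _; rewrite -mulrA ler_wpM2l //.
Qed.

Lemma lip_scale E F (c : R[i]) : lip (fun x : E => c *: x).
Proof.
exists (complex.Re `|c|); first exact: Re_norm_ge0.
move=> x y; rewrite -scalerBr -lecR rmorphM /= -normC_ReE -!nrE normrZ //.
Qed.

Lemma lip_mulr (A : cstarAlgType R) (a : A) : lip (fun x => amul x a).
Proof.
exists (nr a); first exact: nr_ge0.
by move=> x y; rewrite -amulBl mulrC nrM.
Qed.

Lemma lip_mull (A : cstarAlgType R) (a : A) : lip (amul a).
Proof.
exists (nr a); first exact: nr_ge0.
by move=> x y; rewrite -amulBr nrM.
Qed.

Lemma lip_star (A : cstarAlgType R) : lip (@astar R A).
Proof. by exists 1 => // x y; rewrite -astarB nr_star mul1r. Qed.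

Lemma lip_additive E F (f : E -> F) (C : R) : 0 <= C ->
  (forall x y, f (x + y) = f x + f y) -> (forall c x, f (c *: x) = c *: f x) ->
  (forall x, nr (f x) <= C * nr x) -> lip f.
Proof.
move=> C0 fD fZ fC; exists C => // x y.
by rewrite -[f x - f y](_ : f (x - y) = _) // fD -scaleN1r fZ scaleN1r.
Qed.

End Lipschitz.

Section Extension.
Variables (R : realType) (V : lmodType R[i]) (S : set V).
Hypotheses (SD : forall x y, S x -> S y -> S (x + y))
           (SZ : forall (c : R[i]) x, S x -> S (c *: x)).
Variables (E : normedModType R[i]) (F : completeNormedModType R[i]).
Variables (iota : V -> E) (L : V -> F).

Definition linear_on (W : lmodType R[i]) (f : V -> W) :=
  (forall x y, S x -> S y -> f (x + y) = f x + f y) /\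
  (forall (c : R[i]) x, S x -> f (c *: x) = c *: f x).

Hypotheses (iota_lin : linear_on iota) (L_lin : linear_on L).
Hypothesis iota_dense : dense_in (iota @` S).
Hypothesis L_le : forall x, S x -> nr (L x) <= nr (iota x).

Let L_dist x y : S x -> S y -> nr (L x - L y) <= nr (iota x - iota y).
Proof.
case: iota_lin => iD iZ; case: L_lin => LD LZ Sx Sy.
rewrite -(scaleN1r (L y)) -(scaleN1r (iota y)) -iZ // -LZ // -iD -?LD ?L_le //;
  try exact: SZ.
by apply: SD => //; exact: SZ.
Qed.

Let limit e : exists l, forall x, S x -> nr (L x - l) <= nr (iota x - e).
Proof.
have [|d d' y z|l lP] := complete_approx
    (P := fun d y => exists x, [/\ S x, y = L x & nr (iota x - e) <= d]).
- move=> d d0; have [_ [x Sx <-] ex] := iota_dense e d0.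
  by exists (L x), x; rewrite nr_distC.
- move=> [x [Sx -> ex]] [x' [Sx' -> ex']].
  apply: le_trans (L_dist Sx Sx') _; apply: le_trans (nr_distD e _ _) _.
  by rewrite (nr_distC e); exact: lerD.
by exists l => x Sx; apply: lP; exists x.
Qed.

Lemma extension : exists f : E -> F,
  [/\ forall x, S x -> f (iota x) = L x,
      forall x y, f (x + y) = f x + f y,
      forall (c : R[i]) x, f (c *: x) = c *: f x
    & forall x, nr (f x) <= nr x].
Proof.
have [f fP] := choice limit; case: iota_lin => iD iZ; case: L_lin => LD LZ.
have f_iota x : S x -> f (iota x) = L x.
  move=> Sx; apply/eqP; rewrite eq_sym -subr_eq0; apply/eqP/nr_eq0/eqP.
  by rewrite eq_le nr_ge0 (le_trans (fP _ _ Sx)) // subrr nr0.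
have f_dist x y : nr (f x - f y) <= nr (x - y).
  rewrite -subr_le0; apply: le_eps0 => e e0.
  have [|_ [u Su <-] xu] := iota_dense x (e := e / 4); first lra.
  have [|_ [v Sv <-] yv] := iota_dense y (e := e / 4); first lra.
  have h1 := fP x u Su; have h2 := fP y v Sv; have h3 := L_dist Su Sv.
  have h4 := nr_distD (L u) (f x) (f y); have h5 := nr_distD (L v) (L u) (f y).
  have h6 := nr_distD x (iota u) (iota v); have h7 := nr_distD y x (iota v).
  rewrite (nr_distC (f x) (L u)) in h4.
  rewrite (nr_distC (iota u) x) in h1 h6; rewrite (nr_distC (iota v) y) in h2.
  lra.
have f_lip : lip f by exists 1 => // x y; rewrite mul1r; exact: f_dist.
exists f; split=> //.
- move=> x y; apply: (lip_dense_eq (f := fun x => f (x + y))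
    (g := fun x => f x + f y) _ _ iota_dense _ x).
  + by apply: lip_comp => //; apply: lipD; [exact: lip_id | exact: lip_cst].
  + by apply: lipD => //; exact: lip_cst.
  move=> _ [u Su <-]; apply: (lip_dense_eq (f := fun y => f (iota u + y))
    (g := fun y => f (iota u) + f y) _ _ iota_dense _ y).
  + by apply: lip_comp => //; apply: lipD; [exact: lip_cst | exact: lip_id].
  + by apply: lipD => //; exact: lip_cst.
  by move=> _ [v Sv <-]; rewrite -iD // !f_iota ?LD //; exact: SD.
- move=> c x; apply: (lip_dense_eq (f := fun x => f (c *: x))
    (g := fun x => c *: f x) _ _ iota_dense _ x).
  + by apply: lip_comp => //; exact: lip_scale.
  + by apply: lip_comp => //; exact: lip_scale.
  by move=> _ [u Su <-]; rewrite -iZ // !f_iota ?LZ //; exact: SZ.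
- have [u0 Su0] : exists u, S u.
    by have [_ [u Su _] _] := iota_dense 0 ltr01; exists u.
  have f0 : f 0 = 0.
    rewrite -(scale0r (iota u0)) -iZ // f_iota; last exact: SZ.
    by rewrite LZ // scale0r.
  by move=> x; have := f_dist x 0; rewrite f0 !subr0.
Qed.

End Extension.

Section Enveloping.
Variables (R : realType) (V : lmodType R[i]) (o : star_ops V) (S : set V).
Variables (E : cstarAlgType R) (iota : V -> E).
Hypothesis envE : is_enveloping o S iota.

Lemma enveloping_hom : star_hom_on o (ops_of E) S iota.
Proof. by case: envE. Qed.

Lemma enveloping_linear : linear_on S iota.
Proof. by case: enveloping_hom. Qed.

Lemma enveloping_dense : dense_in (iota @` S).
Proof.
case: envE => _ cl _ x e e0; apply: closure_approx => //.
by rewrite cl.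
Qed.

Lemma enveloping_max (p : V -> R) x : rcstar_seminorm_on o S p -> S x ->
  p x <= nr (iota x).
Proof.
move=> pS Sx; case: envE => _ _ /(_ x Sx) [ub _].
rewrite -lecR -nrE; apply: ub; exists (fun x => (p x)%:C%C) => //.
exact: complex_cstar_seminorm.
Qed.

Lemma star_hom_on_sum (I : Type) (r : seq I) (F : I -> V) :
  S 0 -> (forall x y, S x -> S y -> S (x + y)) -> (forall i, S (F i)) ->
  iota (\sum_(i <- r) F i) = \sum_(i <- r) iota (F i).
Proof.
move=> S0 SD SF; case: enveloping_linear => iD iZ.
suff [] : S (\sum_(i <- r) F i) /\ iota (\sum_(i <- r) F i) = \sum_(i <- r) iota (F i) by [].
elim: r => [|i r [Sr IH]].
  by rewrite !big_nil -(scale0r (0 : V)) iZ // !scale0r.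
by rewrite !big_cons iD // IH; split=> //; exact: SD.
Qed.

End Enveloping.

(** * The corner of an orbit *)

Section OrbitCorner.
Variables (R : realType) (G : groupType) (A : cstarAlgType R).
Variable al : partial_action G A.
Variables (n : nat) (al_dec : decomposition_property al n).
Variables (t : {fset G}) (Tt : tuples1 G n t).
Variables (k : nat) (gs : 'I_k -> G).
Hypothesis gs_in : forall i, ((gs i)^-1)%g \in t.
Hypothesis gs_cover :
  forall u, (u^-1)%g \in t -> exists i, tstab t ((gs i)^-1 * u)%g.
Hypothesis gs_inj : forall i j, tstab t ((gs i)^-1 * gs j)%g -> i = j.
Variable J : set A.
Hypotheses (J_inv : invariant_ideal al setT J) (orbit_J : orbit_ideal al n t `<=` J).
Variables (E B : cstarAlgType R) (iE : (G -> A) -> E) (iB : (G -> A) -> B).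
Hypothesis envE : is_crossed_product al setT J iE.
Hypothesis envB : is_crossed_product al (tstab t) (tdom al t) iB.
Local Notation SJ := (cp_carrier al setT J).
Local Notation SO := (cp_carrier al setT (orbit_ideal al n t)).
Local Notation SB := (cp_carrier al (tstab t) (tdom al t)).
Local Notation phi := (Phi al t gs).
Local Notation psi := (Psi al gs).
Local Notation M := (cmatrix B k).
Implicit Types (x y b c : G -> A) (e : E) (T : M).

Let D_star g a : pdom al g a -> pdom al g (astar a). Proof. exact: (pdom_star al_dec). Qed.
Let GT : subgroup_set [set: G]. Proof. exact: subgroup_setT. Qed.
Let H_grp := tstab_subgroup t.
Let tdom_inv := tdom_invariant al_dec Tt.
Let orb_inv := orbit_ideal_invariant al_dec t.
Let SO_SJ x : SO x -> SJ x. Proof. exact: carrier_sub. Qed.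
Let SJ_T x : SJ x -> cp_carrier al setT setT x. Proof. exact: carrier_sub. Qed.
Let phi_SB x i j : SJ x -> SB (phi x i j).
Proof. by move=> /SJ_T; exact: (Phi_carrier al_dec Tt gs_in). Qed.
Let psi_SO b i j : SB b -> SO (psi i j b).
Proof. exact: (Psi_carrier al_dec Tt gs_in). Qed.
Let psi_SJ b i j : SB b -> SJ (psi i j b).
Proof. by move=> Sb; apply: SO_SJ; exact: psi_SO. Qed.
Let SB_mul b c : SB b -> SB c -> SB (cp_mul al b c).
Proof.
move=> Sb; apply: (carrier_mul H_grp tdom_inv); exact: carrier_sub Sb.
Qed.

Let iED x y : SJ x -> SJ y -> iE (x + y) = iE x + iE y.
Proof. by case: (enveloping_hom envE) => h _ _ _; exact: h. Qed.
Let iEZ (c : R[i]) x : SJ x -> iE (c *: x) = c *: iE x.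
Proof. by case: (enveloping_hom envE) => _ h _ _; exact: h. Qed.
Let iEM x y : SJ x -> SJ y -> iE (cp_mul al x y) = amul (iE x) (iE y).
Proof. by case: (enveloping_hom envE) => _ _ h _; exact: h. Qed.
Let iE_star x : SJ x -> iE (cp_star al x) = astar (iE x).
Proof. by case: (enveloping_hom envE) => _ _ _ h; exact: h. Qed.
Let iBD x y : SB x -> SB y -> iB (x + y) = iB x + iB y.
Proof. by case: (enveloping_hom envB) => h _ _ _; exact: h. Qed.
Let iBZ (c : R[i]) x : SB x -> iB (c *: x) = c *: iB x.
Proof. by case: (enveloping_hom envB) => _ h _ _; exact: h. Qed.
Let iBM x y : SB x -> SB y -> iB (cp_mul al x y) = amul (iB x) (iB y).
Proof. by case: (enveloping_hom envB) => _ _ h _; exact: h. Qed.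
Let iB_star x : SB x -> iB (cp_star al x) = astar (iB x).
Proof. by case: (enveloping_hom envB) => _ _ _ h; exact: h. Qed.
Let iB0 : iB 0 = 0.
Proof. by rewrite -(scale0r (0 : G -> A)) iBZ ?scale0r //; exact: (carrier0 tdom_inv). Qed.

Let phi_mx x : M := \matrix_(i, j) iB (phi x i j).

Let phi_mx_hom :
  star_hom_on (StarOps (cp_mul al) (cp_star al)) (ops_of M) SJ phi_mx.
Proof.
split=> [x y Sx Sy|c x Sx|x y Sx Sy|x Sx]; apply/matrixP => i j; rewrite !mxE /=.
- by rewrite (PhiD al_dec Tt) // iBD //; exact: phi_SB.
- by rewrite (PhiZ al_dec Tt) // iBZ //; exact: phi_SB.
- rewrite (PhiM al_dec Tt gs_in gs_cover gs_inj _ _ (SJ_T Sx) (SJ_T Sy)).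
  rewrite (star_hom_on_sum envB) => [||? ?|l].
  + by apply: eq_bigr => l _; rewrite !mxE iBM //; exact: phi_SB.
  + exact: (carrier0 tdom_inv).
  + exact: (carrierD tdom_inv).
  + by apply: SB_mul; exact: phi_SB.
- by rewrite (Phi_star al_dec Tt gs_in _ _ (SJ_T Sx)) iB_star //; exact: phi_SB.
Qed.

(** The C*-norm of the matrices over [B] pulls back to a C*-seminorm, which the norm
    of [E] dominates. *)
Let phi_le x i j : SJ x -> nr (iB (phi x i j)) <= nr (iE x).
Proof.
move=> Sx; apply: (@le_trans _ _ (mnorm (phi_mx x))).
  by have := nr_le_mnorm (phi_mx x) i j; rewrite mxE.
apply: (enveloping_max envE (p := fun x => mnorm (phi_mx x))) => //.
apply: (cstar_seminorm_pullback _ phi_mx_hom); last exact: mnorm_cstar_seminorm.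
by move=> y Sy; exact: (carrier_star GT J_inv D_star).
Qed.

(** On the diagonal, [psi] induces a C*-seminorm, which the norm of [B] dominates;
    the other entries reduce to the diagonal ones by the C*-identity. *)
Let psi_le b i j : SB b -> nr (iE (psi i j b)) <= nr (iB b).
Proof.
have psiM := PsiM al_dec Tt gs_in gs_cover gs_inj.
have psi_star := Psi_star al_dec Tt gs_in gs_cover gs_inj.
have SB_star c : SB c -> SB (cp_star al c).
  by move=> Sc; exact: (carrier_star H_grp tdom_inv D_star).
have diag c l : SB c -> nr (iE (psi l l c)) <= nr (iB c).
  move=> Sc; apply: (enveloping_max envB (p := fun c => nr (iE (psi l l c)))) => //.
  apply: (cstar_seminorm_pullback (f := fun c => iE (psi l l c)) (B := E)
    _ _ (nr_cstar_seminorm E)) => //.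
  split=> [x y Sx Sy|u x Sx|x y Sx Sy|x Sx] /=.
  - by rewrite (PsiD gs_in) // iED //; exact: psi_SJ.
  - by rewrite (PsiZ gs_in) // iEZ //; exact: psi_SJ.
  - by rewrite -(psiM x y l l l) // iEM //; exact: psi_SJ.
  - by rewrite -(psi_star x l l) // iE_star //; exact: psi_SJ.
move=> Sb; rewrite -[_ <= _](@ler_pXn2r _ 2) ?nnegrE ?nr_ge0 //.
have Ss := SB_star _ Sb.
have psi_b := psi_SJ i j Sb; have psi_s := psi_SJ j i Ss.
rewrite -!nr_cstar -iE_star // psi_star // -iEM // psiM //.
by rewrite -iB_star // -iBM //; apply: diag; exact: SB_mul.
Qed.

(** [F] and [P] extend [phi] and [psi] by continuity. While [P] is a right inverse of
    [F], it is a left inverse only on the closure of the image of SO, which is an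
    ideal of [E]; the last two clauses express this. *)
Lemma corner_iso : exists (F : E -> M) (P : M -> E),
  [/\ star_hom F, star_hom P, cancel P F
    & [/\ forall e i j, nr (F e i j) <= nr e,
          forall x i j, SJ x -> F (iE x) i j = iB (phi x i j),
          forall T (d : R), 0 < d -> exists2 x, SO x & nr (P T - iE x) <= d,
          forall x, SO x -> P (F (iE x)) = iE x
        & forall e T, amul e (P T) = P (amul (F e) T)]].
Proof.
have SJD x y : SJ x -> SJ y -> SJ (x + y) by exact: (carrierD J_inv).
have SJZ (c : R[i]) x : SJ x -> SJ (c *: x) by exact: (carrierZ J_inv).
have SBD x y : SB x -> SB y -> SB (x + y) by exact: (carrierD tdom_inv).
have SBZ (c : R[i]) x : SB x -> SB (c *: x) by exact: (carrierZ tdom_inv).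
have denseE := enveloping_dense envE; have denseB := enveloping_dense envB.
have ext_f ij : exists f : E -> B,
    [/\ forall x, SJ x -> f (iE x) = iB (phi x ij.1 ij.2),
        forall x y : E, f (x + y) = f x + f y,
        forall (c : R[i]) (x : E), f (c *: x) = c *: f x
      & forall x : E, nr (f x) <= nr x].
  apply: (extension SJD SJZ (enveloping_linear envE)) => //.
    split=> [x y Sx Sy|c x Sx].
      by rewrite (PhiD al_dec Tt) // iBD //; exact: phi_SB.
    by rewrite (PhiZ al_dec Tt) // iBZ //; exact: phi_SB.
  by move=> x; exact: phi_le.
have ext_q ij : exists q : B -> E,
    [/\ forall b, SB b -> q (iB b) = iE (psi ij.1 ij.2 b),
        forall x y : B, q (x + y) = q x + q y,
        forall (c : R[i]) (x : B), q (c *: x) = c *: q x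
      & forall x : B, nr (q x) <= nr x].
  apply: (extension SBD SBZ (enveloping_linear envB)) => //.
    split=> [x y Sx Sy|c x Sx].
      by rewrite (PsiD gs_in) // iED //; exact: psi_SJ.
    by rewrite (PsiZ gs_in) // iEZ //; exact: psi_SJ.
  by move=> b; exact: psi_le.
have [f0 f0P] := choice ext_f; have [q0 q0P] := choice ext_q.
pose f i j := f0 (i, j); pose q i j := q0 (i, j).
have f_iE i j x : SJ x -> f i j (iE x) = iB (phi x i j)
  by case: (f0P (i, j)) => h _ _ _; exact: h.
have fD i j (x y : E) : f i j (x + y) = f i j x + f i j y
  by case: (f0P (i, j)) => _ h _ _; exact: h.
have fZ i j (c : R[i]) (x : E) : f i j (c *: x) = c *: f i j x
  by case: (f0P (i, j)) => _ _ h _; exact: h.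
have f_le i j (x : E) : nr (f i j x) <= nr x
  by case: (f0P (i, j)) => _ _ _ h; exact: h.
have f_lip i j : lip (f i j) by apply: (lip_additive ler01) => // x; rewrite mul1r.
have q_iB i j b : SB b -> q i j (iB b) = iE (psi i j b)
  by case: (q0P (i, j)) => h _ _ _; exact: h.
have qD i j (x y : B) : q i j (x + y) = q i j x + q i j y
  by case: (q0P (i, j)) => _ h _ _; exact: h.
have qZ i j (c : R[i]) (x : B) : q i j (c *: x) = c *: q i j x
  by case: (q0P (i, j)) => _ _ h _; exact: h.
have q_le i j (x : B) : nr (q i j x) <= nr x
  by case: (q0P (i, j)) => _ _ _ h; exact: h.
have q_lip i j : lip (q i j) by apply: (lip_additive ler01) => // x; rewrite mul1r.
have f_sum i j (I : Type) (r : seq I) (v : I -> E) :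
    f i j (\sum_(l <- r) v l) = \sum_(l <- r) f i j (v l).
  by apply: big_morph => //; rewrite -(scale0r (0 : E)) fZ !scale0r.
pose F e : M := \matrix_(i, j) f i j e.
pose P T : E := \sum_i \sum_j q i j (T i j).
have FE x : SJ x -> F (iE x) = phi_mx x.
  by move=> Sx; apply/matrixP => i j; rewrite !mxE f_iE.
have f_q i j i' j' (c : B) : f i j (q i' j' c) = if (i' == i) && (j' == j) then c else 0.
  apply: (lip_dense_eq (f := fun c : B => f i j (q i' j' c))
    (g := fun c : B => if (i' == i) && (j' == j) then c else 0) _ _ denseB _ c).
  - exact: lip_comp.
  - by case: (_ && _); [exact: lip_id | exact: lip_cst].
  move=> _ [b Sb <-]; rewrite q_iB // f_iE; last exact: psi_SJ.
  rewrite (PhiPsi al_dec Tt gs_in gs_inj) //.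
  by case: ifP => // _; exact: iB0.
have FP : cancel P F.
  move=> T; apply/matrixP => i j; rewrite !mxE /P f_sum (bigD1 i) //=.
  rewrite f_sum (bigD1 j) //= f_q !eqxx big1 ?addr0 => [|l lj]; last first.
    by rewrite f_q eqxx (negPf lj).
  rewrite big1 ?addr0 // => l li; rewrite f_sum big1 // => m _.
  by rewrite f_q (negPf li).
have F_hom : star_hom F.
  split=> [x y _ _|c x _|x y _ _|x _]; apply/matrixP => i j.
  - by rewrite !mxE fD.
  - by rewrite !mxE fZ.
  - rewrite !mxE; under eq_bigr do rewrite !mxE.
    apply: (lip_dense_eq (f := fun x : E => f i j (amul x y))
      (g := fun x : E => \sum_l amul (f i l x) (f l j y)) _ _ denseE _ x).
    + by apply: lip_comp => //; exact: lip_mulr.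
    + by apply: lip_sum => l; apply: (lip_comp (lip_mulr _)).
    move=> _ [u Su <-].
    apply: (lip_dense_eq (f := fun y : E => f i j (amul (iE u) y))
      (g := fun y : E => \sum_l amul (f i l (iE u)) (f l j y)) _ _ denseE _ y).
    + by apply: lip_comp => //; exact: lip_mull.
    + by apply: lip_sum => l; apply: (lip_comp (lip_mull _)).
    move=> _ [v Sv <-]; case: phi_mx_hom => _ _ /(_ u v Su Sv) /matrixP /(_ i j) + _.
    rewrite !mxE /= -iEM // f_iE; last exact: (carrier_mul GT J_inv (SJ_T Su)).
    move=> ->; apply: eq_bigr => l _; by rewrite !mxE !f_iE.
  - rewrite !mxE; apply: (lip_dense_eq (f := fun x : E => f i j (astar x))
      (g := fun x : E => astar (f j i x)) _ _ denseE _ x).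
    + by apply: lip_comp => //; exact: lip_star.
    + by apply: lip_comp => //; exact: lip_star.
    move=> _ [u Su <-].
    rewrite -iE_star // !f_iE //; last exact: (carrier_star GT J_inv D_star).
    by rewrite (Phi_star al_dec Tt gs_in _ _ (SJ_T Su)) iB_star //; exact: phi_SB.
have PF_lip : lip (fun e => P (F e)).
  apply: lip_sum => i; apply: lip_sum => j.
  by under eq_fun do rewrite mxE; exact: lip_comp.
have PF_iE x : SO x -> P (F (iE x)) = iE x.
  move=> Sx; rewrite [in RHS](PsiPhi al_dec Tt gs_in gs_cover gs_inj Sx).
  have SJx := SO_SJ Sx; have S0 := carrier0 J_inv.
  rewrite (star_hom_on_sum envE) //; last first.
    move=> i; apply: (carrier_sum J_inv) => j _.
    by apply: psi_SJ; exact: phi_SB.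
  apply: eq_bigr => i _; rewrite (star_hom_on_sum envE) //; last first.
    by move=> j; apply: psi_SJ; exact: phi_SB.
  by apply: eq_bigr => j _; rewrite mxE f_iE // q_iB //; exact: phi_SB.
(* the closure of the image of SO: a *-ideal of E, on which P \o F is the identity *)
pose N e := forall d : R, 0 < d -> exists2 x, SO x & nr (e - iE x) <= d.
have N_fix e : N e -> P (F e) = e.
  move=> Ne; case: PF_lip => C C0 PFC; apply/eqP; rewrite -subr_eq0; apply/eqP.
  apply: (@nr_small0 _ _ _ (C + 1)) => d d0; have [x Sx ex] := Ne d d0.
  apply: le_trans (nr_distD (P (F (iE x))) _ _) _; rewrite {2}(PF_iE _ Sx) mulrDl mul1r.
  apply: lerD; last by rewrite nr_distC.
  by apply: le_trans (PFC _ _) _; rewrite ler_wpM2l.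
have SOD x y : SO x -> SO y -> SO (x + y) by exact: (carrierD orb_inv).
have N0 : N 0.
  move=> d d0; exists 0; first exact: (carrier0 orb_inv).
  have -> : iE 0 = 0.
    by rewrite -(scale0r (0 : G -> A)) iEZ ?scale0r //; exact: (carrier0 J_inv).
  by rewrite subrr nr0 ltW.
have ND e e' : N e -> N e' -> N (e + e').
  move=> Ne Ne' d d0; have [|x Sx ex] := Ne (d / 2); first lra.
  have [|y Sy ey] := Ne' (d / 2); first lra.
  exists (x + y); first exact: SOD.
  rewrite iED; [|exact: SO_SJ|exact: SO_SJ].
  by rewrite opprD addrACA; apply: le_trans (nrD _ _) _; lra.
have N_P T : N (P T).
  apply: big_ind => // i _; apply: big_ind => // j _ d d0.
  have [_ [b Sb <-] bd] := denseB (T i j) d d0.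
  exists (psi i j b); first exact: psi_SO.
  rewrite -q_iB // -[q i j _ - _](_ : q i j (T i j - iB b) = _).
    by apply: le_trans (q_le _ _ _) _.
  by rewrite qD -scaleN1r qZ scaleN1r.
have N_star e : N e -> N (astar e).
  move=> Ne d d0; have [x Sx ex] := Ne d d0.
  exists (cp_star al x); first exact: (carrier_star GT orb_inv D_star).
  by rewrite iE_star; [rewrite -astarB nr_star | exact: SO_SJ].
have N_mul e e' : N e' -> N (amul e e').
  move=> Ne' d d0.
  have d1 : 0 < d / 2 / (nr e + 1).
    by have := nr_ge0 e => ?; rewrite !divr_gt0 //; lra.
  have [x Sx ex] := Ne' _ d1.
  have d2 : 0 < d / 2 / (nr (iE x) + 1).
    by have := nr_ge0 (iE x) => ?; rewrite !divr_gt0 //; lra.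
  have [_ [y Sy <-] ey] := denseE e _ d2.
  exists (cp_mul al y x); first exact: (carrier_mul GT orb_inv (SJ_T Sy)).
  have SJx := SO_SJ Sx; rewrite iEM //; have -> : amul e e' - amul (iE y) (iE x) =
     amul e (e' - iE x) + amul (e - iE y) (iE x) by rewrite amulBr amulBl subrKA.
  apply: le_trans (nrD _ _) _.
  have h1 := nrM e (e' - iE x); have h2 := nrM (e - iE y) (iE x).
  have half (a c : R) : 0 <= a -> c <= d / 2 / (a + 1) -> a * c <= d / 2.
    move=> a0; have a1 : 0 < a + 1 by lra.
    rewrite ler_pdivlMr // => h; nra.
  have h3 := half _ _ (nr_ge0 e) ex; have h4 := half _ _ (nr_ge0 (iE x)) ey.
  lra.
have P_hom : star_hom P.
  case: F_hom => _ _ FM Fs.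
  split=> [S T _ _|c T _|S T _ _|T _].
  - rewrite -big_split; apply: eq_bigr => i _; rewrite -big_split /=.
    by apply: eq_bigr => j _; rewrite mxE qD.
  - rewrite scaler_sumr; apply: eq_bigr => i _; rewrite scaler_sumr.
    by apply: eq_bigr => j _; rewrite mxE qZ.
  - rewrite -[op_mul _ (P S) _]N_fix; last exact: N_mul.
    by rewrite FM //= !FP.
  - rewrite -[op_star _ (P T)]N_fix; last exact: N_star.
    by rewrite Fs //= FP.
exists F, P; split=> //; split=> //.
- by move=> e i j; rewrite mxE.
- by move=> x i j Sx; rewrite mxE f_iE.
- move=> e T; rewrite -[LHS]N_fix; last exact: N_mul.
  by case: F_hom => _ _ FM _; rewrite FM //= FP.
Qed.

End OrbitCorner.

(** * Representatives of an orbit *)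

Section OrbitRepresentatives.
Variables (G : groupType) (n : nat) (t : {fset G}) (Tt : tuples1 G n t).
Local Notation H := (tstab t).

Lemma finite_tstab : finite_set H.
Proof.
by apply: (sub_finite_set _ (finite_fset t)) => h /= Hh; exact: (tstab_sub Tt).
Qed.

(** All fibers of [g |-> ltrans g t] on [tinv t] are left cosets of the
    stabilizer. *)
Lemma card_orbit :
  n = (#|` [fset ltrans g t | g in tinv t]%fset| * #|` fset_set H|)%N.
Proof.
have cV : #|` tinv t| = n.
  by rewrite card_imfset /=; [case/andP: Tt => _ /eqP | exact: invg_inj].
rewrite -[LHS]cV card_fset_sum1 (partition_big_imfset _ (fun g => ltrans g t)) /=.
rewrite card_fset_sum1 big_distrl /=; apply: eq_big_seq => s /imfsetP [g0 /= g0t sE].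
rewrite mul1n big_fset_condE -card_fset_sum1.
have <- : #|` [fset (g0 * h)%g | h in fset_set H]%fset| = #|` fset_set H|.
  by rewrite card_imfset //=; exact: mulgI.
congr #|` _|; apply/fsetP => g; rewrite !inE /=; apply/andP/imfsetP => /=.
  move=> [_ /eqP gs]; exists (g0^-1 * g)%g; last by rewrite mulVKg.
  rewrite in_fset_set ?inE /tstab /=; last exact: finite_tstab.
  by rewrite ltransM gs sE ltransK.
move=> [h Hh ->]; have {}Hh : ltrans h t = t.
  by move: Hh; rewrite in_fset_set ?inE //; exact: finite_tstab.
rewrite ltransM Hh -sE eqxx; split=> //.
rewrite mem_tinv; rewrite mem_tinv in g0t; rewrite invgM mem_tstab //.
by rewrite /tstab /= -{1}Hh ltransK.
Qed.

Lemma orbit_reps : exists gs : 'I_(tmult n t).+1 -> G,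
  [/\ forall i, ((gs i)^-1)%g \in t,
      forall u, (u^-1)%g \in t -> exists i, H ((gs i)^-1 * u)%g
    & forall i j, H ((gs i)^-1 * gs j)%g -> i = j].
Proof.
set O := [fset ltrans g t | g in tinv t]%fset.
have kO : (tmult n t).+1 = #|` O|.
  rewrite /tmult {1}card_orbit mulnK.
    rewrite prednK // cardfs_gt0; apply/fset0Pn; exists t.
    by apply/imfsetP; exists 1%g; rewrite /= ?ltrans1 // mem_tinv invg1 (tuples1_1 Tt).
  rewrite cardfs_gt0; apply/fset0Pn; exists 1%g.
  by rewrite in_fset_set ?inE /tstab /= ?ltrans1 //; exact: finite_tstab.
have rep (i : 'I_(tmult n t).+1) : exists g, g \in tinv t /\ nth fset0 O i = ltrans g t.
  have : nth fset0 O i \in O by rewrite mem_nth // -kO.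
  by move=> /imfsetP [g gt gE]; exists g.
have [gs gsP] := choice rep; exists gs; split.
- by move=> i; have [+ _] := gsP i; rewrite mem_tinv.
- move=> u ut; have uO : ltrans u t \in O.
    by apply/imfsetP; exists u; rewrite //= mem_tinv.
  have iO : (index (ltrans u t) O < (tmult n t).+1)%N by rewrite kO index_mem.
  exists (Ordinal iO); rewrite /tstab /= ltransM.
  have [_] := gsP (Ordinal iO); rewrite nth_index //.
  by move: (gs _) => g ->; rewrite ltransK.
- move=> i j; rewrite /tstab /= ltransM => ij.
  have eq_tr : ltrans (gs j) t = ltrans (gs i) t by rewrite -{2}ij ltransVK.
  apply/val_inj/eqP; rewrite -(nth_uniq fset0 (s := O)) -?kO ?ltn_ord ?fset_uniq //.
  by have [_ ->] := gsP i; have [_ ->] := gsP j; rewrite eq_tr.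
Qed.

End OrbitRepresentatives.

(** * The orbit summands of the crossed product *)

Lemma dense_faithful (R : realType) (E : cstarAlgType R) (w : E) (X : set E) :
  dense_in X -> (forall y, X y -> amul w y = 0) -> w = 0.
Proof.
move=> dX w0; apply: cstar_eq0r; apply: (@nr_small0 _ _ _ (nr w)) => e e0.
have [y Xy wy] := dX (astar w) e e0.
rewrite -[amul _ _]subr0 -(w0 y Xy) -amulBr; apply: le_trans (nrM _ _) _.
by rewrite ler_wpM2l ?nr_ge0.
Qed.

Section StarHom.
Variables (R : realType) (A B : starAlgType R) (f : A -> B).
Hypothesis f_hom : star_hom f.

Lemma star_homD x y : f (x + y) = f x + f y. Proof. by case: f_hom => h _ _ _; exact: h. Qed.
Lemma star_homZ (c : R[i]) x : f (c *: x) = c *: f x.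
Proof. by case: f_hom => _ h _ _; exact: h. Qed.
Lemma star_homM x y : f (amul x y) = amul (f x) (f y).
Proof. by case: f_hom => _ _ h _; exact: h. Qed.
Lemma star_hom_star x : f (astar x) = astar (f x).
Proof. by case: f_hom => _ _ _ h; exact: h. Qed.
Lemma star_hom0 : f 0 = 0.
Proof. by rewrite -(scale0r (0 : A)) star_homZ scale0r. Qed.
Lemma star_homN x : f (- x) = - f x.
Proof. by rewrite -scaleN1r star_homZ scaleN1r. Qed.
Lemma star_homB x y : f (x - y) = f x - f y.
Proof. by rewrite star_homD star_homN. Qed.
Lemma star_hom_sum (I : Type) (r : seq I) (F : I -> A) :
  f (\sum_(i <- r) F i) = \sum_(i <- r) f (F i).
Proof. by apply: big_morph; [exact: star_homD | exact: star_hom0]. Qed.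
End StarHom.

(** [F] and [P] exhibit the matrix algebra as an ideal summand of [E], namely the
    closure of the image of the coefficients supported on the orbit of [t]. *)
Definition orbit_summand (R : realType) (G : groupType) (A E B : cstarAlgType R)
    (al : partial_action G A) (n : nat) (t : {fset G}) (J : set A)
    (iE : (G -> A) -> E) (F : E -> cmatrix B (tmult n t).+1)
    (P : cmatrix B (tmult n t).+1 -> E) : Prop :=
  [/\ star_hom F, star_hom P, cancel P F
    & [/\ forall e i j, nr (F e i j) <= nr e,
          forall x, cp_carrier al setT J x ->
            (forall g h, tuples1 G n (ltrans h t) -> pr al (ltrans h t) (x g) = 0) ->
            F (iE x) = 0,
          forall T (d : R), 0 < d ->
            exists2 x, cp_carrier al setT (orbit_ideal al n t) x & nr (P T - iE x) <= d,
          forall x, cp_carrier al setT (orbit_ideal al n t) x -> P (F (iE x)) = iE x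
        & forall e T, amul e (P T) = P (amul (F e) T)]].

Lemma orbit_summand_exists (R : realType) (G : groupType) (A E B : cstarAlgType R)
    (al : partial_action G A) (n : nat) (al_dec : decomposition_property al n)
    (t : {fset G}) (Tt : tuples1 G n t) (J : set A)
    (J_inv : invariant_ideal al setT J) (orbit_J : orbit_ideal al n t `<=` J)
    (iE : (G -> A) -> E) (iB : (G -> A) -> B) :
  is_crossed_product al setT J iE ->
  is_crossed_product al (tstab t) (tdom al t) iB ->
  exists FP : (E -> cmatrix B (tmult n t).+1) * (cmatrix B (tmult n t).+1 -> E),
    orbit_summand al J iE FP.1 FP.2.
Proof.
move=> envE envB; have [gs [gs_in gs_cover gs_inj]] := orbit_reps Tt.
have [F [P [F_hom P_hom FP [F_le F_iE P_app PF eP]]]] :=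
  corner_iso al_dec Tt gs_in gs_cover gs_inj J_inv orbit_J envE envB.
exists (F, P); split=> //; split=> //= x Sx x0.
apply/matrixP => i j; rewrite F_iE // mxE.
have -> : Phi al t gs x i j = 0.
  apply/funext => h; rewrite /Phi x0 ?act0 ?if_same //.
  exact: tuples1_ltrans.
have [_ hZ] := enveloping_linear envB.
rewrite -(scale0r (0 : G -> A)) hZ ?scale0r //.
exact: (carrier0 (tdom_invariant al_dec Tt)).
Qed.

Lemma orbit_crossed_product (R : realType) (G : groupType) (A E B : cstarAlgType R)
    (al : partial_action G A) (n : nat) (al_dec : decomposition_property al n)
    (t : {fset G}) (Tt : tuples1 G n t) (iE : (G -> A) -> E) (iB : (G -> A) -> B) :
  is_crossed_product al setT (orbit_dom al t) iE ->
  is_crossed_product al (tstab t) (tdom al t) iB ->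
  star_isomorphic E (cmatrix B (tmult n t).+1).
Proof.
have [gs [gs_in gs_cover gs_inj]] := orbit_reps Tt.
rewrite (orbit_domE al_dec Tt gs_in gs_cover gs_inj) => envE envB.
have [[F P] /= [F_hom P_hom FP [_ _ _ PF eP]]] :=
  orbit_summand_exists al_dec Tt (orbit_ideal_invariant al_dec t) (@subset_refl _ _) envE envB.
exists F; split=> //; exists P => // e.
apply/eqP; rewrite -subr_eq0; apply/eqP.
apply: (dense_faithful (enveloping_dense envE)) => _ [x Sx <-].
rewrite -PF // eP (star_homB F_hom) FP subrr amul0l.
exact: (star_hom0 P_hom).
Qed.

Section Single.
Variables (R : realType) (G : groupType) (A : cstarAlgType R).
Variable al : partial_action G A.
Variables (n : nat) (al_dec : decomposition_property al n).
Implicit Types (a b : A) (g h : G).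

Definition single g a : G -> A := fun h => if h == g then a else 0.

Lemma single_carrier (J : set A) g a : closed_ideal J -> J a -> pdom al g a ->
  cp_carrier al setT J (single g a).
Proof.
move=> idJ Ja Da; apply/cp_carrierP; split=> [|h /(_ I) //|h].
  by exists [fset g]%fset => h; rewrite inE /single => /negPf ->.
by rewrite /single; case: ifP => [/eqP -> //|_]; split; apply: ideal0 => //; exact: pdom_ideal.
Qed.

Lemma singleD g a b : single g (a + b) = single g a + single g b.
Proof.
apply/funext => h; rewrite [RHS](_ : _ = single g a h + single g b h) // /single.
by case: ifP; rewrite ?addr0.
Qed.

Lemma singleZ (c : R[i]) g a : single g (c *: a) = c *: single g a.
Proof.
apply/funext => h; rewrite [RHS](_ : _ = c *: single g a h) // /single.
by case: ifP; rewrite ?scaler0.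
Qed.

Lemma single_sum (x : G -> A) (W : {fset G}) : (forall g, g \notin W -> x g = 0) ->
  x = \sum_(g <- W) single g (x g).
Proof.
move=> xW; apply/funext => h.
rewrite (big_morph (fun y : G -> A => y h) (id1 := 0) (op1 := +%R)) //.
have [hW|hW] := boolP (h \in W).
  rewrite (big_fsetD1 h) //= /single eqxx big_seq big1 ?addr0 // => g.
  by rewrite !inE eq_sym => /andP[/negPf ->].
rewrite xW // big_seq big1 // => g gW; rewrite /single.
by case: eqP => // hg; rewrite hg gW in hW.
Qed.

Lemma single_mul_star g a : pdom al g a ->
  cp_mul al (single g a) (cp_star al (single g a)) = single 1%g (amul a (astar a)).
Proof.
move=> Da; have Ds := pdom_star al_dec Da; apply/funext => k.
rewrite (@cp_mulE _ _ _ al [fset g]%fset); last first.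
  by move=> h; rewrite inE /single => /negPf ->.
rewrite big_seq_fset1 /cp_star /single eqxx invgM invgK.
have -> : ((k^-1 * g)%g == g) = (k == 1%g).
  by rewrite -{2}(mul1g g) (inj_eq (@mulIg _ g)) invg_eq1.
case: eqP => [->|_]; last by rewrite astar0 act0 amul0r act0.
rewrite mulg1 actM ?actVK //; apply: act_in; rewrite invgK //.
Qed.

Lemma single1_mul a b :
  cp_mul al (single 1%g a) (single 1%g b) = single 1%g (amul a b).
Proof.
apply/funext => k; rewrite (@cp_mulE _ _ _ al [fset 1%g]%fset); last first.
  by move=> h; rewrite inE /single => /negPf ->.
rewrite big_seq_fset1 /single eqxx invg1 mul1g !pact1.
by case: ifP; rewrite ?amul0r.
Qed.

Lemma single1_star a : cp_star al (single 1%g a) = single 1%g (astar a).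
Proof.
apply/funext => k; rewrite /cp_star /single invg_eq1.
by case: eqP => [->|_]; rewrite ?pact1 // astar0 act0.
Qed.

Variables (E : cstarAlgType R) (iE : (G -> A) -> E).
Hypothesis envE : is_crossed_product al setT setT iE.

Lemma setT_invariant : invariant_ideal al setT setT.
Proof. by split=> //; split=> //; exact: closedT. Qed.

Let Ssingle g a : pdom al g a -> cp_carrier al setT setT (single g a).
Proof. by move=> Da; apply: single_carrier => //; case: setT_invariant. Qed.

Let iM x y : cp_carrier al setT setT x -> cp_carrier al setT setT y ->
  iE (cp_mul al x y) = amul (iE x) (iE y).
Proof. by case: (enveloping_hom envE) => _ _ h _; exact: h. Qed.

Let i_star x : cp_carrier al setT setT x -> iE (cp_star al x) = astar (iE x).
Proof. by case: (enveloping_hom envE) => _ _ _ h; exact: h. Qed.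

Let D1 a : pdom al 1%g a. Proof. by rewrite pdom1. Qed.

(** The C*-identity reduces the claim to g = 1, where it is the contractivity of
    C*-seminorms on [A]. *)
Lemma nr_single g a : pdom al g a -> nr (iE (single g a)) <= nr a.
Proof.
have [iD iZ _ _] := enveloping_hom envE.
have single1_le b : nr (iE (single 1%g b)) <= nr b.
  apply: (seminorm_contractive (p := fun b => nr (iE (single 1%g b)))).
  apply: (cstar_seminorm_pullback (f := fun b => iE (single 1%g b)) (B := E)
    _ _ (nr_cstar_seminorm E)) => //.
  split=> [x y _ _|c x _|x y _ _|x _] /=.
  - by rewrite singleD iD //; exact: Ssingle.
  - by rewrite singleZ iZ //; exact: Ssingle.
  - by rewrite -single1_mul iM //; exact: Ssingle.
  - by rewrite -single1_star i_star //; exact: Ssingle.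
move=> Da; have Sa := Ssingle Da.
rewrite -[_ <= _](@ler_pXn2r _ 2) ?nnegrE ?nr_ge0 //.
rewrite -!nr_cstarr -i_star // -iM //; last first.
  apply: (carrier_star (@subgroup_setT G) setT_invariant) => // h b.
  exact: (pdom_star al_dec).
by rewrite /= single_mul_star.
Qed.

(** By [nr_single], approximating each coefficient by its components, as in
    [pr_approx], approximates the element of the crossed product. *)
Lemma single_span (Y : set E) : Y 0 -> (forall x y, Y x -> Y y -> Y (x + y)) ->
  (forall x, (forall d : R, 0 < d -> exists2 y, Y y & nr (x - y) <= d) -> Y x) ->
  (forall s g a, tuples1 G n s -> g \in s -> tdom al s a -> Y (iE (single g a))) ->
  forall x, Y x.
Proof.
move=> Y0 YD Ycl Ys x; have [iD iZ _ _] := enveloping_hom envE.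
have i0 : iE 0 = 0.
  rewrite -(scale0r (0 : G -> A)) iZ ?scale0r //; exact: (carrier0 setT_invariant).
apply: (Ycl) => d d0; have [_ [y Sy <-] xy] := enveloping_dense envE x d0.
exists (iE y) => //; have /cp_carrierP [[W yW] _ yD] := Sy.
rewrite (single_sum yW) (star_hom_on_sum envE) //.
- apply: big_ind => // g _; have [_ Dg] := yD g.
  apply: (Ycl) => e e0; have [F TF Fy] := pr_approx al_dec (y g) e0.
  have DF : pdom al g (\sum_(s <- F) pr al s (y g)).
    apply: ideal_sum; first exact: pdom_ideal.
    by move=> s /TF Ts _; exact: (pr_pdom al_dec).
  exists (iE (single g (\sum_(s <- F) pr al s (y g)))).
    have: forall s, s \in (F : seq {fset G}) -> tuples1 G n s by [].
    elim: (F : seq {fset G}) => [|s r IH] Tr.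
      rewrite big_nil (_ : single g 0 = 0) ?i0 //.
      by apply/funext => h; rewrite /single if_same.
    have Ts : tuples1 G n s by apply: Tr; rewrite inE eqxx.
    have Tr' u : u \in r -> tuples1 G n u by move=> ur; apply: Tr; rewrite inE ur orbT.
    rewrite big_cons singleD iD; last first.
    - apply: Ssingle; apply: ideal_sum; first exact: pdom_ideal.
      by move=> u /Tr' Tu _; exact: (pr_pdom al_dec).
    - by apply: Ssingle; exact: (pr_pdom al_dec).
    apply: (YD); last exact: IH.
    have [gs|gs] := boolP (g \in s).
      by apply: (Ys s) => //; exact: (pr_tdom al_dec).
    rewrite (pr_pdom0 al_dec Ts gs) // (_ : single g 0 = 0) ?i0 //.
    by apply/funext => h; rewrite /single if_same.
  have Dd : pdom al g (y g - \sum_(s <- F) pr al s (y g)).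
    by apply: idealB => //; exact: pdom_ideal.
  apply: le_trans Fy; apply: le_trans (nr_single Dd).
  rewrite -{1}[y g](subrK (\sum_(s <- F) pr al s (y g))) singleD iD ?addrK //.
    exact: Ssingle.
  exact: Ssingle.
- exact: (carrier0 setT_invariant).
- exact: (carrierD setT_invariant).
- by move=> g; apply: Ssingle; case: (yD g).
Qed.

End Single.

(** * Orthogonal sums *)

Lemma le_pow2_bound (R : realType) (a m N : R) : 0 <= a -> 0 <= m ->
  (forall j : nat, a ^+ (2 ^ j) <= N * m ^+ (2 ^ j)) -> a <= m.
Proof.
move=> a0 m0 h; rewrite leNgt; apply/negP => ma.
have [m_eq0|m_neq0] := eqVneq m 0.
  by have := h 0; rewrite expn0 !expr1 m_eq0 mulr0; lra.
have m_gt0 : 0 < m by rewrite lt_neqAle eq_sym m_neq0.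
pose d := a / m - 1; have d0 : 0 < d by rewrite subr_gt0 ltr_pdivlMr // mul1r.
have bernoulli k : 1 + k%:R * d <= (a / m) ^+ k.
  elim: k => [|k IH]; first by rewrite mul0r addr0 expr0.
  have -> : a / m = 1 + d by rewrite /d addrC subrK.
  rewrite -[a / m](_ : 1 + d = _) in IH; last by rewrite /d addrC subrK.
  rewrite exprS -addn1 natrD; have k0 := ler0n R k.
  by move: ((1 + d) ^+ k) (k%:R) IH k0 => p q; nra.
have [j jE] : exists j : nat, N / d < j%:R.
  have [N0|N0] := leP 0 N; last first.
    by exists 1; rewrite ltr_pdivrMr // mul1r; lra.
  by exists (Num.bound (N / d)); apply: archi_boundP; rewrite divr_ge0 // ltW.
have := h j; rewrite -ler_pdivrMr ?exprn_gt0 // -expr_div_n.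
have := bernoulli (2 ^ j)%N; rewrite ltr_pdivrMr // in jE.
have : j%:R <= (2 ^ j)%:R :> R by rewrite ler_nat ltnW // ltn_expl.
by move: ((a / m) ^+ _) (j%:R) ((2 ^ j)%:R) jE => p q r *; nra.
Qed.

Section DirectSum.
Variables (R : realType) (G : groupType) (A : cstarAlgType R).
Variables (al : partial_action G A) (n : nat) (al_dec : decomposition_property al n).
Variables (E : cstarAlgType R) (iE : (G -> A) -> E).
Hypothesis envE : is_crossed_product al setT setT iE.
Variables (B : {fset G} -> cstarAlgType R) (iB : forall t, (G -> A) -> B t).
Hypothesis envB : forall t, tuples1 G n t ->
  is_crossed_product al (tstab t) (tdom al t) (iB t).

(** Translates of [t] have the same representative since the set it is chosen from
    is the same. *)
Definition orbit_rep (t : {fset G}) : {fset G} :=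
  xget fset0 [set s | tuples1 G n s /\ exists g, s = ltrans g t].

Lemma orbit_repP t : tuples1 G n t ->
  tuples1 G n (orbit_rep t) /\ exists g, orbit_rep t = ltrans g t.
Proof.
move=> Tt; rewrite /orbit_rep; case: xgetP => [s -> //|/(_ t) []].
by split=> //; exists 1%g; rewrite ltrans1.
Qed.

Lemma orbit_rep_ltrans t g : orbit_rep (ltrans g t) = orbit_rep t.
Proof.
rewrite /orbit_rep; congr (xget _ _); apply/seteqP; split=> s [Ts [h sE]].
  by split; [exact: Ts | exists (h * g)%g; rewrite ltransM].
by split; [exact: Ts | exists (h * g^-1)%g; rewrite ltransM ltransK].
Qed.

Definition reps : set {fset G} := [set t | tuples1 G n t /\ orbit_rep t = t].

Implicit Types (r s : reps) (e : E).

Let rep_T r : tuples1 G n (val r). Proof. by case: (set_valP r). Qed.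

Let M r := cmatrix (B (val r)) (tmult n (val r)).+1.

Let summand r : exists FP : (E -> M r) * (M r -> E), orbit_summand al setT iE FP.1 FP.2.
Proof.
apply: (orbit_summand_exists al_dec (rep_T r) (setT_invariant al) _ envE) => //.
exact: envB.
Qed.

Let F r : E -> M r := (projT1 (cid (summand r))).1.
Let P r : M r -> E := (projT1 (cid (summand r))).2.

Let FP_summand r : orbit_summand al setT iE (@F r) (@P r).
Proof. exact: (projT2 (cid (summand r))). Qed.

Let F_hom r : star_hom (@F r). Proof. by case: (FP_summand r). Qed.
Let P_hom r : star_hom (@P r). Proof. by case: (FP_summand r). Qed.
Let FP r : cancel (@P r) (@F r). Proof. by case: (FP_summand r). Qed.
Let F_le r e i j : nr (F r e i j) <= nr e.
Proof. by case: (FP_summand r) => _ _ _ [h _ _ _ _]; exact: h. Qed.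
Let eP r e (T : M r) : amul e (P T) = P (amul (F r e) T).
Proof. by case: (FP_summand r) => _ _ _ [_ _ _ _ h]; exact: h. Qed.

Let F_orth r s (T : M s) : r != s -> F r (P T) = 0.
Proof.
move=> rs; apply/matrixP => i j; rewrite mxE; apply: (@nr_small0 _ _ _ 1) => d d0.
case: (FP_summand s) => _ _ _ [_ _ P_app _ _].
have [x Sx PTx] := P_app T d d0.
have Sx' : cp_carrier al setT setT x by exact: carrier_sub Sx.
have Fx : F r (iE x) = 0.
  case: (FP_summand r) => _ _ _ [_ F0 _ _ _]; apply: F0 => // g h Th.
  case: Sx => _ _ /(_ g) [og _]; apply: og => // -[u uE].
  move/eqP: rs; apply; apply: val_inj.
  have [_ <-] := set_valP r; have [_ <-] := set_valP s.
  by rewrite -(orbit_rep_ltrans _ h) uE orbit_rep_ltrans.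
rewrite mul1r; have <- : F r (P T - iE x) i j = F r (P T) i j.
  by rewrite (star_homB (F_hom r)) Fx subr0.
by apply: (le_trans (F_le _ i j)).
Qed.

Let PF_le r e : nr (P (F r e)) <= nr e.
Proof.
set z := P (F r e); have z_star : astar z = P (astar (F r e)).
  by rewrite (star_hom_star (P_hom r)).
have ez : amul e (astar z) = amul z (astar z).
  by rewrite z_star eP (star_homM (P_hom r)).
have [z0|z0] := eqVneq (nr z) 0; first by rewrite z0 nr_ge0.
have z_gt0 : 0 < nr z by rewrite lt_neqAle eq_sym z0 nr_ge0.
by rewrite -(ler_pM2r z_gt0) -expr2 -nr_cstarr -ez -(nr_star z) nrM.
Qed.

Let span (Y : set E) : Y 0 -> (forall x y, Y x -> Y y -> Y (x + y)) ->
  (forall x, (forall d : R, 0 < d -> exists2 y, Y y & nr (x - y) <= d) -> Y x) ->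
  (forall r (T : M r), Y (P T)) -> forall x, Y x.
Proof.
move=> Y0 YD Ycl YP; apply: (single_span al_dec envE) => // s g a Ts gs sa.
have [Tr [h rE]] := orbit_repP Ts.
have rr_rep : orbit_rep (orbit_rep s) = orbit_rep s by rewrite {1}rE orbit_rep_ltrans.
have rr : reps (orbit_rep s) by split.
pose r : reps := exist _ (orbit_rep s) (mem_set rr).
suff <- : P (F r (iE (single g a))) = iE (single g a) by exact: YP.
case: (FP_summand r) => _ _ _ [_ _ _ PF _]; apply: PF.
have [idO _ _] := orbit_ideal_invariant al_dec (orbit_rep s).
apply: single_carrier => //; last exact: sa.
move=> u Tu us; apply: (pr_orth al_dec Tu Ts) => //; apply/eqP => ust; apply: us.
by exists (h^-1)%g; rewrite ust -[val r]/(orbit_rep s) rE ltransK.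
Qed.

(** [e] annihilates the span of all summands, as e P(T) = P(F(e) T). *)
Lemma joint_faithful e : (forall r, F r e = 0) -> e = 0.
Proof.
move=> Fe; suff /(_ (astar e)) /cstar_eq0r : forall y, amul e y = 0 by [].
apply: span => [|x y ex ey|x x_cl|r T].
- exact: amul0r.
- by rewrite amulDr ex ey addr0.
- apply: (@nr_small0 _ _ _ (nr e)) => d d0; have [y ey xy] := x_cl d d0.
  rewrite -[amul e x]subr0 -ey -amulBr; apply: le_trans (nrM _ _) _.
  by rewrite ler_wpM2l ?nr_ge0.
- by rewrite eP Fe amul0l (star_hom0 (P_hom r)).
Qed.

(** The property is stable under sums and limits, and an element of a summand has
    only one nonzero component. *)
Lemma components_vanish e (d : R) : 0 < d -> finite_set [set r | d <= nr (P (F r e))].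
Proof.
move: d; pattern e; apply: span => [d d0|x y fx fy d d0|x x_cl d d0|s T d d0].
- apply: (sub_finite_set _ (finite_set0 _)) => r /=.
  by rewrite (star_hom0 (F_hom r)) (star_hom0 (P_hom r)) nr0; lra.
- have d2 : 0 < d / 2 by lra.
  apply: (sub_finite_set _ (B := [set r | d / 2 <= nr (P (F r x))] `|`
                                 [set r | d / 2 <= nr (P (F r y))])).
    move=> r /=; rewrite (star_homD (F_hom r)) (star_homD (P_hom r)) => dxy.
    have := nrD (P (F r x)) (P (F r y)).
    have [?|?] := leP (d / 2) (nr (P (F r x))); first by left.
    by right; lra.
  by rewrite finite_setU; split; [exact: fx | exact: fy].
- have d2 : 0 < d / 2 by lra.
  have [y fy xy] := x_cl _ d2; apply: (sub_finite_set _ (fy _ d2)) => r /= dx.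
  have := nrD (P (F r (x - y))) (P (F r y)).
  rewrite -(star_homD (P_hom r)) -(star_homD (F_hom r)) subrK.
  by have := PF_le r (x - y); lra.
- apply: (sub_finite_set _ (finite_set1 s)) => r /= dr.
  apply: contrapT => /eqP rs; move: dr; rewrite F_orth //.
  by rewrite (star_hom0 (P_hom r)) nr0; lra.
Qed.

(** By orthogonality z*z is the sum of the squares of the terms of z, with as many
    terms; repeated squaring makes their number irrelevant in the triangle
    inequality ([le_pow2_bound]). *)
Lemma nr_orth_sum (W : {fset reps}) (c : forall r, M r) (m : R) : 0 <= m ->
  (forall r, r \in W -> nr (P (c r)) <= m) -> nr (\sum_(r <- W) P (c r)) <= m.
Proof.
move=> m0 cm; apply: (@le_pow2_bound _ _ _ (\sum_(r <- W) 1)) => //; first exact: nr_ge0.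
move=> j; elim: j c m m0 cm => [|j IH] c m m0 cm.
  rewrite expn0 !expr1 mulr_suml; apply: le_trans (nr_sum _ _ _) _.
  by rewrite big_seq [leRHS]big_seq; apply: ler_sum => r rW; rewrite mul1r cm.
rewrite expnS !exprM -nr_cstar.
have -> : amul (astar (\sum_(r <- W) P (c r))) (\sum_(r <- W) P (c r)) =
    \sum_(r <- W) P (amul (astar (c r)) (c r)).
  rewrite amul_sumr; apply: eq_big_seq => r rW.
  rewrite eP (star_hom_star (F_hom r)) (star_hom_sum (F_hom r)).
  rewrite (big_fsetD1 r) //= FP big_seq big1 ?addr0 // => s.
  by rewrite !inE => /andP[sr _]; apply: F_orth; rewrite eq_sym.
apply: IH; first exact: sqr_ge0.
move=> r rW; rewrite (star_homM (P_hom r)) (star_hom_star (P_hom r)) nr_cstar.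
by rewrite lerXn2r ?nnegrE ?nr_ge0 ?cm.
Qed.

(** The limit of the finite partial sums, which form a Cauchy net by
    [nr_orth_sum]. *)
Lemma orth_sum_exists (b : forall r, M r) :
  (forall d : R, 0 < d -> finite_set [set r | d <= nr (P (b r))]) ->
  exists x, forall r, F r x = b r.
Proof.
move=> fin_b.
pose approx (W : {fset reps}) (d : R) := forall r, r \notin W -> nr (P (b r)) <= d.
have ex_approx (d : R) : 0 < d -> exists W, approx W d.
  move=> d0; exists (fset_set [set r | d <= nr (P (b r))]) => r.
  rewrite in_fset_set; last exact: fin_b.
  by move=> rW; rewrite leNgt; apply: contra rW => /ltW dr; rewrite inE.
have [|d d' y z [W [dW WA ->]] [W' [dW' WA' ->]]|x xP] := complete_approx
    (P := fun d y => exists W, [/\ 0 < d, approx W d & y = \sum_(r <- W) P (b r)]).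
- move=> d d0; have [W WA] := ex_approx d d0.
  by exists (\sum_(r <- W) P (b r)), W.
- pose c r : M r := (if r \in W then b r else 0) - (if r \in W' then b r else 0).
  have sumE (V U : {fset reps}) : (V `<=` U)%fset -> \sum_(r <- V) P (b r) =
      \sum_(r <- U) P (if r \in V then b r else 0).
    move=> VU; rewrite -(big_fset_incl _ VU) => [|r _ /negPf ->]; last first.
      exact: (star_hom0 (P_hom r)).
    by apply: eq_big_seq => r ->.
  rewrite (sumE W (W `|` W')%fset (fsubsetUl _ _)).
  rewrite (sumE W' (W `|` W')%fset (fsubsetUr _ _)) -sumrB.
  under eq_bigr do rewrite -(star_homB (P_hom _)).
  apply: (nr_orth_sum (c := c)) => [|r _]; first by rewrite addr_ge0 // ltW.
  have P0 : nr (P (0 : M r)) = 0 by rewrite (star_hom0 (P_hom r)) nr0.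
  rewrite /c; case: ifPn => rW; case: ifPn => rW'; rewrite ?subrr ?subr0 ?sub0r ?P0;
    rewrite ?(star_homN (P_hom r)) ?nrN.
  + by rewrite addr_ge0 // ltW.
  + by have := WA' _ rW'; lra.
  + by have := WA _ rW; lra.
  + by rewrite addr_ge0 // ltW.
exists x => r; apply/matrixP => i j; apply/eqP; rewrite -subr_eq0; apply/eqP.
apply: (@nr_small0 _ _ _ 1) => d d0; have [W WA] := ex_approx d d0.
pose V := (r |` W)%fset.
have xV : nr (\sum_(s <- V) P (b s) - x) <= d.
  apply: xP; exists V; split=> // s; rewrite !inE negb_or => /andP[_ sW]; exact: WA.
have <- : F r (x - \sum_(s <- V) P (b s)) i j = F r x i j - b r i j.
  rewrite (star_homB (F_hom r)) (star_hom_sum (F_hom r)) !mxE; congr (_ - _).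
  rewrite (big_fsetD1 r) ?inE ?eqxx //= FP big_seq big1 ?addr0 // => s.
  by rewrite !inE => /andP[sr _]; apply: F_orth; rewrite eq_sym.
by rewrite mul1r; apply: (le_trans (F_le _ i j)); rewrite nr_distC.
Qed.

Lemma crossed_product_direct_sum : is_direct_sum E M.
Proof.
exists (fun r T => (nr (P T))%:C%C), F; split=> //.
- move=> r; split.
    apply: complex_cstar_seminorm.
    exact: (cstar_seminorm_pullback _ (P_hom r) (nr_cstar_seminorm E)).
  move=> T /complexI /nr_eq0 PT0; rewrite -(FP T) PT0; exact: (star_hom0 (F_hom r)).
- move=> x y xy; apply/eqP; rewrite -subr_eq0; apply/eqP/joint_faithful => r.
  by rewrite (star_homB (F_hom r)) xy subrr.
move=> b; split=> [[x xb] e e0|fin_b].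
  have eR : e \is Num.real by rewrite gtr0_real.
  have e0' : 0 < complex.Re e by rewrite -ltcR RRe_real.
  apply: (sub_finite_set _ (components_vanish x e0')) => r /=.
  by rewrite xb -(RRe_real eR) lecR.
apply: orth_sum_exists => d d0.
have := fin_b d%:C%C; rewrite ltcR => /(_ d0); apply: sub_finite_set => r /=.
by rewrite lecR.
Qed.

End DirectSum.

Theorem theoremC (R : realType) (G : groupType) (A : cstarAlgType R)
    (al : partial_action G A) (n : nat) (n_gt0 : (0 < n)%N)
    (al_dec : decomposition_property al n) :
  (forall t : {fset G}, tuples1 G n t ->
   forall (E B : cstarAlgType R) (iE : (G -> A) -> E) (iB : (G -> A) -> B),
     is_crossed_product al setT (orbit_dom al t) iE ->
     is_crossed_product al (tstab t) (tdom al t) iB ->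
     star_isomorphic E (cmatrix B (tmult n t).+1)) /\
  (forall (E : cstarAlgType R) (iE : (G -> A) -> E)
     (B : {fset G} -> cstarAlgType R) (iB : forall t, (G -> A) -> B t),
     is_crossed_product al setT setT iE ->
     (forall t, tuples1 G n t ->
        is_crossed_product al (tstab t) (tdom al t) (iB t)) ->
     exists2 T : set {fset G}, T `<=` tuples1 G n &
       is_direct_sum E (fun t : T => cmatrix (B (val t)) (tmult n (val t)).+1)).
Proof.
split=> [t Tt E B iE iB|E iE B iB envE envB].
  exact: (orbit_crossed_product al_dec Tt).
exists (@reps G n); first by move=> t [].
exact: (crossed_product_direct_sum al_dec envE envB).
Qed.
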